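(* Let $A\neq 0$, let $M_A\subset\mathbb{R}^6$ be the $5$-dimensional submanifold of triples of points $(x_i,y_i)$, $i=1,2,3$, in the plane spanning a triangle of signed area $A$, and let $\mathcal{D}=\mathrm{Span}(Z_1-Z_2,\,Z_3-Z_1)$ be the rank $2$ distribution on $M_A$, where $$Z_i=(x_{i+1}-x_{i+2})\,\partial_{x_i}+(y_{i+1}-y_{i+2})\,\partial_{y_i},\qquad i=1,2,3\ (\text{indices mod }3).$$ Then: (1) The Lie algebra of all (local infinitesimal) symmetries of $\mathcal{D}$, i.e. of symmetries of $\mathcal D|_U$ for any nonempty connected open $U\subset M_A$, is isomorphic to the $5$-dimensional Lie algebra $\mathfrak{sl}(2,\mathbb{R})\ltimes\mathbb{R}^2$ of the group of area-preserving affine motions of the plane. (2) $\mathcal{D}$ is a homogeneous $(2,3,5)$ distribution which can be locally realized on the $5$-dimensional group manifold $\mathbf{SL}(2,\mathbb{R})\ltimes\mathbb{R}^2$, i.e. it is locally equivalent to a left-invariant distribution on this group. (3) The Cartan quartic of $\mathcal{D}$ is, at every point, of algebraic type $D$: it is not identically zero and has exactly one pair of mutually complex conjugate non-real roots, each of multiplicity two. In particular it has no real roots.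
   Context: Setting: a point of $\mathbb{R}^6$ with coordinates $(x_1,y_1,x_2,y_2,x_3,y_3)$ encodes three points (''ants'') $\vec r_i=(x_i,y_i)$ in the plane. The signed area is $A=\tfrac12\sum_{i=1}^3(y_ix_{i+1}-x_iy_{i+1})$ (indices mod $3$). The fields $Z_i$ span the velocity distribution of the rule ''the velocity $\dot{\vec r}_i$ is parallel to $\vec r_{i+1}-\vec r_{i+2}$'' (Rule B), and they are tangent to every $M_A$. Here $\mathfrak{sl}(2,\mathbb{R})\ltimes\mathbb{R}^2$ is the semidirect product for the standard representation. A symmetry of a distribution $\mathcal{D}$ on a manifold $U$ is a smooth vector field $X$ on $U$ with $[X,Z]\in\Gamma(\mathcal{D})$ for all $Z\in\Gamma(\mathcal{D})$. Two distributions are locally equivalent if there are local diffeomorphisms mapping one onto the other. For a distribution put $\mathcal{D}^0=\mathcal D$, $\mathcal{D}^{I+1}=[\mathcal{D}^I,\mathcal{D}^I]+\mathcal{D}^I$; a rank $2$ distribution on a $5$-manifold is a $(2,3,5)$ distribution if $\mathcal{D},\mathcal{D}^1,\mathcal{D}^2$ have ranks $2,3,5$ at every point. Cartan quartic. Let $\mathcal{D}$ be a $(2,3,5)$ distribution on a $5$-manifold $N$. Locally there exist coframes $(\theta^1,\dots,\theta^5)$ with $\mathcal{D}=\ker\theta^1\cap\ker\theta^2\cap\ker\theta^3$, and $1$-forms $\Omega_1,\dots,\Omega_7$, such that $$\begin{aligned} d\theta^1&=\theta^1\wedge(2\Omega_1+\Omega_4)+\theta^2\wedge\Omega_2+\theta^3\wedge\theta^4,\\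 d\theta^2&=\theta^1\wedge\Omega_3+\theta^2\wedge(\Omega_1+2\Omega_4)+\theta^3\wedge\theta^5,\\ d\theta^3&=\theta^1\wedge\Omega_5+\theta^2\wedge\Omega_6+\theta^3\wedge(\Omega_1+\Omega_4)+\theta^4\wedge\theta^5,\\ d\theta^4&=\theta^1\wedge\Omega_7+\tfrac43\theta^3\wedge\Omega_6+\theta^4\wedge\Omega_1+\theta^5\wedge\Omega_2,\\ d\theta^5&=\theta^2\wedge\Omega_7-\tfrac43\theta^3\wedge\Omega_5+\theta^4\wedge\Omega_3+\theta^5\wedge\Omega_4 . \end{aligned}$$ The conformal class of the signature $(2,3)$ metric $g=2\theta^1\theta^5-2\theta^2\theta^4+\tfrac43(\theta^3)^2$ (with $\lambda\mu=\tfrac12(\lambda\otimes\mu+\mu\otimes\lambda)$) depends only on $\mathcal{D}$. Let $W$ be the Weyl tensor of $g$, with all indices lowered by $g$, and let $(e_1,\dots,e_5)$ be the frame dual to $(\theta^i)$, so $\mathcal{D}=\mathrm{Span}(e_4,e_5)$. The Cartan quartic is the homogeneous quartic form on $\mathcal{D}$ $$\mathcal{D}\ni s\,e_4+z\,e_5\ \longmapsto\ W(s e_4+z e_5,\ s e_1+z e_2,\ s e_1+z e_2,\ s e_4+z e_5);$$ it depends only on $\mathcal{D}$. Equivalently, at $s=1$, it is the polynomial $C(z)=A_1+4A_2z+6A_3z^2+4A_4z^3+A_5z^4$ with $A_1=W(e_4,e_1,e_1,e_4)$, $A_2=W(e_4,e_1,e_2,e_4)$, $A_3=W(e_4,e_1,e_2,e_5)$,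 $A_4=W(e_4,e_2,e_2,e_5)$, $A_5=W(e_5,e_2,e_2,e_5)$. Its roots are points of the (complexified) projective line $\mathbb{P}(\mathcal{D})$. The overall normalization constant is irrelevant for the roots. *)

(* Defs.v *)
From HB Require Import structures.
From mathcomp Require Import all_boot all_order all_algebra.
From mathcomp Require Import complex.
From mathcomp Require Import all_classical all_reals all_analysis.

Set Implicit Arguments.
Unset Strict Implicit.
Unset Printing Implicit Defensive.

Import Order.TTheory GRing.Theory Num.Theory.
Import numFieldNormedType.Exports.

Local Open Scope classical_set_scope.
Local Open Scope ring_scope.

Section LinearSpan.
Context {R : realType} {V : lmodType R}.

Definition span_fam (k : nat) (b : 'I_k -> V) : set V :=
  [set v | exists c : 'I_k -> R, v = \sum_i c i *: b i].

Definition independent (k : nat) (b : 'I_k -> V) : Prop :=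
  forall c : 'I_k -> R, \sum_i c i *: b i = 0 -> forall i, c i = 0.

Definition span_set (S : set V) : set V :=
  [set v | exists (k : nat) (b : 'I_k -> V),
      (forall i, S (b i)) /\ span_fam b v].

Definition has_dim (S : set V) (k : nat) : Prop :=
  exists b : 'I_k -> V, independent b /\ S = span_fam b.

End LinearSpan.

(* A manifold is an embedded submanifold of a finite-dimensional normed space;
   objects on it are total functions on the ambient space, of which only the
   restriction to the submanifold matters. *)

Section SmoothMaps.
Context {R : realType} {V W : normedModType R}.

(* For finite-dimensional V, the usual C^k functions on the open set O. *)
Fixpoint Ck (k : nat) (O : set V) (f : V -> W) : Prop :=
  (forall x, O x -> {for x, continuous f}) /\
  (if k is k'.+1 then
     forall v : V, (forall x, O x -> derivable f x v) /\
                   Ck k' O (fun x => 'D_v f x)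
   else True).

Definition smooth_open (O : set V) (f : V -> W) : Prop := forall k, Ck k O f.

Definition local_extension (N : set V) (f : V -> W) (p : V) (g : V -> W) : Prop :=
  exists O : set V, [/\ open O, O p, smooth_open O g &
    forall x, O x -> N x -> g x = f x].

Definition smooth_on (N : set V) (f : V -> W) : Prop :=
  forall p, N p -> exists g, local_extension N f p g.

(* The differential at p of the restriction of f to N, applied to v: it does
   not depend on the chosen extension when f is smooth on the submanifold N
   and v is tangent to N at p. *)
Definition dif (N : set V) (f : V -> W) (p v : V) : W :=
  'D_v (xget f [set g | local_extension N f p g]) p.

End SmoothMaps.

Section Submanifolds.
Context {R : realType} {V : normedModType R}.

Definition open_in (N U : set V) : Prop := exists2 O, open O & U = N `&` O.

Definition tangent (N : set V) (p v : V) : Prop :=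
  exists (O : set R) (c : R -> V),
    [/\ open O, O 0, smooth_open O c, (forall t, O t -> N (c t)) &
        c 0 = p /\ derive1 c 0 = v].

Definition vfield (N : set V) (X : V -> V) : Prop :=
  smooth_on N X /\ forall p, N p -> tangent N p (X p).

Definition lie (N : set V) (X Y : V -> V) : V -> V :=
  fun p => dif N Y p (X p) - dif N X p (Y p).

End Submanifolds.

Definition diffeo (R : realType) (V W : normedModType R)
    (U : set V) (U' : set W) (F : V -> W) : Prop :=
  exists G : W -> V,
    [/\ smooth_on U F, smooth_on U' G,
        (forall x, U x -> U' (F x) /\ G (F x) = x) &
        (forall y, U' y -> U (G y) /\ F (G y) = y)].

Definition submanifold (R : realType) (V : normedModType R) (n : nat)
    (N : set V) : Prop :=
  forall p, N p -> exists (O : set 'rV[R]_n) (U : set V) (F : 'rV[R]_n -> V),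
    [/\ open O, open_in N U, U p & diffeo O U F].

Section Distributions.
Context {R : realType} {V : normedModType R}.

Definition is_distribution (N : set V) (k : nat) (D : V -> set V) : Prop :=
  forall p, N p -> exists (U : set V) (b : 'I_k -> V -> V),
    [/\ open_in N U, U p, (forall i, vfield U (b i)) &
        forall q, U q -> independent (b ^~ q) /\ D q = span_fam (b ^~ q)].

Definition section_of (N : set V) (D : V -> set V) (Z : V -> V) : Prop :=
  vfield N Z /\ forall p, N p -> D p (Z p).

Definition symmetry_field (N : set V) (D : V -> set V) (X : V -> V) : Prop :=
  vfield N X /\ forall Z, section_of N D Z -> section_of N D (lie N X Z).

(* [D, D] + D, at the level of germs of sections *)
Definition derived (N : set V) (D : V -> set V) : V -> set V := fun p =>
  span_set [set v | exists (U : set V) (Z Z' : V -> V),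
    [/\ open_in N U, U p, section_of U D Z, section_of U D Z' &
        v = Z p \/ v = lie U Z Z' p]].

Definition is_235 (N : set V) (D : V -> set V) : Prop :=
  [/\ submanifold 5 N, is_distribution N 2 D &
      forall p, N p -> [/\ has_dim (D p) 2, has_dim (derived N D p) 3 &
                           has_dim (derived N (derived N D) p) 5]].

End Distributions.

Section Equivalence.
Context {R : realType} {V W : normedModType R}.

Definition dist_equiv (U : set V) (D : V -> set V)
    (U' : set W) (D' : W -> set W) (F : V -> W) : Prop :=
  diffeo U U' F /\ forall p, U p -> D' (F p) = dif U F p @` D p.

Definition locally_equivalent (N : set V) (D : V -> set V)
    (N' : set W) (D' : W -> set W) : Prop :=
  (forall p, N p -> exists U U' F,
     [/\ open_in N U, open_in N' U', U p & dist_equiv U D U' D' F]) /\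
  (forall q, N' q -> exists U U' F,
     [/\ open_in N U, open_in N' U', U' q & dist_equiv U D U' D' F]).

End Equivalence.

(* Transitivity both of the group of global symmetries and of the Lie algebra
   of infinitesimal ones. *)
Definition homogeneous (R : realType) (V : normedModType R)
    (N : set V) (D : V -> set V) : Prop :=
  (forall p q, N p -> N q -> exists F, dist_equiv N D N D F /\ F p = q) /\
  (forall p v, N p -> tangent N p v -> exists X, symmetry_field N D X /\ X p = v).

(* The set S of vector fields on N, with fields agreeing on N identified, is a
   Lie algebra isomorphic to the subspace g of L with bracket br. *)
Definition lie_isomorphic (R : realType) (L : lmodType R) (g : set L)
    (br : L -> L -> L) (V : normedModType R) (N : set V)
    (S : set (V -> V)) : Prop :=
  exists phi : L -> V -> V,
    [/\ (forall a, g a -> S (phi a)),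
        (forall (c : R) a b, g a -> g b -> forall p, N p ->
           phi (c *: a + b) p = c *: phi a p + phi b p),
        (forall a b, g a -> g b -> forall p, N p ->
           phi (br a b) p = lie N (phi a) (phi b) p),
        (forall a, g a -> (forall p, N p -> phi a p = 0) -> a = 0) &
        (forall X, S X -> exists a, g a /\ forall p, N p -> X p = phi a p)].

Section SpecialAffine.
Context {R : realType}.

Definition sl2R2 : set ('M[R]_2 * 'cV[R]_2) := [set a | \tr a.1 = 0].

Definition sl2R2_bracket (a b : 'M[R]_2 * 'cV[R]_2) : 'M[R]_2 * 'cV[R]_2 :=
  (a.1 *m b.1 - b.1 *m a.1, a.1 *m b.2 - b.1 *m a.2).

Definition SL2R2 : set ('M[R]_2 * 'cV[R]_2) := [set a | \det a.1 = 1].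

Definition SL2R2_mul (a b : 'M[R]_2 * 'cV[R]_2) : 'M[R]_2 * 'cV[R]_2 :=
  (a.1 *m b.1, a.1 *m b.2 + a.2).

Definition left_invariant (E : 'M[R]_2 * 'cV[R]_2 -> set ('M[R]_2 * 'cV[R]_2)) :
    Prop :=
  forall a b, SL2R2 a -> SL2R2 b ->
    E (SL2R2_mul a b) = dif SL2R2 (SL2R2_mul a) b @` E b.

End SpecialAffine.

Section Forms.
Context {R : realType} {V : normedModType R}.
Implicit Types (N : set V) (X Y : V -> V) (w a b : V -> V -> R).

Definition form1 N w : Prop :=
  (forall p (c : R) u v, N p -> tangent N p u -> tangent N p v ->
     w p (c *: u + v) = c * w p u + w p v) /\
  (forall X, vfield N X -> smooth_on N (fun p => w p (X p))).

Definition ext_d N w X Y : V -> R := fun p =>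
  dif N (fun q => w q (Y q)) p (X p) - dif N (fun q => w q (X q)) p (Y p)
  - w p (lie N X Y p).

Definition wedge a b X Y : V -> R := fun p =>
  a p (X p) * b p (Y p) - a p (Y p) * b p (X p).

End Forms.

Section Curvature.
Context {R : realType} {V : normedModType R} {n : nat}.
Variables (U : set V) (e : 'I_n -> V -> V) (g : V -> V -> V -> R).
Implicit Types X Y Z T : V -> V.

Definition ip X Y : V -> R := fun p => g p (X p) (Y p).

Definition gram_inv (p : V) : 'M[R]_n := invmx (\matrix_(i, j) ip (e i) (e j) p).

(* g(nabla_X Y, Z) for the Levi-Civita connection nabla of g on U, by the Koszul
   formula; e is any frame of U *)
Definition koszul X Y Z : V -> R := fun p =>
  2^-1 * (dif U (ip Y Z) p (X p) + dif U (ip Z X) p (Y p)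
          - dif U (ip X Y) p (Z p)
          + ip (lie U X Y) Z p - ip (lie U Y Z) X p + ip (lie U Z X) Y p).

Definition nabla X Y : V -> V := fun p =>
  \sum_k \sum_l (gram_inv p k l * koszul X Y (e k) p) *: e l p.

Definition riem X Y Z : V -> V := fun p =>
  nabla X (nabla Y Z) p - nabla Y (nabla X Z) p - nabla (lie U X Y) Z p.

(* The trace of the endomorphism X |-> riem X Y Z *)
Definition ricci Y Z : V -> R := fun p =>
  \sum_k \sum_l gram_inv p k l * ip (riem (e k) Y Z) (e l) p.

Definition scal : V -> R := fun p =>
  \sum_k \sum_l gram_inv p k l * ricci (e k) (e l) p.

Definition weyl X Y Z T : V -> R := fun p =>
  ip (riem X Y Z) T p
  - (n%:R - 2)^-1 * (ricci Y Z p * ip X T p - ricci X Z p * ip Y T p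
                     + ricci X T p * ip Y Z p - ricci Y T p * ip X Z p)
  + ((n%:R - 1) * (n%:R - 2))^-1 * scal p
    * (ip Y Z p * ip X T p - ip X Z p * ip Y T p).

End Curvature.

Section CartanQuartic.
Context {R : realType} {V : normedModType R}.

(* 1-based index *)
Definition ix {n : nat} (k : nat) : 'I_n.+1 := inord k.-1.

Definition coframe (n : nat) (U : set V) (theta : 'I_n -> V -> V -> R)
    (e : 'I_n -> V -> V) : Prop :=
  [/\ (forall i, form1 U (theta i)), (forall i, vfield U (e i)),
      (forall p, U p -> tangent U p = span_fam (e ^~ p)) &
      (forall p i j, U p -> theta i p (e j p) = (i == j)%:R)].

Definition structure_equations (U : set V) (theta : 'I_5 -> V -> V -> R)
    (Omega : 'I_7 -> V -> V -> R) : Prop :=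
  let th k := theta (ix k) in
  let Om k := Omega (ix k) in
  let Om2 a k b l : V -> V -> R := fun p v => a * Om k p v + b * Om l p v in
  forall X Y p, vfield U X -> vfield U Y -> U p ->
  let d w := ext_d U w X Y p in
  let w a b := wedge a b X Y p in
  [/\ d (th 1%N) = w (th 1%N) (Om2 2 1%N 1 4%N) + w (th 2%N) (Om 2%N)
                   + w (th 3%N) (th 4%N),
      d (th 2%N) = w (th 1%N) (Om 3%N) + w (th 2%N) (Om2 1 1%N 2 4%N)
                   + w (th 3%N) (th 5%N),
      d (th 3%N) = w (th 1%N) (Om 5%N) + w (th 2%N) (Om 6%N)
                   + w (th 3%N) (Om2 1 1%N 1 4%N) + w (th 4%N) (th 5%N),
      d (th 4%N) = w (th 1%N) (Om 7%N) + 4 / 3 * w (th 3%N) (Om 6%N)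
                   + w (th 4%N) (Om 1%N) + w (th 5%N) (Om 2%N) &
      d (th 5%N) = w (th 2%N) (Om 7%N) - 4 / 3 * w (th 3%N) (Om 5%N)
                   + w (th 4%N) (Om 3%N) + w (th 5%N) (Om 4%N)].

Definition adapted_coframe (U : set V) (D : V -> set V)
    (theta : 'I_5 -> V -> V -> R) (e : 'I_5 -> V -> V) : Prop :=
  [/\ coframe U theta e,
      (forall p, U p -> D p =
         [set v | [/\ tangent U p v, theta (ix 1) p v = 0,
                      theta (ix 2) p v = 0 & theta (ix 3) p v = 0]]) &
      exists Omega : 'I_7 -> V -> V -> R,
        (forall i, form1 U (Omega i)) /\ structure_equations U theta Omega].

(* 2 theta^1 theta^5 - 2 theta^2 theta^4 + 4/3 (theta^3)^2, where
   2 l m = l (x) m + m (x) l *)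
Definition cartan_metric (theta : 'I_5 -> V -> V -> R) : V -> V -> V -> R :=
  fun p u v =>
  let th k := theta (ix k) p in
  (th 1%N u * th 5%N v + th 5%N u * th 1%N v)
  - (th 2%N u * th 4%N v + th 4%N u * th 2%N v) + 4 / 3 * (th 3%N u * th 3%N v).

Definition quartic_in (U : set V) (theta : 'I_5 -> V -> V -> R)
    (e : 'I_5 -> V -> V) (p : V) (s z : R) : R :=
  let X q := s *: e (ix 4) q + z *: e (ix 5) q in
  let Y q := s *: e (ix 1) q + z *: e (ix 2) q in
  weyl U e (cartan_metric theta) X Y Y X p.

(* Q s z is the value of the Cartan quartic of D at s e_4 + z e_5, an element of
   D p, for some adapted coframe around p *)
Definition cartan_quartic (N : set V) (D : V -> set V) (p : V)
    (Q : R -> R -> R) : Prop :=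
  exists (U : set V) (theta : 'I_5 -> V -> V -> R) (e : 'I_5 -> V -> V),
    [/\ open_in N U, U p, adapted_coframe U D theta e & Q = quartic_in U theta e p].

End CartanQuartic.

(* The polynomial P dehomogenizes the binary quartic form Q at s = 1. The
   multiplicity of the point s = 0 as a root of Q is 5 - size P; the one of
   s = 1, z = u, is the multiplicity of the complex root u of P. *)
Definition type_D_nonreal (R : realType) (Q : R -> R -> R) : Prop :=
  exists P : {poly R},
    [/\ (forall s z, Q s z = \sum_(k < 5) P`_k * s ^+ (4 - k) * z ^+ k),
        size P = 5%N &
        exists w : R[i], complex.Im w != 0 /\
          forall u : R[i], mup u (map_poly (real_complex R) P) =
            (if (u == w) || (u == conjc w) then 2 else 0)%N].

Definition no_real_root (R : realType) (Q : R -> R -> R) : Prop :=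
  forall s z, Q s z = 0 -> s = 0 /\ z = 0.

(* Row i of p is the i-th point (x_i, y_i); addition on 'I_3 is modulo 3. *)

Section Ants.
Context {R : realType}.

Definition xc (p : 'M[R]_(3, 2)) (i : 'I_3) : R := p i 0.
Definition yc (p : 'M[R]_(3, 2)) (i : 'I_3) : R := p i 1.

Definition signed_area (p : 'M[R]_(3, 2)) : R :=
  2^-1 * \sum_i (yc p i * xc p (i + 1) - xc p i * yc p (i + 1)).

Definition ants_manifold (A : R) : set 'M[R]_(3, 2) :=
  [set p | signed_area p = A].

Definition Zfield (i : 'I_3) (p : 'M[R]_(3, 2)) : 'M[R]_(3, 2) :=
  \matrix_(j, k) (if j == i then p (i + 1) k - p (i + 2) k else 0).

Definition ants_distribution (p : 'M[R]_(3, 2)) : set 'M[R]_(3, 2) :=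
  let Z k := Zfield (ix k) p in
  [set v | exists a b : R, v = a *: (Z 1%N - Z 2%N) + b *: (Z 3%N - Z 1%N)].

End Ants.

(* Main.v *)
(* The linear fields [E_K : p |-> K p], for K in the 5-dimensional space of 3x3 matrices with
   zero row sums and zero trace, frame M_A, and D is spanned by two of them.  They commute with the affine
   area-preserving fields, and their brackets [E_K, E_L] = E_(LK - KL) have constant coefficients,
   so that every question about D becomes one about a 5-dimensional Lie algebra.

   (1) If X is a symmetry, the components of the brackets [X, E_i] satisfy, by the Jacobi identity,
   an overdetermined linear system with constant coefficients whose prolongation only has the zero
   solution.  So X commutes with the frame, hence is locally affine, and globally so on a connected
   set.

   (2) The special affine group acts simply transitively on M_A and preserves D.

   (3) A suitable basis of the frame solves Cartan's structure equations.  Any other adapted frame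
   (e_i) over an open set is related to it by a matrix of functions whose block on D is arbitrary
   with determinant delta, and the structure equations force its metric to be delta^-2 times the
   constant one.  The vectors s e_4 + z e_5 and s e_1 + z e_2 span a totally null plane: on it the
   Ricci terms of the Weyl tensor vanish, and a conformal change just rescales the curvature.  The
   quartic is thus read off the constant curvature tensor: it is -189/25 (S^2 - S Z + Z^2)^2, where
   (S, Z) are the coordinates of s e_4 + z e_5 in the constant frame of D. *)

Require Import Defs.
From HB Require Import structures.
From mathcomp Require Import all_boot all_order all_algebra.
From mathcomp Require Import complex.
From mathcomp Require Import all_classical all_reals all_analysis.
From mathcomp Require Import ring lra.

Set Implicit Arguments.
Unset Strict Implicit.
Unset Printing Implicit Defensive.

Import Order.TTheory GRing.Theory Num.Theory.
Import numFieldNormedType.Exports.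

Local Open Scope classical_set_scope.
Local Open Scope ring_scope.

(** * Calculus on submanifolds *)

Section Smooth.
Context {R : realType}.
Implicit Types V W : normedModType R.

(** A triple of points is a 3x2 matrix. The frame multiplies it from the left by matrices that kill
    the column [ones], affine maps act from the right: hence the two commute. [E_4 = Z_1 - Z_2] and
    [E_5 = Z_3 - Z_1] are the given generators, and [E_3 = Z_1 + Z_2 + Z_3 = - [E_4, E_5]]. [E_1]
    and [E_2] are [- [E_3, E_4]] and [- [E_3, E_5]] corrected by the combinations of [E_4], [E_5]
    that make Cartan's equations solvable; the odd coefficients come from this correction. Two
    obstacles shape the proof. The differential [dif] uses an unspecified extension of a function,
    so most of its rules hold along tangent vectors only, and vector fields are best replaced by
    their coordinates in the frame. Moreover the quartic is defined from any adapted coframe, and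
    its independence of this choice is not presupposed: the components of the other frame are
    unknown functions, and the forms [Omega], then all derivatives, are eliminated from their
    differential equations until the Gram matrix is left. The roots are non-real because
    [S^2 - S Z + Z^2] has discriminant -3, whose sign survives invertible changes of [(S, Z)]. *)

Lemma derive_linear V W W' (l : {linear W -> W'}) (f : V -> W) x v :
  continuous l -> derivable f x v ->
  derivable (l \o f) x v /\ 'D_v (l \o f) x = l ('D_v f x).
Proof.
move=> lc df.

suff H : (fun h => h^-1 *: (((l \o f) \o shift x) (h *: v) - l (f x))) @ 0^'
   --> l ('D_v f x).
  by split; [apply/cvg_ex; eexists; exact: H|apply/cvg_lim => //; exact: H].
have -> : (fun h => h^-1 *: (((l \o f) \o shift x) (h *: v) - l (f x))) =
  l \o (fun h : R => h^-1 *: ((f \o shift x) (h *: v) - f x)).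
  by apply/funext => h; rewrite /= linearZZ (linearB l).
apply: continuous_cvg; [exact: lc|exact: df].
Qed.

Lemma Ck_eq V W k (O : set V) (f g : V -> W) : open O ->
  (forall x, O x -> f x = g x) -> Ck k O f -> Ck k O g.
Proof.
move=> oO; elim: k f g => [|k IH] f g fg [cf H];
  (have nfg x : O x -> \near x, f x = g x by
    move=> Ox; near=> y; apply: fg; near: y; exact: open_nbhs_nbhs);
  (have cg x : O x -> {for x, continuous g} by
    move=> Ox; have := cf x Ox; rewrite /prop_for /continuous_at (fg x Ox);
    apply: cvg_trans; exact: near_eq_cvg (nfg x Ox)); split=> // v.
have [df D] := H v; split=> [x Ox|].
- exact: near_eq_derivable (nfg x Ox) (df x Ox).
- apply: IH D => x Ox; exact: near_eq_derive (nfg x Ox).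
Unshelve. all: by end_near. Qed.

(** The Leibniz rule multiplies a derivative, of class [k], by an undifferentiated factor of class
    [k.+1], which has to be lowered to class [k]. *)
Lemma CkW V W k (O : set V) (f : V -> W) : Ck k.+1 O f -> Ck k O f.
Proof.
elim: k f => [|k IH] f [cf H]; split=> // v; have [df D] := H v.
by split=> //; apply: IH.
Qed.

Lemma Ck_sub V W k (O O' : set V) (f : V -> W) : O' `<=` O ->
  Ck k O f -> Ck k O' f.
Proof.
move=> OO; elim: k f => [|k IH] f [cf H];
  (have cf' x : O' x -> {for x, continuous f} by move=> /OO; exact: cf);
  split=> // v.
by have [df D] := H v; split=> [x /OO|]; [exact: df|exact: IH].
Qed.

Lemma Ck_linear V W W' k (O : set V) (l : {linear W -> W'}) (f : V -> W) :
  open O -> continuous l -> Ck k O f -> Ck k O (l \o f).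
Proof.
move=> oO lc; elim: k f => [|k IH] f [cf H].
  by split=> // x Ox; apply: continuous_comp; [exact: cf|exact: lc].
split=> [x Ox|v].
  by apply: continuous_comp; [exact: cf|exact: lc].
have [df D] := H v; split=> [x Ox|].
  exact: (derive_linear lc (df x Ox)).1.
apply: Ck_eq (IH _ D) => // x Ox.
by rewrite (derive_linear lc (df x Ox)).2.
Qed.

Lemma Ck_cst V W k (O : set V) (w : W) : open O -> Ck k O (cst w).
Proof.
move=> oO; elim: k w => [|k IH] w;
  (have cf (x : V) : {for x, continuous (cst w)} by exact: cst_continuous);
  split=> // v.
by split=> [x _|]; [exact: derivable_cst|apply: Ck_eq (IH 0) => // x _; rewrite derive_cst].
Qed.

Lemma Ck_id V k (O : set V) : open O -> Ck k O (id : V -> V).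
Proof.
move=> oO; case: k => [|k]; (have cf (x : V) : {for x, continuous (@id V)} by exact: cvg_id);
  split=> // v.
split=> [x _|]; first exact: derivable_id.
by apply: Ck_eq (Ck_cst k v oO) => // x _; rewrite derive_id.
Qed.

Lemma Ck_add V W k (O : set V) (f g : V -> W) : open O ->
  Ck k O f -> Ck k O g -> Ck k O (fun x => f x + g x).
Proof.
move=> oO; elim: k f g => [|k IH] f g [cf F] [cg G].
  by split=> // x Ox; apply: continuousD; [exact: cf|exact: cg].
split=> [x Ox|v]; first by apply: continuousD; [exact: cf|exact: cg].
have [df Df] := F v; have [dg Dg] := G v; split=> [x Ox|].
  by apply: derivableD; [exact: df|exact: dg].
apply: Ck_eq (IH _ _ Df Dg) => // x Ox.
by rewrite -(deriveD (df x Ox) (dg x Ox)).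
Qed.

Lemma Ck_mul V k (O : set V) (f g : V -> R) : open O ->
  Ck k O f -> Ck k O g -> Ck k O (fun x => f x * g x).
Proof.
move=> oO; elim: k f g => [|k IH] f g.
  by move=> [cf F] [cg G]; split=> // x Ox; apply: continuousM; [exact: cf|exact: cg].
move=> Cf Cg; have [cf F] := Cf; have [cg G] := Cg.
split=> [x Ox|v]; first by apply: continuousM; [exact: cf|exact: cg].
have [df Df] := F v; have [dg Dg] := G v; split=> [x Ox|].
  by apply: derivableM; [exact: df|exact: dg].
apply: Ck_eq (Ck_add oO (IH _ _ (CkW Cf) Dg) (IH _ _ (CkW Cg) Df)) => // x Ox.
by rewrite -(deriveM (df x Ox) (dg x Ox)).
Qed.

Lemma Ck_inv V k (O : set V) (f : V -> R) : open O ->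
  (forall x, O x -> f x != 0) -> Ck k O f -> Ck k O (fun x => (f x)^-1).
Proof.
move=> oO f0; elim: k f f0 => [|k IH] f f0.
  by move=> [cf F]; split=> // x Ox; apply: cvgV; [exact: f0|exact: cf].
move=> Cf; have [cf F] := Cf.
split=> [x Ox|v]; first by apply: cvgV; [exact: f0|exact: cf].
have [df Df] := F v; split=> [x Ox|].
  by apply: derivableV; [exact: f0|exact: df].
have Ci := IH _ f0 (CkW Cf).
have H := Ck_mul oO (Ck_cst k (-1 : R) oO) (Ck_mul oO (Ck_mul oO Ci Ci) Df).
apply: Ck_eq H => // x Ox.
rewrite (deriveV (f0 x Ox) (df x Ox)) /cst /= expr2 invfM scaleNr mulN1r.
by [].
Qed.

End Smooth.

(** * Differentiability from partial derivatives, and Schwarz's theorem *)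

Section FinDim.
Context {R : realType}.
Implicit Types V W : normedModType R.

(** A spanning family with continuous coordinate functionals: it reduces limits, derivatives and
    equalities in [W] to real-valued ones. *)
Definition fin_dim W : Prop :=
  exists (I : finType) (b : I -> W) (co : I -> {linear W -> R}),
    (forall i, continuous (co i)) /\ forall w, w = \sum_i co i w *: b i.

Lemma is_derive_line V W (f : V -> W) (x v : V) (s : R) :
  derivable f (s *: v + x) v ->
  is_derive s 1 (fun t : R => f (t *: v + x)) ('D_v f (s *: v + x)).
Proof.
have E : (fun h : R => h^-1 *: (((fun t : R => f (t *: v + x)) \o shift s) (h *: 1)
            - f (s *: v + x))) =
         (fun h : R => h^-1 *: ((f \o shift (s *: v + x)) (h *: v) - f (s *: v + x))).
  by apply/funext => h /=; rewrite [h%:A]mulr1 scalerDl addrA.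
by move=> df; split; rewrite ?/derivable ?/derive E.
Qed.

(** Both signs of [t] are covered, since the coordinates of an increment have no prescribed sign. *)
Lemma MVT_line V (f : V -> R) (x v : V) (t : R) :
  (forall s : R, `|s| <= `|t| -> derivable f (s *: v + x) v) ->
  exists2 c, `|c| <= `|t| & f (t *: v + x) - f x = t * 'D_v f (c *: v + x).
Proof.
move=> df; pose g (s : R) := f (s *: v + x).
have dg (s : R) : `|s| <= `|t| -> is_derive s 1 g ('D_v f (s *: v + x)).
  by move=> st; apply: is_derive_line; exact: df.
have cg (a b : R) : (forall s, a <= s <= b -> `|s| <= `|t|) -> {within `[a, b], continuous g}.
  move=> H; apply: derivable_within_continuous => s; rewrite in_itv /= => sab.
  by have [] := dg s (H s sab).
have -> : f (t *: v + x) - f x = g t - g 0 by rewrite /g scale0r add0r.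
have [t0|t0] := leP 0 t.
- have H (s : R) : 0 <= s <= t -> `|s| <= `|t|.
    by move=> /andP[s0 st]; rewrite !ger0_norm.
  have [c|c] := @MVT_segment R g (fun s => 'D_v f (s *: v + x)) 0 t t0 _ (cg _ _ H).
    by rewrite in_itv /= => /andP[c0 ct]; apply: dg; apply: H; rewrite !ltW.
  by rewrite in_itv /= => /H ct ->; exists c => //; rewrite subr0 mulrC.
- have H (s : R) : t <= s <= 0 -> `|s| <= `|t|.
    by move=> /andP[s0 st]; rewrite !ler0_norm ?lerN2 // ltW.
  have [c|c] := @MVT_segment R g (fun s => 'D_v f (s *: v + x)) t 0 (ltW t0) _ (cg _ _ H).
    by rewrite in_itv /= => /andP[c0 ct]; apply: dg; apply: H; rewrite !ltW.
  rewrite in_itv /= => /H ct E; exists c => //; rewrite sub0r in E.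
  by rewrite -[LHS]opprB E mulrN opprK mulrC.
Qed.

Lemma cvg_sumr (T I : Type) (F : set_system T) (FF : Filter F) W (r : seq I)
    (f : I -> T -> W) (a : I -> W) : (forall i, f i x @[x --> F] --> a i) ->
  \sum_(i <- r) f i x @[x --> F] --> \sum_(i <- r) a i.
Proof.
move=> fa; elim: r => [|i r IH].
  by rewrite big_nil; under eq_fun do rewrite big_nil; exact: cvg_cst.
by rewrite big_cons; under eq_fun do rewrite big_cons; apply: cvgD.
Qed.

Lemma linear_bound V W (l : {linear V -> W}) : continuous l ->
  exists2 k : R, 0 < k & forall x, `|l x| <= k * `|x|.
Proof. by move=> lc; apply: linear_lipschitz; exact: lc. Qed.

(** [Ck] only speaks of directional derivatives. The increment of [f] is split along the
    coordinates; on each piece the mean value theorem and the continuity of the partial derivative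
    at [p] control the error. *)
Lemma Ck1_differentiable V (O : set V) (f : V -> R) (p : V) :
  fin_dim V -> open O -> O p -> Ck 1 O f -> differentiable f p.
Proof.
move=> [I [b [co [coc cob]]]] oO Op [cf Hf].
pose d (h : V) : R := \sum_i co i h * 'D_(b i) f p.
have d_lin : linear d.
  move=> a x y; rewrite /d scaler_sumr -big_split /=; apply: eq_bigr => i _.
  by rewrite linearP mulrDl scalerAl.
pose dM := GRing.isLinear.Build _ _ _ _ _ d_lin.
pose dL : {linear V -> R} := HB.pack d dM.
have dc : continuous dL.
  move=> x; rewrite /= /dL /= /d; apply: cvg_sumr => i.
  by apply: cvgMr_tmp; exact: coc.
(* Induction on the coordinates moved so far. Each new one costs at most [e * |co i h|], once [h] is
   so small that the whole broken path stays in a ball where the partial derivative varies by at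
   most [e]. *)
have step (s : seq I) (e : R) : 0 < e -> \forall h \near (0 : V),
   `|f (\sum_(i <- s) co i h *: b i + p) - f p - \sum_(i <- s) co i h * 'D_(b i) f p|
    <= e * \sum_(i <- s) `|co i h|.
  move=> e0; elim: s => [|i s IH].
    by near=> h; rewrite !big_nil add0r subrr subr0 normr0 mulr0.
  have [dfi [cdi _]] := Hf (b i).
  have : \forall y \near p, O y /\ `|'D_(b i) f p - 'D_(b i) f y| <= e.
    near=> y; split; first by near: y; exact: open_nbhs_nbhs.
    near: y; have /cvgrPdist_le := cdi p Op; exact.
  move=> /nbhs_ballP[r /= r0 rB].
  have small : \forall h \near (0 : V),
      `|co i h| * `|b i| + `|\sum_(j <- s) co j h *: b j| < r.
    have : (fun h => `|co i h| * `|b i| + `|\sum_(j <- s) co j h *: b j|) @ (0 : V)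
       --> `|co i 0| * `|b i| + `|\sum_(j <- s) co j 0 *: b j|.
      apply: cvgD; first by apply: cvgMr_tmp; apply: cvg_norm; exact: coc.
      apply: cvg_norm; apply: cvg_sumr => j; apply: cvgZr_tmp; exact: coc.
    rewrite linear0 normr0 mul0r add0r big1 ?normr0; last first.
      by move=> j _; rewrite linear0 scale0r.
    move=> /cvgrPdist_lt /(_ r r0); apply: filterS => h.
    by rewrite sub0r normrN ger0_norm // addr_ge0 ?mulr_ge0.
  near=> h; rewrite !big_cons.
  have sm : `|co i h| * `|b i| + `|\sum_(j <- s) co j h *: b j| < r by near: h.
  have IH1 : `|f (\sum_(i <- s) co i h *: b i + p) - f p - \sum_(i <- s) co i h * 'D_(b i) f p|
     <= e * \sum_(i <- s) `|co i h| by near: h.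
  set y := \sum_(j <- s) co j h *: b j in sm IH1 *.
  have inB (c : R) : `|c| <= `|co i h| -> ball p r (c *: b i + (y + p)).
    move=> ch; rewrite -ball_normE /ball_ /= addrA opprD addrCA subrr addr0 normrN.
    apply: le_lt_trans sm; apply: le_trans (ler_normD _ _) _.
    by rewrite lerD2r normrZ ler_wpM2r.
  have [c ch E] := @MVT_line V f (y + p) (b i) (co i h)
     (fun s sh => dfi _ (rB _ (inB s sh)).1).
  have De := (rB _ (inB c ch)).2; rewrite -(addrA _ y p).
  have -> : f (co i h *: b i + (y + p)) - f p -
     (co i h * 'D_(b i) f p + \sum_(j <- s) co j h * 'D_(b j) f p) =
     co i h * ('D_(b i) f (c *: b i + (y + p)) - 'D_(b i) f p)
     + (f (y + p) - f p - \sum_(j <- s) co j h * 'D_(b j) f p).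
    by rewrite mulrBr -E; ring.
  apply: le_trans (ler_normD _ _) _; rewrite [leRHS]mulrDr; apply: lerD => //.
  by rewrite normrM mulrC ler_wpM2r // distrC.
have key : f \o shift p = cst (f p) + dL +o_ 0 id.
  apply/eqaddoP => e e0.
  (* The sum of the coordinates is bounded by a multiple of the norm, which turns the error of
     [step] into a little-o of [h]. *)
  have [C C0 HC] : exists2 C : R, 0 < C & forall h, \sum_i `|co i h| <= C * `|h|.
    suff : forall s : seq I, exists2 C : R, 0 < C &
      forall h, \sum_(i <- s) `|co i h| <= C * `|h| by apply.
    elim=> [|i s [C C0 HC]].
      by exists 1 => // h; rewrite big_nil mul1r.
    have [k k0 Hk] := linear_bound (coc i).
    exists (k + C) => [|h]; first by rewrite addr_gt0.
    by rewrite big_cons mulrDl lerD.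
  have e'0 : 0 < e / C by rewrite divr_gt0.
  have := step (index_enum I) _ e'0; apply: filterS => h.
  rewrite -(cob h) => H.
  apply: (@le_trans _ _ (e / C * (C * `|h|))); last by rewrite mulrA divfK // gt_eqF.
  apply: le_trans (ler_wpM2l (ltW e'0) (HC h)).
  move: H; congr (_ <= _); congr (`| _ |).
  by rewrite /= !fctE /cst /= opprD addrA.
apply/diff_locallyP; have -> : 'd f p = dL :> (V -> R) by apply: diff_unique.
by split.
Unshelve. all: by end_near. Qed.

(** Schwarz's theorem. The second difference of [f] is symmetric in [v] and [w]; two applications of
    the mean value theorem equate it with [t^2] times a mixed derivative near [p], in either order,
    and both mixed derivatives are continuous at [p]. *)
Lemma derive_swap V (O : set V) (f : V -> R) (p v w : V) :
  open O -> O p -> Ck 2 O f -> 'D_v (fun x => 'D_w f x) p = 'D_w (fun x => 'D_v f x) p.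
Proof.
move=> oO Op [cf Hf].
have [r0 /= r00 rO] : exists2 r : R, 0 < r & ball p r `<=` O.
  by move: oO; rewrite openE => /(_ p Op) /nbhs_ballP[r /= rp rO]; exists r.
(* the second difference quotient is a value of either mixed derivative *)
have key (u1 u2 : V) (r t : R) : 0 < r -> r <= r0 -> `|t| * (`|u1| + `|u2|) < r ->
  exists2 x, ball p r x & f (t *: u2 + (t *: u1 + p)) - f (t *: u1 + p)
     - (f (t *: u2 + p) - f p) = t * (t * 'D_u2 (fun x => 'D_u1 f x) x).
  move=> rp rr0 tr.
  have inB (a1 a2 : R) : `|a1| <= `|t| -> `|a2| <= `|t| -> ball p r (a2 *: u2 + (a1 *: u1 + p)).
    move=> at1 at2; rewrite -ball_normE /ball_ /= addrA opprD addrCA subrr addr0 normrN.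
    apply: le_lt_trans tr; apply: le_trans (ler_normD _ _) _.
    by rewrite !normrZ addrC mulrDr lerD // ler_wpM2r.
  have inO (a1 a2 : R) : `|a1| <= `|t| -> `|a2| <= `|t| -> O (a2 *: u2 + (a1 *: u1 + p)).
    by move=> h1 h2; apply: rO; apply: le_ball (inB _ _ h1 h2).
  have inO1 (a1 : R) : `|a1| <= `|t| -> O (a1 *: u1 + p).
    by move=> h1; have := inO a1 0 h1; rewrite scale0r add0r normr0; apply.
  pose g x := f (t *: u2 + x) - f x.
  have [d1 D1] := Hf u1.
  have dsh x : O (t *: u2 + x) -> derivable (fun y => f (t *: u2 + y)) x u1 /\
      'D_u1 (fun y => f (t *: u2 + y)) x = 'D_u1 f (t *: u2 + x).
    move=> Ox; have E : (fun h : R => h^-1 *: (((fun y => f (t *: u2 + y)) \o shift x) (h *: u1)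
            - f (t *: u2 + x))) =
         (fun h : R => h^-1 *: ((f \o shift (t *: u2 + x)) (h *: u1) - f (t *: u2 + x))).
      by apply/funext => h /=; rewrite addrCA.
    by rewrite /derivable /derive E; split=> //; exact: d1.
  have dg x : O (t *: u2 + x) -> O x ->
     derivable g x u1 /\ 'D_u1 g x = 'D_u1 f (t *: u2 + x) - 'D_u1 f x.
    move=> O1 O2; have [e1 e2] := dsh x O1; split.
      exact: (derivableB e1 (d1 _ O2)).
    by rewrite (deriveB e1 (d1 _ O2)) e2.
  have [c ct E] : exists2 c, `|c| <= `|t| & g (t *: u1 + p) - g p = t * 'D_u1 g (c *: u1 + p).
    apply: MVT_line => s st; apply: (dg _ _ _).1; [exact: inO|exact: inO1].
  rewrite (dg _ (inO _ _ ct (lexx _)) (inO1 _ ct)).2 in E.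
  have [_ D2] := D1; have [d2 _] := D2 u2.
  have [c' ct' E'] : exists2 c', `|c'| <= `|t| & 'D_u1 f (t *: u2 + (c *: u1 + p)) -
       'D_u1 f (c *: u1 + p) = t * 'D_u2 (fun x => 'D_u1 f x) (c' *: u2 + (c *: u1 + p)).
    by apply: (@MVT_line _ (fun x => 'D_u1 f x)) => s st; apply: d2; apply: inO.
  exists (c' *: u2 + (c *: u1 + p)); first exact: inB.
  by rewrite -E' -E.
have cont (u1 u2 : V) (e : R) : 0 < e -> \forall x \near p,
    `|'D_u2 (fun x => 'D_u1 f x) p - 'D_u2 (fun x => 'D_u1 f x) x| <= e.
  have [_ [_ D2]] := Hf u1; have [_ [c2 _]] := D2 u2.
  move=> e0; have /cvgrPdist_le := c2 p Op; exact.
apply/eqP; rewrite -subr_eq0 -normr_le0; apply/ler_addgt0Pl => e e0; rewrite addr0.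
have e2 : 0 < e / 2 by rewrite divr_gt0.
have : \forall x \near p, `|'D_w (fun x => 'D_v f x) p - 'D_w (fun x => 'D_v f x) x| <= e / 2
  /\ `|'D_v (fun x => 'D_w f x) p - 'D_v (fun x => 'D_w f x) x| <= e / 2.
  by apply: filterI; [exact: (cont v w _ e2)|exact: (cont w v _ e2)].
move=> /nbhs_ballP[r1 /= r10 H1].
pose r := Num.min r0 r1; have rp : 0 < r by rewrite lt_min r00 r10.
have rr0 : r <= r0 by rewrite ge_min lexx.
have rr1 : r <= r1 by rewrite ge_min lexx orbT.
pose t := r / (2 * (1 + `|v| + `|w|)).
have S0 : 0 < 1 + `|v| + `|w| by rewrite ltr_pwDl ?ltr01 // ltr_pwDl.
have t0 : 0 < t by rewrite divr_gt0 // mulr_gt0.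
have tS : `|t| * (`|v| + `|w|) < r.
  rewrite gtr0_norm // /t mulrAC ltr_pdivrMr ?mulr_gt0 // ltr_pM2l //.
  have := normr_ge0 v; have := normr_ge0 w; lra.
have [x xB Ex] := key v w r t rp rr0 tS.
have [y yB Ey] : exists2 x, ball p r x & f (t *: v + (t *: w + p)) - f (t *: w + p)
     - (f (t *: v + p) - f p) = t * (t * 'D_v (fun x => 'D_w f x) x).
  by apply: key => //; rewrite addrC.
have L : f (t *: w + (t *: v + p)) - f (t *: v + p) - (f (t *: w + p) - f p) =
  f (t *: v + (t *: w + p)) - f (t *: w + p) - (f (t *: v + p) - f p).
  by rewrite (addrCA (t *: v)) !opprB addrACA [in RHS]addrACA [- _ + _]addrC.
have cancel2 (a b l m : R) : l = t * (t * a) -> m = t * (t * b) -> l = m -> a = b.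
  by move=> -> -> /(mulfI (lt0r_neq0 t0)) /(mulfI (lt0r_neq0 t0)).
have E := cancel2 _ _ _ _ Ex Ey L.
have [Hx _] := H1 x (le_ball rr1 xB); have [_ Hy] := H1 y (le_ball rr1 yB).
have fin (a b c d : R) : a = b -> `|c - a| <= e / 2 -> `|d - b| <= e / 2 -> `|d - c| <= e.
  move=> -> cb db; have h := ler_distD b d c; rewrite (distrC b c) in h.
  by rewrite [e]splitr; exact: le_trans h (lerD db cb).
exact: fin E Hx Hy.
Unshelve. all: by end_near. Qed.

End FinDim.

Section FinDimInstances.
Context {R : realType}.
Implicit Types V W : normedModType R.

Definition mx_entry m n (i : 'I_m) (j : 'I_n) (A : 'M[R]_(m, n)) : R := A i j.

Lemma mx_entry_linear m n i j : linear (@mx_entry m n i j : 'M[R]_(m, n) -> R).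
Proof. by move=> a A B; rewrite /mx_entry !mxE. Qed.

HB.instance Definition _ m n i j :=
  GRing.isLinear.Build R 'M[R]_(m, n) R _ (@mx_entry m n i j) (mx_entry_linear i j).

Lemma mx_entry_continuous m n i j : continuous (@mx_entry m n i j).
Proof. exact: coord_continuous. Qed.

Lemma fin_dim_mx m n : fin_dim 'M[R]_(m, n).
Proof.
exists ('I_m * 'I_n)%type, (fun ij => delta_mx ij.1 ij.2),
  (fun ij => mx_entry ij.1 ij.2 : {linear 'M[R]_(m, n) -> R}); split=> [ij|A].
  exact: mx_entry_continuous.
by rewrite [LHS]matrix_sum_delta pair_bigA.
Qed.

Lemma fin_dim_R : fin_dim R.
Proof.
exists unit, (fun=> 1), (fun=> idfun : {linear R -> R}); split=> [_ x|w].
  exact: cvg_id.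
by rewrite (big_pred1 tt) => [|[]//]; rewrite /= [_%:A]mulr1.
Qed.

Lemma fin_dim_prod V W : fin_dim V -> fin_dim W -> fin_dim (V * W)%type.
Proof.
move=> [I [b [co [coc cob]]]] [I' [b' [co' [coc' cob']]]].
exists (I + I')%type,
  (fun k => match k with inl i => (b i, 0) | inr i => (0, b' i) end),
  (fun k => match k with inl i => co i \o fst | inr i => co' i \o snd end
   : {linear (V * W)%type -> R}).
split=> [[i|i] x|[v w]].
- by apply: continuous_comp; [exact: cvg_fst|exact: coc].
- by apply: continuous_comp; [exact: cvg_snd|exact: coc'].
rewrite big_sumType /=.
rewrite [v in LHS]cob [w in LHS]cob'.
rewrite (_ : \sum_i co i v *: (b i, 0) = (\sum_i co i v *: b i, 0)); last first.
  by apply: (big_ind2 (fun (x : V * W) y => x = (y, 0))) => // [x1 x2 y1 y2 -> ->|i _];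
    congr pair; rewrite /= ?addr0 ?scaler0.
rewrite (_ : \sum_i co' i w *: (0, b' i) = (0, \sum_i co' i w *: b' i)); last first.
  by apply: (big_ind2 (fun (x : V * W) y => x = (0, y))) => // [x1 x2 y1 y2 -> ->|i _];
    congr pair; rewrite /= ?addr0 ?scaler0.
by congr pair; rewrite /= ?addr0 ?add0r.
Qed.

End FinDimInstances.

(** * Smooth functions on a subset *)

Section SmoothOn.
Context {R : realType}.
Implicit Types V W : normedModType R.

Lemma local_extension_at V W (N : set V) (f g : V -> W) p :
  local_extension N f p g -> exists O, [/\ open O, O p, smooth_open O g,
    (forall x, O x -> N x -> g x = f x) & forall q, O q -> local_extension N f q g].
Proof. by move=> [ O [ oO Op sg E]]; exists O; split=> // q Oq; exists O. Qed.

Lemma smooth_on_eq V W (N : set V) (f g : V -> W) :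
  (forall x, N x -> f x = g x) -> smooth_on N f -> smooth_on N g.
Proof.
move=> eqfg sf p Np; have [h [ O [ oO Op sh E]]] := sf p Np.
by exists h, O; split=> // x Ox Nx; rewrite E // eqfg.
Qed.

Lemma smooth_on_open V W (N : set V) (f : V -> W) :
  (forall p, N p -> exists O, [/\ open O, O p & smooth_open O f]) -> smooth_on N f.
Proof. by move=> sf p /sf[ O [ oO Op s]]; exists f, O. Qed.

Lemma smooth_on_cst V W (N : set V) (w : W) : smooth_on N (fun=> w).
Proof.
apply: smooth_on_open => p _; exists setT; split=> //; first exact: openT.
by move=> k; apply: Ck_cst; exact: openT.
Qed.

Lemma smooth_on_id V (N : set V) : smooth_on N (fun x => x).
Proof.
apply: smooth_on_open => p _; exists setT; split=> //; first exact: openT.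
by move=> k; apply: Ck_id; exact: openT.
Qed.

Lemma local_extension_comp V W W' (N : set V) (l : {linear W -> W'}) (f g : V -> W) p :
  continuous l -> local_extension N f p g ->
  local_extension N (fun x => l (f x)) p (fun x => l (g x)).
Proof.
move=> lc [ O [ oO Op sg E]]; exists O; split=> // [k|x Ox Nx]; last by rewrite E.
exact: (Ck_linear oO lc (sg k)).
Qed.

Lemma smooth_on_linear V W W' (N : set V) (l : {linear W -> W'}) (f : V -> W) :
  continuous l -> smooth_on N f -> smooth_on N (fun x => l (f x)).
Proof.
move=> lc sf p /sf[g eg]; exists (fun x => l (g x)).
exact: local_extension_comp.
Qed.

Lemma smooth_openI V W (O O' : set V) (f : V -> W) :
  smooth_open O f -> smooth_open (O `&` O') f.
Proof. by move=> sf k; apply: Ck_sub (sf k) => x []. Qed.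

Lemma smooth_openIr V W (O O' : set V) (f : V -> W) :
  smooth_open O f -> smooth_open (O' `&` O) f.
Proof. by move=> sf k; apply: Ck_sub (sf k) => x []. Qed.

Lemma local_extensionD V W (N : set V) (f1 f2 g1 g2 : V -> W) p :
  local_extension N f1 p g1 -> local_extension N f2 p g2 ->
  local_extension N (fun x => f1 x + f2 x) p (fun x => g1 x + g2 x).
Proof.
move=> [ O1 [ o1 p1 s1 E1]] [ O2 [ o2 p2 s2 E2]].
have o12 := openI o1 o2; exists (O1 `&` O2); split=> // [k|x [] *]; last by rewrite E1 // E2.
by apply: Ck_add => //; [exact: smooth_openI|exact: smooth_openIr].
Qed.

Lemma local_extensionM V (N : set V) (f1 f2 g1 g2 : V -> R) p :
  local_extension N f1 p g1 -> local_extension N f2 p g2 ->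
  local_extension N (fun x => f1 x * f2 x) p (fun x => g1 x * g2 x).
Proof.
move=> [ O1 [ o1 p1 s1 E1]] [ O2 [ o2 p2 s2 E2]].
have o12 := openI o1 o2; exists (O1 `&` O2); split=> // [k|x [] *]; last by rewrite E1 // E2.
by apply: Ck_mul => //; [exact: smooth_openI|exact: smooth_openIr].
Qed.

Lemma local_extensionV V (N : set V) (f g : V -> R) p : N p -> f p != 0 ->
  local_extension N f p g -> local_extension N (fun x => (f x)^-1) p (fun x => (g x)^-1).
Proof.
move=> Np fp0 [ O [ oO Op sg E]].
have oO' : open (O `&` [set x | g x != 0]).
  rewrite openE => x [ Ox gx0].
  have [cg _] := sg 0%N.
  near=> y; split; first by near: y; exact: open_nbhs_nbhs.
  near: y; exact: (cvgr_neq0 _ (cg x Ox) gx0).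
exists (O `&` [set x | g x != 0]); split=> //.
- by split=> //=; rewrite E.
- by move=> k; apply: Ck_inv => // [x []//|]; exact: smooth_openI.
- by move=> x [ Ox _] Nx; rewrite E.
Unshelve. all: by end_near. Qed.

Lemma smooth_onD V W (N : set V) (f g : V -> W) :
  smooth_on N f -> smooth_on N g -> smooth_on N (fun x => f x + g x).
Proof.
by move=> sf sg p Np; have [f' ?] := sf p Np; have [g' ?] := sg p Np;
  eexists; apply: local_extensionD; eassumption.
Qed.

Lemma smooth_onM V (N : set V) (f g : V -> R) :
  smooth_on N f -> smooth_on N g -> smooth_on N (fun x => f x * g x).
Proof.
by move=> sf sg p Np; have [f' ?] := sf p Np; have [g' ?] := sg p Np;
  eexists; apply: local_extensionM; eassumption.
Qed.

Lemma smooth_onV V (N : set V) (f : V -> R) : (forall x, N x -> f x != 0) ->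
  smooth_on N f -> smooth_on N (fun x => (f x)^-1).
Proof.
by move=> f0 sf p Np; have [f' ?] := sf p Np;
  eexists; apply: local_extensionV; eauto.
Qed.

Lemma smooth_onN V W (N : set V) (f : V -> W) :
  smooth_on N f -> smooth_on N (fun x => - f x).
Proof.
move=> sf; apply: (@smooth_on_eq _ _ _ (fun x => -1 *: f x)) => [x _|].
  by rewrite scaleN1r.
apply: (@smooth_on_linear _ _ _ _ ( *:%R (-1) : {linear W -> W}) f) => //.
exact: scaler_continuous.
Qed.

Lemma smooth_onB V W (N : set V) (f g : V -> W) :
  smooth_on N f -> smooth_on N g -> smooth_on N (fun x => f x - g x).
Proof. by move=> sf sg; apply: smooth_onD => //; exact: smooth_onN. Qed.

Lemma smooth_on_sum V W (N : set V) (I : Type) (r : seq I) (f : I -> V -> W) :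
  (forall i, smooth_on N (f i)) -> smooth_on N (fun x => \sum_(i <- r) f i x).
Proof.
move=> sf; elim: r => [|i r IH].
  by apply: smooth_on_eq (@smooth_on_cst _ _ N 0) => x _; rewrite big_nil.
by apply: smooth_on_eq (smooth_onD (sf i) IH) => x _; rewrite big_cons.
Qed.

Definition scaler_to W (w : W) (t : R) : W := t *: w.

Lemma scaler_to_linear W (w : W) : linear (scaler_to w : R -> W).
Proof. by move=> a x y; rewrite /scaler_to scalerDl scalerA. Qed.

HB.instance Definition _ W (w : W) :=
  GRing.isLinear.Build R R W _ (scaler_to w) (scaler_to_linear w).

Lemma scaler_to_continuous W (w : W) : continuous (scaler_to w).
Proof. by move=> x; apply: cvgZr_tmp; exact: cvg_id. Qed.

Lemma smooth_on_scale V W (N : set V) (f : V -> R) (w : W) :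
  smooth_on N f -> smooth_on N (fun x => f x *: w).
Proof. by move=> sf; apply: (smooth_on_linear (@scaler_to_continuous _ w)). Qed.

Lemma smooth_on_mxP V (N : set V) m n (f : V -> 'M[R]_(m, n)) :
  smooth_on N f <-> forall i j, smooth_on N (fun x => f x i j).
Proof.
split=> [sf i j|sf].
  exact: (smooth_on_linear (@mx_entry_continuous _ _ _ i j) sf).
apply: (@smooth_on_eq _ _ _ (fun x => \sum_ij f x ij.1 ij.2 *: delta_mx ij.1 ij.2)).
  by move=> x _; rewrite [RHS]matrix_sum_delta pair_bigA.
by apply: smooth_on_sum => ij; apply: smooth_on_scale; exact: sf.
Qed.

Definition inl_pair V W (v : V) : V * W := (v, 0).
Definition inr_pair V W (w : W) : V * W := (0, w).

Lemma inl_pair_linear V W : linear (@inl_pair V W).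
Proof. by move=> a x y; congr pair; rewrite /= scaler0 addr0. Qed.
Lemma inr_pair_linear V W : linear (@inr_pair V W).
Proof. by move=> a x y; congr pair; rewrite /= scaler0 addr0. Qed.

HB.instance Definition _ V W :=
  GRing.isLinear.Build R V (V * W)%type _ (@inl_pair V W) (@inl_pair_linear V W).
HB.instance Definition _ V W :=
  GRing.isLinear.Build R W (V * W)%type _ (@inr_pair V W) (@inr_pair_linear V W).

Lemma inl_pair_continuous V W : continuous (@inl_pair V W).
Proof. by move=> x; apply: cvg_pair; [exact: cvg_id|exact: cvg_cst]. Qed.
Lemma inr_pair_continuous V W : continuous (@inr_pair V W).
Proof. by move=> x; apply: cvg_pair; [exact: cvg_cst|exact: cvg_id]. Qed.

Lemma smooth_on_pair V W W' (N : set V) (f : V -> W) (g : V -> W') :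
  smooth_on N f -> smooth_on N g -> smooth_on N (fun x => (f x, g x)).
Proof.
move=> sf sg; apply: (@smooth_on_eq _ _ _ (fun x => inl_pair W' (f x) + inr_pair W (g x))).
  by move=> x _; congr pair; rewrite /= ?addr0 ?add0r.
by apply: smooth_onD; apply: smooth_on_linear => //;
  [exact: inl_pair_continuous|exact: inr_pair_continuous].
Qed.

Lemma smooth_on_fst V W W' (N : set V) (f : V -> (W * W')%type) :
  smooth_on N f -> smooth_on N (fun x => (f x).1).
Proof.
by move=> sf; apply: (@smooth_on_linear _ _ _ _ (fst : {linear _ -> _}) f) => // x;
  exact: cvg_fst.
Qed.

Lemma smooth_on_snd V W W' (N : set V) (f : V -> (W * W')%type) :
  smooth_on N f -> smooth_on N (fun x => (f x).2).
Proof.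
by move=> sf; apply: (@smooth_on_linear _ _ _ _ (snd : {linear _ -> _}) f) => // x;
  exact: cvg_snd.
Qed.

End SmoothOn.

(** * Differentials along tangent vectors, and Lie brackets *)

Section Differentials.
Context {R : realType}.
Implicit Types V W : normedModType R.

Lemma derive_curve V W (g : V -> W) (c : R -> V) (t : R) :
  differentiable g (c t) -> derivable c t 1 ->
  is_derive t 1 (fun s => g (c s)) ('D_('D_1 c t) g (c t)).
Proof.
move=> dg /derivable1_diffP dc.
have dgc : differentiable (g \o c) t by apply: differentiable_comp.
split; first exact/derivable1_diffP.
by rewrite (deriveE _ dgc) (deriveE _ dg) (deriveE _ dc) diff_comp.
Qed.

Lemma derive_linearr V (g : V -> R) p : differentiable g p ->
  forall (a : R) u v, 'D_(a *: u + v) g p = a * 'D_u g p + 'D_v g p.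
Proof. by move=> dg a u v; rewrite !(deriveE _ dg) linearP. Qed.

Lemma smooth_differentiable V (O : set V) (f : V -> R) (p : V) :
  fin_dim V -> open O -> O p -> smooth_open O f -> differentiable f p.
Proof. by move=> fV oO Op sf; apply: (Ck1_differentiable fV oO Op (sf 1%N)). Qed.

Lemma smooth_derivable V W (O : set V) (f : V -> W) (p v : V) :
  O p -> smooth_open O f -> derivable f p v.
Proof. by move=> Op sf; have [_ /(_ v)[+ _]] := sf 1%N; apply. Qed.

Lemma smooth_derive V W (O : set V) (f : V -> W) (v : V) :
  smooth_open O f -> smooth_open O (fun x => 'D_v f x).
Proof. by move=> sf k; have [_ /(_ v)[]] := sf k.+1. Qed.

(** Two extensions agree on a curve inside [N] with velocity [v], so the chain rule along this curve
    gives them the same derivative. This is what makes [dif] independent of its choice. *)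
Lemma tangent_derive V (N : set V) (f g1 g2 : V -> R) (p v : V) :
  fin_dim V -> local_extension N f p g1 -> local_extension N f p g2 ->
  tangent N p v -> 'D_v g1 p = 'D_v g2 p.
Proof.
move=> fV [ O1 [ o1 p1 s1 E1]] [ O2 [ o2 p2 s2 E2]] [ O0 [c [ o0 O00 sc cN [c0 <-]]]].
have dc : derivable c 0 1 by apply: smooth_derivable sc.
have d1 : differentiable g1 (c 0) by rewrite c0; apply: smooth_differentiable s1.
have d2 : differentiable g2 (c 0) by rewrite c0; apply: smooth_differentiable s2.
have [_ H1] := derive_curve d1 dc; have [_ H2] := derive_curve d2 dc.
rewrite derive1E -c0 -H1 -H2; apply: near_eq_derive.
have cc : {for 0, continuous c} by have [+ _] := sc 0%N; apply.
near=> t; rewrite E1 ?E2 //.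
- by near: t; apply: cc; rewrite c0; exact: open_nbhs_nbhs.
- by apply: cN; near: t; exact: open_nbhs_nbhs.
- by near: t; apply: cc; rewrite c0; exact: open_nbhs_nbhs.
- by apply: cN; near: t; exact: open_nbhs_nbhs.
Unshelve. all: by end_near. Qed.

(** Exposes the extension picked by [xget]. A single [g] serves all directions [v], which gives the
    linearity of [dif] in [v]. *)
Lemma dif_spec V W (N : set V) (f : V -> W) p : smooth_on N f -> N p ->
  exists g, local_extension N f p g /\ forall v, dif N f p v = 'D_v g p.
Proof.
move=> sf Np; exists (xget f [set g | local_extension N f p g]); split=> //.
by have [g eg] := sf p Np; exact: (@xgetPex _ f [set g | local_extension N f p g] (ex_intro _ g eg)).
Qed.

Lemma co_inj V (I : finType) (b : I -> V) (co : I -> {linear V -> R}) :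
  (forall w, w = \sum_i co i w *: b i) -> forall x y, (forall i, co i x = co i y) -> x = y.
Proof. by move=> cob x y E; rewrite (cob x) (cob y); under eq_bigr do rewrite E. Qed.

(** By [tangent_derive], coordinate by coordinate, any extension may replace the chosen one; the
    rules of calculus below all start from a convenient extension. *)
Lemma dif_local V W (N : set V) (f g : V -> W) p v : fin_dim V -> fin_dim W -> N p ->
  local_extension N f p g -> tangent N p v -> dif N f p v = 'D_v g p.
Proof.
move=> fV [I [b [co [coc cob]]]] Np eg tv.
have eg' : local_extension N f p (xget f [set g | local_extension N f p g]).
  exact: (@xgetPex _ f [set g | local_extension N f p g] (ex_intro _ g eg)).
rewrite /dif; move: (xget _ _) eg' => g' eg'.
have dd h : local_extension N f p h -> derivable h p v.
  by move=> [ O [ oO Op sh _]]; apply: smooth_derivable sh.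
apply: (co_inj cob) => i.
rewrite -(derive_linear (coc i) (dd _ eg)).2 -(derive_linear (coc i) (dd _ eg')).2.
by apply: (tangent_derive fV) tv; apply: (local_extension_comp (coc i)); eassumption.
Qed.

Section Rules.
Variables (V : normedModType R) (fV : fin_dim V) (N : set V) (p : V) (Np : N p).

Lemma dif_linearr (f : V -> R) : smooth_on N f ->
  forall (a : R) u v, dif N f p (a *: u + v) = a * dif N f p u + dif N f p v.
Proof.
move=> sf a u v; have [g [[ O [ oO Op sg _]] H]] := dif_spec sf Np.
by rewrite !H; apply: derive_linearr; apply: (smooth_differentiable fV oO Op).
Qed.

Variables (v : V) (tv : tangent N p v).

Lemma dif_eq W (f g : V -> W) : fin_dim W -> smooth_on N f ->
  (forall x, N x -> f x = g x) -> dif N f p v = dif N g p v.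
Proof.
move=> fW sf E; have [h [[ O [ oO Op sh Eh]] H]] := dif_spec sf Np.
rewrite H; apply: esym; apply: (dif_local fV fW Np) tv.
by exists O; split=> // x Ox Nx; rewrite Eh // E.
Qed.

Lemma dif_cst W (w : W) : fin_dim W -> dif N (fun=> w) p v = 0.
Proof.
move=> fW; rewrite (dif_local fV fW Np (g := cst w)) ?derive_cst //.
by exists setT; split=> //; [exact: openT|move=> k; apply: Ck_cst; exact: openT].
Qed.

Lemma dif_id : dif N (fun x => x) p v = v.
Proof.
rewrite (dif_local fV fV Np (g := id)) ?derive_id //.
by exists setT; split=> //; [exact: openT|move=> k; apply: Ck_id; exact: openT].
Qed.

Lemma dif_linear W W' (l : {linear W -> W'}) (f : V -> W) : fin_dim W -> fin_dim W' ->
  continuous l -> smooth_on N f -> dif N (fun x => l (f x)) p v = l (dif N f p v).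
Proof.
move=> fW fW' lc sf; have [g [eg H]] := dif_spec sf Np.
rewrite H (dif_local fV fW' Np (local_extension_comp lc eg)) //.
have [ O [ oO Op sg _]] := eg.
by have [_ <-] := derive_linear lc (@smooth_derivable _ _ _ _ _ v Op sg).
Qed.

Lemma difD W (f g : V -> W) : fin_dim W -> smooth_on N f -> smooth_on N g ->
  dif N (fun x => f x + g x) p v = dif N f p v + dif N g p v.
Proof.
move=> fW sf sg; have [f' [ef Hf]] := dif_spec sf Np; have [g' [eg Hg]] := dif_spec sg Np.
rewrite Hf Hg (dif_local fV fW Np (local_extensionD ef eg)) //.
have [ O [ oO Op sf' _]] := ef; have [ O' [ oO' Op' sg' _]] := eg.
by rewrite -(deriveD (@smooth_derivable _ _ _ _ _ v Op sf') (@smooth_derivable _ _ _ _ _ v Op' sg')).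
Qed.

Lemma difM (f g : V -> R) : smooth_on N f -> smooth_on N g ->
  dif N (fun x => f x * g x) p v = dif N f p v * g p + f p * dif N g p v.
Proof.
move=> sf sg; have [f' [ef Hf]] := dif_spec sf Np; have [g' [eg Hg]] := dif_spec sg Np.
rewrite Hf Hg (dif_local fV (fin_dim_R) Np (local_extensionM ef eg)) //.
have [ O [ oO Op sf' E]] := ef; have [ O' [ oO' Op' sg' E']] := eg.
rewrite -(E p Op Np) -(E' p Op' Np).
rewrite (deriveM (@smooth_derivable _ _ _ _ _ v Op sf') (@smooth_derivable _ _ _ _ _ v Op' sg')).
exact: (etrans (addrC _ _) (congr2 (fun a b => a + b) (mulrC _ _) erefl)).
Qed.

Lemma difZ (f : V -> R) (a : R) : smooth_on N f ->
  dif N (fun x => a * f x) p v = a * dif N f p v.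
Proof.
by move=> sf; rewrite (difM (@smooth_on_cst _ _ _ N a) sf) dif_cst ?mul0r ?add0r //; exact: fin_dim_R.
Qed.

Lemma difN W (f : V -> W) : fin_dim W -> smooth_on N f ->
  dif N (fun x => - f x) p v = - dif N f p v.
Proof.
move=> fW sf; rewrite -scaleN1r.
have lc : continuous ( *:%R (-1) : W -> W) by exact: scaler_continuous.
rewrite -(dif_linear (l := ( *:%R (-1) : {linear W -> W})) fW fW lc sf).
by apply: (dif_eq fW (smooth_onN sf)) => x _; rewrite /= scaleN1r.
Qed.

Lemma difB W (f g : V -> W) : fin_dim W -> smooth_on N f -> smooth_on N g ->
  dif N (fun x => f x - g x) p v = dif N f p v - dif N g p v.
Proof. by move=> fW sf sg; rewrite (difD fW sf (smooth_onN sg)) difN. Qed.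

Lemma dif_sum W (I : Type) (r : seq I) (f : I -> V -> W) : fin_dim W ->
  (forall i, smooth_on N (f i)) ->
  dif N (fun x => \sum_(i <- r) f i x) p v = \sum_(i <- r) dif N (f i) p v.
Proof.
move=> fW sf; elim: r => [|i r IH].
  rewrite big_nil -[RHS](dif_cst 0 fW); apply: dif_eq => // [|x _]; last by rewrite big_nil.
  exact: smooth_on_sum.
rewrite big_cons -IH -difD //; last exact: smooth_on_sum.
by apply: dif_eq => // [|x _]; [exact: smooth_on_sum|rewrite big_cons].
Qed.

Lemma dif_scale W (f : V -> R) (w : W) : fin_dim W -> smooth_on N f ->
  dif N (fun x => f x *: w) p v = dif N f p v *: w.
Proof.
move=> fW sf.
exact: (dif_linear (fin_dim_R) fW (@scaler_to_continuous _ _ w) sf).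
Qed.

Lemma dif_mx m n (f : V -> 'M[R]_(m, n)) i j : smooth_on N f ->
  dif N (fun x => f x i j) p v = (dif N f p v) i j.
Proof.
move=> sf.
exact: (dif_linear (fin_dim_mx m n) (fin_dim_R) (@mx_entry_continuous _ _ _ i j) sf).
Qed.

End Rules.

Section VectorFields.
Variables (V : normedModType R) (fV : fin_dim V) (N : set V).

(** One extension [g] of [f] computes the differential at all points of [N] near [p]. Pairing its
    partial derivatives with the coordinates of an extension of [X] gives an extension of the
    derivative. *)
Lemma dif_smooth_R (f : V -> R) (X : V -> V) : smooth_on N f -> vfield N X ->
  smooth_on N (fun p => dif N f p (X p)).
Proof.
move=> sf [sX tX] p Np; have [I [b [co [coc cob]]]] := fV.
have [g /local_extension_at[ O1 [ o1 p1 s1 _ H1]]] := sf p Np.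
have [h [ O2 [ o2 p2 s2 E2]]] := sX p Np.
exists (fun q => \sum_i co i (h q) * 'D_(b i) g q), (O1 `&` O2).
have o12 := openI o1 o2; split=> //.
- move=> k; elim: (index_enum I) => [|i r IH].
    by apply: Ck_eq (Ck_cst k (0 : R) o12) => // x _; rewrite big_nil.
  apply: (@Ck_eq _ _ _ k (O1 `&` O2) (fun x => co i (h x) * 'D_(b i) g x +
      \sum_(j <- r) co j (h x) * 'D_(b j) g x)) => // [x _|]; first by rewrite big_cons.
  apply: Ck_add => //; apply: Ck_mul => //.
    by apply: (Ck_linear o12 (coc i)); apply: smooth_openIr; exact: s2.
  by apply: smooth_openI; apply: smooth_derive; exact: s1.
- move=> x [ O1x O2x] Nx; rewrite (dif_local fV fin_dim_R Nx (H1 x O1x) (tX x Nx)).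
  rewrite E2 // !(deriveE _ (smooth_differentiable fV o1 O1x s1)).
  rewrite [X x in RHS](cob (X x)) linear_sum; apply: eq_bigr => i _.
  by rewrite linearZ (deriveE _ (smooth_differentiable fV o1 O1x s1)).
Qed.

Lemma dif_smooth W (f : V -> W) (X : V -> V) : fin_dim W -> smooth_on N f -> vfield N X ->
  smooth_on N (fun p => dif N f p (X p)).
Proof.
move=> fW sf vX; have [I [b [co [coc cob]]]] := fW.
apply: (@smooth_on_eq _ _ _ _ (fun p => \sum_i dif N (fun x => co i (f x)) p (X p) *: b i)).
  move=> p Np; rewrite [RHS]cob; apply: eq_bigr => i _; congr (_ *: _).
  by apply: (dif_linear fV Np) => //; [exact: vX.2|exact: fin_dim_R].
apply: smooth_on_sum => i; apply: smooth_on_scale; apply: dif_smooth_R => //.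
exact: smooth_on_linear.
Qed.

(** In terms of extensions both iterated derivatives consist of a first order part, which produces
    the bracket, and a Hessian part, which is symmetric by [derive_swap] and cancels. *)
Lemma dif_comm (f : V -> R) (X Y : V -> V) p : N p -> smooth_on N f ->
  vfield N X -> vfield N Y ->
  dif N (fun q => dif N f q (Y q)) p (X p) - dif N (fun q => dif N f q (X q)) p (Y p)
  = dif N f p (lie N X Y p).
Proof.
move=> Np sf vX vY; have [I [b [co [coc cob]]]] := fV.
have [g [eg Hg]] := dif_spec sf Np.
have /local_extension_at[ O1 [ o1 p1 s1 _ H1]] := eg.
have dg x : O1 x -> differentiable g x by move=> O1x; exact: (smooth_differentiable fV o1 O1x s1).
have expand v x : O1 x -> 'D_v g x = \sum_i co i v * 'D_(b i) g x.
  move=> O1x; rewrite (deriveE _ (dg x O1x)) [v in LHS]cob linear_sum; apply: eq_bigr => i _.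
  by rewrite linearZ (deriveE _ (dg x O1x)).
have key (Z T : V -> V) : vfield N Z -> vfield N T ->
   dif N (fun q => dif N f q (T q)) p (Z p) =
   \sum_i (co i (dif N T p (Z p)) * 'D_(b i) g p +
     co i (T p) * \sum_j co j (Z p) * 'D_(b j) (fun x => 'D_(b i) g x) p).
  move=> vZ vT; have [sT tT] := vT.
  have [h [[ O2 [ o2 p2 s2 E2]] Hh]] := dif_spec sT Np.
  have o12 := openI o1 o2.
  pose F i q := co i (h q) * 'D_(b i) g q.
  have sF i k : Ck k (O1 `&` O2) (F i).
    apply: Ck_mul => //.
      by apply: (Ck_linear o12 (coc i)); apply: smooth_openIr; exact: s2.
    by apply: smooth_openI; apply: smooth_derive; exact: s1.
  rewrite (dif_local fV fin_dim_R Np (g := fun q => \sum_i F i q)); last 2 first.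
  - exists (O1 `&` O2); split=> //.
      move=> k; elim: (index_enum I) => [|i r IH].
        by apply: Ck_eq (Ck_cst k (0 : R) o12) => // x _; rewrite big_nil.
      apply: (@Ck_eq _ _ _ k (O1 `&` O2) (fun x => F i x + \sum_(j <- r) F j x)) => // [x _|].
        by rewrite big_cons.
      exact: Ck_add.
    move=> x [ O1x O2x] Nx; rewrite (dif_local fV fin_dim_R Nx (H1 x O1x) (tT x Nx)).
    by rewrite -E2 // expand.
  - exact: vZ.2.
  have dF i : derivable (F i) p (Z p).
    by have [_ /(_ (Z p))[+ _]] := sF i 1%N; apply.
  have -> : 'D_(Z p) (fun q => \sum_i F i q) p = \sum_i 'D_(Z p) (F i) p.
    elim: (index_enum I) => [|i r IH].
      rewrite big_nil (_ : (fun q => _) = cst 0) ?derive_cst //.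
      by apply/funext => q; rewrite big_nil.
    rewrite big_cons -IH -deriveD //.
      exact: (congr1 (fun G => 'D_(Z p) G p) (funext (fun q => big_cons _ _ _ _ _ _))).
    elim: r {IH} => [|j r IH].
      rewrite (_ : (fun q => _) = cst 0); first exact: derivable_cst.
      by apply/funext => q; rewrite big_nil.
    rewrite (_ : (fun q => _) = F j + (fun q => \sum_(i <- r) F i q)).
      exact: (derivableD (dF j) IH).
    by apply/funext => q; rewrite big_cons.
  apply: eq_bigr => i _.
  have dh : derivable h p (Z p) by exact: smooth_derivable s2.
  have [d1 e1] := derive_linear (coc i) dh.
  have s1' := smooth_derive (b i) s1.
  have d2 : derivable (fun x => 'D_(b i) g x) p (Z p) by exact: smooth_derivable s1'.
  have -> : 'D_(Z p) (F i) p = 'D_(Z p) ((co i \o h) * (fun x => 'D_(b i) g x)) p by [].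
  rewrite (deriveM d1 d2) e1 /= Hh (E2 p) // addrC; congr (_ + _); first exact: mulrC.
  have dg' : differentiable (fun x => 'D_(b i) g x) p.
    exact: (smooth_differentiable fV o1 p1 s1').
  rewrite (deriveE _ dg') [Z p in LHS](cob (Z p)) linear_sum; congr (_ * _).
  by apply: eq_bigr => j _; rewrite linearZ (deriveE _ dg').
apply: (etrans (congr2 (fun a b => a - b) (key _ _ vX vY) (key _ _ vY vX))).
rewrite Hg expand // /lie.
rewrite !big_split /= opprD addrACA -[RHS]addr0; congr (_ + _).
  by rewrite -sumrB; apply: eq_bigr => i _; rewrite -mulrBl linearB.
apply/eqP; rewrite subr_eq0; apply/eqP.
under eq_bigr do rewrite mulr_sumr.
under [RHS]eq_bigr do rewrite mulr_sumr.
rewrite exchange_big; apply: eq_bigr => i _; apply: eq_bigr => j _.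
by rewrite !mulrA [co i _ * _]mulrC (derive_swap _ _ o1 p1 (s1 2%N)).
Qed.

End VectorFields.

Lemma tangent_open V (N U : set V) p v : open_in N U -> U p ->
  tangent U p v <-> tangent N p v.
Proof.
move=> [ O oO ->] [Np Op]; split=> [[ O' [c [ oO' O0 sc cN c0]]]|[ O' [c [ oO' O0 sc cN c0]]]].
  by exists O', c; split=> // t /cN[].
have cc t : O' t -> {for t, continuous c} by have [+ _] := sc 0%N; apply.
have oO'' : open (O' `&` c @^-1` O).
  rewrite openE => t [ O't Oct]; near=> s; split.
    by near: s; exact: open_nbhs_nbhs.
  by near: s; apply: (cc t O't); exact: open_nbhs_nbhs.
exists (O' `&` c @^-1` O), c; split=> //.
- by split=> //=; rewrite c0.1.
- exact: smooth_openI.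
- by move=> t [ O't Oct]; split=> //; exact: cN.
Unshelve. all: by end_near. Qed.

End Differentials.

Section Constancy.
Context {R : realType}.
Implicit Types V W : normedModType R.

Lemma Ck_local V W k (O : set V) (f : V -> W) :
  (forall x, O x -> exists O', [/\ open O', O' x & Ck k O' f]) -> Ck k O f.
Proof.
elim: k f => [|k IH] f H; (have cf x : O x -> {for x, continuous f} by
    move=> /H[ O' [ oO' O'x [cf _]]]; exact: cf); split=> // v; split=> [x|].
  by move=> /H[ O' [ oO' O'x [_ /(_ v)[df _]]]]; exact: df.
by apply: IH => x /H[ O' [ oO' O'x [_ /(_ v)[_ Df]]]]; exists O'.
Qed.

Lemma smooth_on_openP V W (O : set V) (f : V -> W) : open O ->
  smooth_on O f -> smooth_open O f.
Proof.
move=> oO sf k; apply: Ck_local => x Ox; have [g [ O' [ oO' O'x sg E]]] := sf x Ox.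
have oI := openI oO oO'; exists (O `&` O'); split=> //.
apply: (@Ck_eq _ _ _ k (O `&` O') g) => //; first by move=> y [] *; exact: E.
by apply: Ck_sub (sg k) => y [].
Qed.

Section Line.
Variables (V W : normedModType R) (O : set V) (oO : open O) (x v : V).
Let I := [set t : R | O (t *: v + x)].

Lemma open_line : open I.
Proof.
rewrite openE => t It.
have c : {for t, continuous (fun t : R => t *: v + x)}.
  by apply: cvgD; [apply: cvgZr_tmp; exact: cvg_id|exact: cvg_cst].
by apply: c; exact: open_nbhs_nbhs.
Qed.

Lemma line_derive (F : V -> W) t (w : R) : derivable F (t *: v + x) v ->
  derivable (fun t : R => F (t *: v + x)) t w /\
  'D_w (fun t : R => F (t *: v + x)) t = w *: 'D_v F (t *: v + x).
Proof.
move=> dF; have [d1 e1] := is_derive_line dF.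
have df : differentiable (fun t : R => F (t *: v + x)) t by apply/derivable1_diffP.
split; first exact: diff_derivable.
by rewrite -e1 (deriveE _ df) (deriveE _ df) -[w in LHS]mulr1 -[w * 1]/(w *: 1) linearZ.
Qed.

Lemma Ck_line k (F : V -> W) : Ck k O F -> Ck k I (fun t : R => F (t *: v + x)).
Proof.
elim: k F => [|k IH] F [cF H].
  split=> // t It; apply: continuous_comp; last exact: cF.
  by apply: cvgD; [apply: cvgZr_tmp; exact: cvg_id|exact: cvg_cst].
split=> [t It|w].
  apply: continuous_comp; last exact: cF.
  by apply: cvgD; [apply: cvgZr_tmp; exact: cvg_id|exact: cvg_cst].
have [dF D] := H v; split=> [t It|].
  exact: (line_derive w (dF _ It)).1.
have sc : continuous ( *:%R w : W -> W) by exact: scaler_continuous.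
have C := @Ck_linear _ _ _ _ k I ( *:%R w : {linear W -> W}) _ open_line sc (IH _ D).
apply: Ck_eq C; first exact: open_line.
by move=> t It; rewrite (line_derive w (dF _ It)).2.
Qed.

End Line.

(** In a chart, [p] is joined to a nearby point by a segment, whose image is a curve in [U] with
    tangent velocity; [f] has zero derivative along it, and the mean value theorem concludes. *)
Lemma dif0_locally_constant V n (N U : set V) (f : V -> R) p : fin_dim V ->
  submanifold n N -> open_in N U -> U p -> smooth_on U f ->
  (forall q v, U q -> tangent U q v -> dif U f q v = 0) ->
  \forall q \near p, U q -> f q = f p.
Proof.
move=> fV mN [OU oOU UE] Up sf df.
have Np : N p by move: Up; rewrite UE => -[].
have [ O [U1 [F [ oO [ O1 oO1 U1E] U1p [G [sF sG FG GF]]]]]] := mN p Np.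
have {}sF := smooth_on_openP oO sF.
have [Ox0 Fx0] := GF p U1p; set x0 := G p in Ox0 Fx0.
(* A ball of parameters whose image stays in [U]; being convex, it contains the segments that leave
   [x0 = G p]. *)
have [r /= r0 rB] : exists2 r : R, 0 < r & ball x0 r `<=` O `&` F @^-1` OU.
  have : \forall x \near x0, (O `&` F @^-1` OU) x.
    apply: filterI; first exact: open_nbhs_nbhs.
    have [cF _] := sF 0%N; apply: (cF x0 Ox0); rewrite Fx0.
    by apply: open_nbhs_nbhs; split=> //; move: Up; rewrite UE => -[].
  by move=> /nbhs_ballP[r /= r0 rB]; exists r.
have [g [ Og [ oOg Ogp sg gE]]] := sG p U1p.
have [cg _] := sg 0%N.
near=> q; move=> Uq.
have [Nq OUq] : N q /\ OU q by move: Uq; rewrite UE.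
have O1q : O1 q.
  by near: q; apply: open_nbhs_nbhs; split=> //; move: U1p; rewrite U1E => -[].
have U1q : U1 q by rewrite U1E.
have Ogq : Og q by near: q; exact: open_nbhs_nbhs.
have Bq : ball x0 r (G q).
  rewrite -gE //; near: q; apply: (cg p Ogp); rewrite gE //; exact: nbhsx_ballx.
have [_ FGq] := GF q U1q.
set v := G q - x0.
have inB (t : R) : `|t| <= 1 -> ball x0 r (t *: v + x0).
  move=> t1; move: Bq; rewrite -!ball_normE /ball_ /= opprD addrCA subrr addr0 normrN normrZ.
  rewrite -normrN opprB -/v; apply: le_lt_trans.
  by rewrite ler_piMl.
pose c (t : R) := F (t *: v + x0).
have in1 (t : R) : `|t| <= 1 -> U (c t).
  move=> t1; have [ Ot OUt] := rB _ (inB t t1); rewrite UE; split=> //.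
  by have [] := FG _ Ot; rewrite U1E => -[].
have dc (t : R) : `|t| <= 1 -> is_derive t 1 (fun s => f (c s)) 0.
  move=> t1.
  have Uct := in1 t t1; have [h [eh Hh]] := dif_spec sf Uct.
  have [ Oh [ oOh Ohp sh hE]] := eh.
  have [ Ot OUt] := rB _ (inB t t1).
  have dF : derivable F (t *: v + x0) v by exact: smooth_derivable sF.
  have [dct Dct] := line_derive 1 dF.
  have tan : tangent U (c t) ('D_v F (t *: v + x0)).
    pose B := ball x0 r; pose y := t *: v + x0.
    have oB : open B by exact: ball_open.
    exists [set s : R | B (s *: v + y)], (fun s => F (s *: v + y)); split.
    - exact: open_line.
    - by rewrite /= scale0r add0r; exact: inB.
    - by move=> k; apply: Ck_line => //; apply: Ck_sub (sF k) => z /rB[].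
    - move=> s /= /rB[ Os OUs]; rewrite UE; split=> //.
      by have [] := FG _ Os; rewrite U1E => -[].
    - split; first by rewrite scale0r add0r.
      rewrite derive1E; have dF0 : derivable F (0 *: v + y) v by rewrite scale0r add0r.
      by rewrite (line_derive 1 dF0).2 scale1r scale0r add0r.
  have dh : differentiable h (c t) by apply: (smooth_differentiable fV oOh Ohp sh).
  have [d1 d2] := derive_curve dh dct.
  have E : \forall s \near t, h (c s) = f (c s).
    near=> s; apply: hE.
    - near: s; have cc : {for t, continuous c}.
        by apply: differentiable_continuous; apply/derivable1_diffP.
      by apply: cc; exact: open_nbhs_nbhs.
    - have Bs : ball x0 r (s *: v + x0).
        near: s; have cl : {for t, continuous (fun s : R => s *: v + x0)}.
          by apply: cvgD; [apply: cvgZr_tmp; exact: cvg_id|exact: cvg_cst].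
        by apply: cl; apply: open_nbhs_nbhs; split; [exact: ball_open|exact: inB].
      have [ Os OUs] := rB _ Bs; rewrite UE; split=> //.
      by have [] := FG _ Os; rewrite U1E => -[].
  have D0 : 'D_1 (fun s => h (c s)) t = 0.
    by rewrite d2 Dct scale1r -Hh df.
  split; first exact: near_eq_derivable E d1.
  by rewrite -(near_eq_derive _ E).
have H1 (s : R) : s \in `]0, 1[%R -> is_derive s 1 (fun s => f (c s)) 0.
  by rewrite in_itv /= => /andP[s0 s1]; apply: dc; rewrite ger0_norm ltW.
have H2 : {within `[0, 1], continuous (fun s => f (c s))}.
  apply: derivable_within_continuous => s; rewrite in_itv /= => /andP[s0 s1].
  by have [] : is_derive s 1 (fun s => f (c s)) 0 by apply: dc; rewrite ger0_norm.
have [z _] := @MVT_segment R (fun s => f (c s)) (fun=> 0) 0 1 ler01 H1 H2.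
rewrite mul0r => /eqP; rewrite subr_eq0 => /eqP.
by rewrite /c scale1r scale0r add0r subrK FGq Fx0.
Unshelve. all: by end_near. Qed.

(** The level set of [f] through [p0] is relatively open and relatively closed in [U]. *)
Lemma locally_constant V (U : set V) (f : V -> R) : connected U ->
  (forall p, U p -> \forall q \near p, U q -> f q = f p) ->
  forall p q, U p -> U q -> f q = f p.
Proof.
move=> cU loc p0 q0 Up0 Uq0.
pose B := [set q | U q /\ f q = f p0].
suff E : B = U by (have [] : B q0 by rewrite E).
apply: cU.
- by exists p0.
- exists (interior [set r | U r -> f r = f p0]); first exact: open_interior.
  apply/seteqP; split=> [q [Uq Eq]|q [Uq /nbhs_singleton H]]; split=> //; last exact: H.
  by rewrite /interior -Eq; exact: loc.
- exists (~` interior [set r | U r -> f r <> f p0]).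
    by apply: open_closedC; exact: open_interior.
  apply/seteqP; split=> [q [Uq Eq]|q [Uq H]]; split=> //.
    by move=> /nbhs_singleton /(_ Uq).
  apply: contrapT => ne; apply: H; have := loc q Uq; apply: filterS => r /= Er Ur.
  by rewrite Er.
Qed.

End Constancy.

Lemma linear_at0 {R : pzRingType} {V W : lmodType R} (f : V -> W) : linear f -> f 0 = 0.
Proof.
move=> fl; have := fl 1 0 0; rewrite !scale1r addr0 => /eqP.
by rewrite -subr_eq0 opprD addNKr oppr_eq0 => /eqP.
Qed.

Section Bilinear.
Context {R : realType}.
Variables (V W1 W2 W3 : normedModType R) (B : W1 -> W2 -> W3).
Hypotheses (Bl : forall w, linear (B^~ w)) (Br : forall u, linear (B u)).
Hypotheses (f1 : fin_dim W1) (f2 : fin_dim W2) (f3 : fin_dim W3).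

Let B_suml (I : Type) (r : seq I) (a : I -> R) (u : I -> W1) w :
  B (\sum_(i <- r) a i *: u i) w = \sum_(i <- r) a i *: B (u i) w.
Proof.
elim: r => [|i r IH]; last by rewrite !big_cons Bl IH.
by rewrite !big_nil (linear_at0 (Bl w)).
Qed.

Let B_sumr (I : Type) (r : seq I) (a : I -> R) (w : I -> W2) u :
  B u (\sum_(i <- r) a i *: w i) = \sum_(i <- r) a i *: B u (w i).
Proof.
elim: r => [|i r IH]; last by rewrite !big_cons Br IH.
by rewrite !big_nil (linear_at0 (Br u)).
Qed.

Lemma smooth_on_bilin (N : set V) (x : V -> W1) (y : V -> W2) :
  smooth_on N x -> smooth_on N y -> smooth_on N (fun p => B (x p) (y p)).
Proof.
move=> sx sy; have [I1 [b1 [co1 [c1 cb1]]]] := f1; have [I2 [b2 [co2 [c2 cb2]]]] := f2.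
apply: (@smooth_on_eq _ _ _ _ (fun p => \sum_i \sum_j (co1 i (x p) * co2 j (y p)) *: B (b1 i) (b2 j))).
  move=> p _; rewrite [x p in RHS]cb1 B_suml; apply: eq_bigr => i _.
  rewrite [y p in RHS]cb2 B_sumr scaler_sumr; apply: eq_bigr => j _.
  by rewrite scalerA.
apply: smooth_on_sum => i; apply: smooth_on_sum => j; apply: smooth_on_scale.
by apply: smooth_onM; apply: smooth_on_linear.
Qed.

(** A single Leibniz rule for all the products met below: matrix products, scaling, [bdt], [frmul],
    [cb], [gf] and [gam]. *)
Lemma dif_bilin (fV : fin_dim V) (N : set V) (x : V -> W1) (y : V -> W2) p v :
  smooth_on N x -> smooth_on N y -> N p -> tangent N p v ->
  dif N (fun p => B (x p) (y p)) p v = B (dif N x p v) (y p) + B (x p) (dif N y p v).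
Proof.
move=> sx sy Np tv; have [I1 [b1 [co1 [c1 cb1]]]] := f1; have [I2 [b2 [co2 [c2 cb2]]]] := f2.
have sxi i : smooth_on N (fun q => co1 i (x q)) by apply: smooth_on_linear.
have syi i : smooth_on N (fun q => co2 i (y q)) by apply: smooth_on_linear.
have expand u w : B u w = \sum_i \sum_j (co1 i u * co2 j w) *: B (b1 i) (b2 j).
  rewrite [u in LHS]cb1 B_suml; apply: eq_bigr => i _.
  rewrite [w in LHS]cb2 B_sumr scaler_sumr; apply: eq_bigr => j _.
  by rewrite scalerA.
rewrite (@dif_eq _ _ fV N p Np v tv _ _
   (fun p => \sum_i \sum_j (co1 i (x p) * co2 j (y p)) *: B (b1 i) (b2 j))) //; last first.
  exact: smooth_on_bilin.
have sij i j : smooth_on N (fun q => (co1 i (x q) * co2 j (y q)) *: B (b1 i) (b2 j)).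
  by apply: smooth_on_scale; apply: smooth_onM.
rewrite (dif_sum fV Np tv _ f3); last by move=> i; apply: smooth_on_sum.
rewrite !expand -big_split /=; apply: eq_bigr => i _.
rewrite (dif_sum fV Np tv _ f3) // -big_split /=; apply: eq_bigr => j _.
rewrite (dif_scale fV Np tv _ f3); last exact: smooth_onM.
rewrite (difM fV Np tv) // -scalerDl.
rewrite (dif_linear fV Np tv f1 fin_dim_R (c1 i) sx).
by rewrite (dif_linear fV Np tv f2 fin_dim_R (c2 j) sy).
Qed.

End Bilinear.

(** * The invariant frame *)

Section Indices.

Lemma sum2 (W : nmodType) (F : 'I_2 -> W) : \sum_i F i = F (ix 1) + F (ix 2).
Proof.
rewrite !big_ord_recl big_ord0 addr0; congr (F _ + F _); apply: val_inj => /=;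
  by rewrite /ix inordK.
Qed.

Lemma sum3 (W : nmodType) (F : 'I_3 -> W) :
  \sum_i F i = F (ix 1) + F (ix 2) + F (ix 3).
Proof.
rewrite !big_ord_recl big_ord0 addr0 addrA.
by congr (F _ + F _ + F _); apply: val_inj => /=; rewrite /ix inordK.
Qed.

Lemma sum5 (W : nmodType) (F : 'I_5 -> W) :
  \sum_i F i = F (ix 1) + F (ix 2) + F (ix 3) + F (ix 4) + F (ix 5).
Proof.
rewrite !big_ord_recl big_ord0 addr0 !addrA.
by congr (F _ + F _ + F _ + F _ + F _); apply: val_inj => /=; rewrite /ix inordK.
Qed.

Lemma ord2P (P : 'I_2 -> Prop) : P (ix 1) -> P (ix 2) -> forall i, P i.
Proof.
move=> P1 P2 [[|[|//]] H]; [move: P1|move: P2]; congr P; apply: val_inj;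
  by rewrite /= /ix inordK.
Qed.

Lemma ord3P (P : 'I_3 -> Prop) : P (ix 1) -> P (ix 2) -> P (ix 3) -> forall i, P i.
Proof.
move=> P1 P2 P3 [[|[|[|//]]] H]; [move: P1|move: P2|move: P3]; congr P; apply: val_inj;
  by rewrite /= /ix inordK.
Qed.

Lemma ord5P (P : 'I_5 -> Prop) : P (ix 1) -> P (ix 2) -> P (ix 3) -> P (ix 4) -> P (ix 5) ->
  forall i, P i.
Proof.
move=> P1 P2 P3 P4 P5 [[|[|[|[|[|//]]]]] H];
  [move: P1|move: P2|move: P3|move: P4|move: P5]; congr P; apply: val_inj;
  by rewrite /= /ix inordK.
Qed.

End Indices.

Notation cf x k := (fun_of_matrix x (0 : 'I_1) (@ix 4 k)).
Notation en p i k := (fun_of_matrix p (@ix 2 i) (@ix 1 k)).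

Section Frame.
Context {R : realType}.
Local Notation V := 'M[R]_(3, 2).

Definition row5 (a b c d e : R) : 'rV[R]_5 := \row_(i < 5) nth 0 [:: a; b; c; d; e] i.

Lemma row5E a b c d e : (cf (row5 a b c d e) 1 = a) * (cf (row5 a b c d e) 2 = b) *
  (cf (row5 a b c d e) 3 = c) * (cf (row5 a b c d e) 4 = d) * (cf (row5 a b c d e) 5 = e).
Proof. by rewrite !mxE /ix !inordK. Qed.

Lemma row5P (x y : 'rV[R]_5) : cf x 1 = cf y 1 -> cf x 2 = cf y 2 -> cf x 3 = cf y 3 ->
  cf x 4 = cf y 4 -> cf x 5 = cf y 5 -> x = y.
Proof. by move=> h1 h2 h3 h4 h5; apply/rowP; apply: ord5P. Qed.

Lemma row5_eta (x : 'rV[R]_5) : row5 (cf x 1) (cf x 2) (cf x 3) (cf x 4) (cf x 5) = x.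
Proof. by apply: row5P; rewrite row5E. Qed.

(** Turns a row into five scalar variables, so that identities between rows reach [ring] and [field]
    free of matrix entries. *)
Lemma row5_ind (P : 'rV[R]_5 -> Prop) : (forall a b c d e, P (row5 a b c d e)) -> forall x, P x.
Proof. by move=> H x; rewrite -(row5_eta x). Qed.

Lemma mx32P (p q : V) : en p 1 1 = en q 1 1 -> en p 1 2 = en q 1 2 ->
  en p 2 1 = en q 2 1 -> en p 2 2 = en q 2 2 -> en p 3 1 = en q 3 1 -> en p 3 2 = en q 3 2 ->
  p = q.
Proof. by move=> *; apply/matrixP; apply: ord3P; apply: ord2P. Qed.

(* The fields [p |-> fr x *m p] are the translation-invariant linear fields tangent to the
   level sets of the area: the rows of [fr x] sum to 0 and its trace is 0.  The basis is
   adapted: it satisfies Cartan's structure equations with constant coefficients. *)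
Definition fr (x : 'rV[R]_5) : 'M[R]_3 :=
  let x1 := cf x 1 in let x2 := cf x 2 in let x3 := cf x 3 in
  let x4 := cf x 4 in let x5 := cf x 5 in
  \matrix_(i, j) nth 0 (nth [::]
   [:: [:: 3 * x1 - 3 * x2;
           - (21 / 10 * x1) + 9 / 10 * x2 + x3 + x4 - x5;
           - (9 / 10 * x1) + 21 / 10 * x2 - x3 - x4 + x5];
       [:: 21 / 10 * x1 - 6 / 5 * x2 - x3 + x4;
           - (3 * x1);
           9 / 10 * x1 + 6 / 5 * x2 + x3 - x4];
       [:: 6 / 5 * x1 - 21 / 10 * x2 + x3 + x5;
           - (6 / 5 * x1) - 9 / 10 * x2 - x3 - x5;
           3 * x2]] i) j.

Lemma fr_linear : linear fr.
Proof.
by move=> a x y; apply/matrixP; apply: ord3P; apply: ord3P; rewrite !mxE /ix !inordK //=; ring.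
Qed.

HB.instance Definition _ := GRing.isLinear.Build R 'rV[R]_5 'M[R]_3 _ fr fr_linear.

(** The determinant of the 3x3 matrix with rows [(x_i, y_i, 1)], that is, [-2] times the signed
    area. *)
Definition dt (p : V) : R :=
  en p 1 1 * (en p 2 2 - en p 3 2) + en p 2 1 * (en p 3 2 - en p 1 2)
  + en p 3 1 * (en p 1 2 - en p 2 2).

(** The differential of [dt] at [p] in the direction [v]. *)
Definition ddt (p v : V) : R :=
  en v 1 1 * (en p 2 2 - en p 3 2) + en v 2 1 * (en p 3 2 - en p 1 2)
  + en v 3 1 * (en p 1 2 - en p 2 2)
  + en p 1 1 * (en v 2 2 - en v 3 2) + en p 2 1 * (en v 3 2 - en v 1 2)
  + en p 3 1 * (en v 1 2 - en v 2 2).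

Lemma signed_areaE (p : V) : signed_area p = - dt p / 2.
Proof.
rewrite /signed_area sum3 /xc /yc.
have -> : (@ix 2 1 + 1 = ix 2) by apply: val_inj; rewrite /= /ix !inordK.
have -> : (@ix 2 2 + 1 = ix 3) by apply: val_inj; rewrite /= /ix !inordK.
have -> : (@ix 2 3 + 1 = ix 1) by apply: val_inj; rewrite /= /ix !inordK.
have -> : (0 : 'I_2) = ix 1 by apply: val_inj; rewrite /= /ix inordK.
have -> : (1 : 'I_2) = ix 2 by apply: val_inj; rewrite /= /ix inordK.
by rewrite /dt; field.
Qed.

(* Coordinates in the frame [fr] of a vector [v] tangent at [p]: if [v = K *m p] and the rows of [K]
   sum to 0 then [K = v *m Q], where the rows of [Q] are [q] and [r]. *)
Definition co (p v : V) : 'rV[R]_5 :=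
  let q1 := (en p 2 2 - en p 3 2) / dt p in let q2 := (en p 3 2 - en p 1 2) / dt p in
  let q3 := (en p 1 2 - en p 2 2) / dt p in
  let r1 := (en p 3 1 - en p 2 1) / dt p in let r2 := (en p 1 1 - en p 3 1) / dt p in
  let r3 := (en p 2 1 - en p 1 1) / dt p in
  let x1 := - (en v 2 1 * q2 + en v 2 2 * r2) / 3 in
  let x2 := (en v 3 1 * q3 + en v 3 2 * r3) / 3 in
  let a := en v 1 1 * q2 + en v 1 2 * r2 + 21 / 10 * x1 - 9 / 10 * x2 in
  let b := en v 2 1 * q1 + en v 2 2 * r1 - 21 / 10 * x1 + 6 / 5 * x2 in
  let c := en v 3 1 * q1 + en v 3 2 * r1 - 6 / 5 * x1 + 21 / 10 * x2 in
  let x3 := (a + c - b) / 3 in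
  row5 x1 x2 x3 (b + x3) (c - x3).

Lemma frE x (p : V) i k : (fr x *m p) i k = fr x i (ix 1) * p (ix 1) k
  + fr x i (ix 2) * p (ix 2) k + fr x i (ix 3) * p (ix 3) k.
Proof. by rewrite mxE sum3. Qed.

Lemma fr_entries x :
  (fr x (ix 1) (ix 1) = 3 * cf x 1 - 3 * cf x 2) *
  (fr x (ix 1) (ix 2) = - (21 / 10 * cf x 1) + 9 / 10 * cf x 2 + cf x 3 + cf x 4 - cf x 5) *
  (fr x (ix 1) (ix 3) = - (9 / 10 * cf x 1) + 21 / 10 * cf x 2 - cf x 3 - cf x 4 + cf x 5) *
  (fr x (ix 2) (ix 1) = 21 / 10 * cf x 1 - 6 / 5 * cf x 2 - cf x 3 + cf x 4) *
  (fr x (ix 2) (ix 2) = - (3 * cf x 1)) *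
  (fr x (ix 2) (ix 3) = 9 / 10 * cf x 1 + 6 / 5 * cf x 2 + cf x 3 - cf x 4) *
  (fr x (ix 3) (ix 1) = 6 / 5 * cf x 1 - 21 / 10 * cf x 2 + cf x 3 + cf x 5) *
  (fr x (ix 3) (ix 2) = - (6 / 5 * cf x 1) - 9 / 10 * cf x 2 - cf x 3 - cf x 5) *
  (fr x (ix 3) (ix 3) = 3 * cf x 2).
Proof. by rewrite !mxE /ix !inordK. Qed.

Lemma co_fr x (p : V) : dt p != 0 -> co p (fr x *m p) = x.
Proof.
move=> p0; rewrite /co !frE !fr_entries.
by rewrite -[RHS]row5_eta; congr row5; rewrite /dt in p0 *; field.
Qed.

Lemma fr_co (p v : V) : dt p != 0 -> ddt p v = 0 -> fr (co p v) *m p = v.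
Proof.
move=> p0 v0.
(* The second and third rows are identities of rational functions; the first one only holds modulo
   [ddt p v], so a suitable multiple of it is added before [field]. *)
have E t : t = 0 -> en v 1 1 + t = en v 1 1 by move=> ->; rewrite addr0.
have E' t : t = 0 -> en v 1 2 + t = en v 1 2 by move=> ->; rewrite addr0.
rewrite /co; cbv zeta.
move E1: (X in row5 X _ _ _ _) => x1; move E2: (X in row5 _ X _ _ _) => x2.
move E3: (X in row5 _ _ X _ _) => x3; move E4: (X in row5 _ _ _ X _) => x4.
move E5: (X in row5 _ _ _ _ X) => x5.
apply: mx32P; rewrite frE !fr_entries !row5E -?E5 -?E4 -?E3 -?E2 -?E1.
- rewrite -[RHS](E (- (ddt p v / dt p * (en p 1 1 - en p 3 1)))); last by rewrite v0 !mul0r oppr0.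
  by rewrite /ddt; rewrite /dt in p0 *; field.
- rewrite -[RHS](E' (- (ddt p v / dt p * (en p 1 2 - en p 3 2)))); last by rewrite v0 !mul0r oppr0.
  by rewrite /ddt; rewrite /dt in p0 *; field.
- by rewrite /dt in p0 *; field.
- by rewrite /dt in p0 *; field.
- by rewrite /dt in p0 *; field.
- by rewrite /dt in p0 *; field.
Qed.

Lemma ddt_fr x (p : V) : ddt p (fr x *m p) = 0.
Proof. by rewrite /ddt !frE !fr_entries; field. Qed.

End Frame.

(** * Tangent spaces of the level sets of the area *)

Section Tangent.
Context {R : realType}.
Local Notation V := 'M[R]_(3, 2).
Local Notation fV := (@fin_dim_mx R 3 2).

(** A bilinear form with [bdt p p = dt p], so that the bilinear Leibniz rule differentiates [dt]. *)
Definition bdt (p q : V) : R :=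
  en p 1 1 * (en q 2 2 - en q 3 2) + en p 2 1 * (en q 3 2 - en q 1 2)
  + en p 3 1 * (en q 1 2 - en q 2 2).

Lemma bdt_linearl q : linear (bdt^~ q : V -> R).
Proof. by move=> a x y; rewrite -[RHS]/(a * _ + _) /bdt !mxE; ring. Qed.

Lemma bdt_linearr p : linear (bdt p : V -> R).
Proof. by move=> a x y; rewrite -[RHS]/(a * _ + _) /bdt !mxE; ring. Qed.

Lemma ants_dt (A : R) p : ants_manifold A p -> dt p = - (2 * A).
Proof. by rewrite /ants_manifold /= signed_areaE => <-; field. Qed.

Lemma ants_dt_neq0 (A : R) p : A != 0 -> ants_manifold A p -> dt p != 0.
Proof. by move=> A0 /ants_dt ->; rewrite oppr_eq0 mulf_neq0 ?pnatr_eq0. Qed.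

Lemma tangent_ddt (A : R) p v : ants_manifold A p -> tangent (ants_manifold A) p v ->
  ddt p v = 0.
Proof.
move=> Mp tv; have si := @smooth_on_id _ _ (ants_manifold A).
have := dif_bilin bdt_linearl bdt_linearr fV fV fin_dim_R fV si si Mp tv.
have -> : dif (ants_manifold A) (fun q : V => bdt q q) p v = 0.
  rewrite (@dif_eq _ _ fV _ _ Mp _ tv _ _ (fun=> - (2 * A))).
  - exact: (dif_cst fV Mp tv _ fin_dim_R).
  - exact: fin_dim_R.
  - exact: (smooth_on_bilin bdt_linearl bdt_linearr fV fV).
  - by move=> x /ants_dt <-.
rewrite !(dif_id fV Mp tv) => ->; rewrite /ddt /bdt; ring.
Qed.

Lemma derive_quadratic (c w : R -> V) (p v : V) : {for 0, continuous w} ->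
  (forall t, c t = p + t *: v + (t * t) *: w t) -> derive1 c 0 = v.
Proof.
move=> cw cE; rewrite derive1E /derive; apply: cvg_lim => //.
have : (fun h : R => v + h *: w h) @ 0^' --> v + 0 *: w 0.
  apply: cvgD; first exact: cvg_cst.
  apply: cvgZ; first exact: cvg_within.
  by apply: cvg_trans cw; apply: cvg_app; exact: cvg_within.
rewrite scale0r addr0; apply: cvg_trans; apply: near_eq_cvg.
near=> h; have h0 : h != 0 by near: h; exact: nbhs_dnbhs_neq.
rewrite /= addr0 [h%:A]mulr1 (_ : c h - c 0 = h *: v + (h * h) *: w h); last first.
  by rewrite !cE scale0r mul0r scale0r !addr0 [LHS]addrC !addrA addNr add0r.
by rewrite scalerDr !scalerA !mulrA mulVf // mul1r scale1r.
Unshelve. all: by end_near. Qed.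

(** The traceless linear part is a sum of three square-zero matrices: [al] times the one with both
    rows [(1, -1)], and [be], [ga] times the two off-diagonal units. As [1 + t N] has determinant 1
    when [N^2 = 0], a polynomial curve can replace the exponential flow. *)
Definition affine (al be ga b1 b2 : R) (p : V) : V := \matrix_(i, k)
  (if k == ix 1 then al * p i (ix 1) + (ga + al) * p i (ix 2) + b1
   else (be - al) * p i (ix 1) - al * p i (ix 2) + b2).

Lemma affineE al be ga b1 b2 p i :
  (affine al be ga b1 b2 p i (ix 1) = al * p i (ix 1) + (ga + al) * p i (ix 2) + b1) *
  (affine al be ga b1 b2 p i (ix 2) = (be - al) * p i (ix 1) - al * p i (ix 2) + b2).
Proof. by rewrite !mxE eqxx; split=> //; case: eqP => // /(congr1 val); rewrite /= /ix !inordK. Qed.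

Lemma affine_tangent (A : R) al be ga b1 b2 p : ants_manifold A p ->
  tangent (ants_manifold A) p (affine al be ga b1 b2 p).
Proof.
move=> Mp.
(* [w2] and [w3] are the coefficients of [t^2] and [t^3] in
   [p (1 + t N_be) (1 + t N_ga) (1 + t N_al)], a product that preserves the area. *)
pose w2 : V := \matrix_(i, k)
  (if k == ix 1 then ga * be * p i (ix 1) + al * (be * p i (ix 1) + ga * p i (ix 2))
   else - (al * (be * p i (ix 1) + ga * p i (ix 2)))).
pose w3 : V := \matrix_(i, k)
  (if k == ix 1 then al * ga * be * p i (ix 1) else - (al * ga * be * p i (ix 1))).
have ne : (@ix 1 2 == ix 1) = false.
  by apply/eqP => /(congr1 val); rewrite /= /ix !inordK.
pose w (t : R) := w2 + t *: w3.
pose c (t : R) : V := p + t *: affine al be ga b1 b2 p + (t * t) *: w t.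
exists setT, c; split=> //.
- exact: openT.
- move=> k; have oT : open [set: R] by exact: openT.
  have Cid : Ck k setT (fun t : R => t) by exact: Ck_id.
  have Ct u (f : R -> R) : Ck k setT f -> Ck k setT (fun t : R => f t *: (u : V)).
    by move=> Cf; apply: (Ck_linear oT (@scaler_to_continuous _ _ u)).
  have -> : c = (fun t => p + t *: affine al be ga b1 b2 p + (t * t) *: w2
                          + (t * t * t) *: w3).
    by apply/funext => t; rewrite /c /w scalerDr scalerA addrA.
  by do ![apply: Ck_add => //]; [exact: Ck_cst|exact: Ct|apply: Ct|apply: Ct];
    do ?apply: Ck_mul.
- move=> t _; move: Mp; rewrite /ants_manifold /= !signed_areaE => <-.
  congr (- _ / 2).
  have En i k : c t i k = p i k + t * affine al be ga b1 b2 p i k + t * t * (w2 i k + t * w3 i k).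
    by rewrite !mxE.
  have w21 i : w2 i (ix 1) = ga * be * p i (ix 1) + al * (be * p i (ix 1) + ga * p i (ix 2)).
    by rewrite mxE eqxx.
  have w22 i : w2 i (ix 2) = - (al * (be * p i (ix 1) + ga * p i (ix 2))).
    by rewrite mxE ne.
  have w31 i : w3 i (ix 1) = al * ga * be * p i (ix 1) by rewrite mxE eqxx.
  have w32 i : w3 i (ix 2) = - (al * ga * be * p i (ix 1)) by rewrite mxE ne.
  by rewrite /dt !En !affineE !w21 !w22 !w31 !w32; ring.
- split; first by rewrite /c scale0r mul0r scale0r !addr0.
  apply: (@derive_quadratic _ w) => //.
  by apply: cvgD; [exact: cvg_cst|apply: cvgZr_tmp; exact: cvg_id].
Qed.

(** The linear part is [Q v], where [Q p = 1] and the rows [q], [r] of [Q] sum to 0; its trace is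
    [ddt p v / dt p]. The translation is read off the first point. *)
Lemma ddt_affine (A : R) p v : A != 0 -> ants_manifold A p -> ddt p v = 0 ->
  exists al be ga b1 b2, v = affine al be ga b1 b2 p.
Proof.
move=> A0 Mp v0; have p0 := ants_dt_neq0 A0 Mp.
pose q1 := (en p 2 2 - en p 3 2) / dt p; pose q2 := (en p 3 2 - en p 1 2) / dt p.
pose q3 := (en p 1 2 - en p 2 2) / dt p.
pose r1 := (en p 3 1 - en p 2 1) / dt p; pose r2 := (en p 1 1 - en p 3 1) / dt p.
pose r3 := (en p 2 1 - en p 1 1) / dt p.
pose al := q1 * en v 1 1 + q2 * en v 2 1 + q3 * en v 3 1.
pose a12 := q1 * en v 1 2 + q2 * en v 2 2 + q3 * en v 3 2.
pose a21 := r1 * en v 1 1 + r2 * en v 2 1 + r3 * en v 3 1.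
have tr0 : r1 * en v 1 2 + r2 * en v 2 2 + r3 * en v 3 2 = - al.
  apply/eqP; rewrite -subr_eq0 opprK; apply/eqP.
  transitivity (ddt p v / dt p); last by rewrite v0 mul0r.
  by rewrite /r1 /r2 /r3 /al /q1 /q2 /q3 /ddt; field.
pose b1 := en v 1 1 - (al * en p 1 1 + a21 * en p 1 2).
pose b2 := en v 1 2 - (a12 * en p 1 1 - al * en p 1 2).
exists al, (a12 + al), (a21 - al), b1, b2.
(* The goal only shows [- al]; in the second column it must be expanded as the last entry of [Q v]
   for [field] to succeed. *)
have a22 : - al * dt p = (en p 3 1 - en p 2 1) * en v 1 2 + (en p 1 1 - en p 3 1) * en v 2 2
   + (en p 2 1 - en p 1 1) * en v 3 2.
  by rewrite -tr0 /r1 /r2 /r3; field.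
apply: mx32P; rewrite !affineE /b1 /b2 ?subrK; first by ring.
- by ring.
- by rewrite /a21 /al /q1 /q2 /q3 /r1 /r2 /r3; rewrite /dt in p0 *; field.
- transitivity (a12 * en p 2 1 + - al * dt p * en p 2 2 / dt p + (en v 1 2 - (a12 * en p 1 1 + - al * dt p * en p 1 2 / dt p))).
    by rewrite a22 /a12 /q1 /q2 /q3; rewrite /dt in p0 *; field.
  by field.
- by rewrite /a21 /al /q1 /q2 /q3 /r1 /r2 /r3; rewrite /dt in p0 *; field.
- transitivity (a12 * en p 3 1 + - al * dt p * en p 3 2 / dt p + (en v 1 2 - (a12 * en p 1 1 + - al * dt p * en p 1 2 / dt p))).
    by rewrite a22 /a12 /q1 /q2 /q3; rewrite /dt in p0 *; field.
  by field.
Qed.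

End Tangent.

Section Bracket.
Context {R : realType}.
Local Notation V := 'M[R]_(3, 2).
Implicit Types x y z : 'rV[R]_5.

(* Structure constants of the frame [fr]. *)
Definition cb x y : 'rV[R]_5 :=
  let w i j := cf x i * cf y j - cf x j * cf y i in
  row5
   (1 / 10 * w 1 3 + w 1 4 - w 1 5 - 1 / 5 * w 2 3 - w 2 4 - w 3 4)
   (1 / 5 * w 1 3 - w 1 5 - 1 / 10 * w 2 3 - w 2 4 + w 2 5 - w 3 5)
   (- (243 / 100 * w 1 2) - 9 / 5 * w 1 4 + 9 / 10 * w 1 5 + 9 / 10 * w 2 4 - 9 / 5 * w 2 5
    - w 4 5)
   (- (567 / 100 * w 1 3) + 9 / 10 * w 1 4 + 9 / 10 * w 1 5 + 9 / 10 * w 2 4 - 9 / 5 * w 2 5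
    + 11 / 10 * w 3 4 - 11 / 5 * w 3 5)
   (9 / 5 * w 1 4 - 9 / 10 * w 1 5 - 567 / 100 * w 2 3 - 9 / 10 * w 2 4 - 9 / 10 * w 2 5
    + 11 / 5 * w 3 4 - 11 / 10 * w 3 5).

Lemma cf_lin (a : R) x y k : cf (a *: x + y) k = a * cf x k + cf y k.
Proof. by rewrite !mxE. Qed.

Lemma cb_row5 (x1 x2 x3 x4 x5 y1 y2 y3 y4 y5 : R) :
  cb (row5 x1 x2 x3 x4 x5) (row5 y1 y2 y3 y4 y5) = row5
   (1 / 10 * (x1 * y3 - x3 * y1) + (x1 * y4 - x4 * y1) - (x1 * y5 - x5 * y1)
    - 1 / 5 * (x2 * y3 - x3 * y2) - (x2 * y4 - x4 * y2) - (x3 * y4 - x4 * y3))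
   (1 / 5 * (x1 * y3 - x3 * y1) - (x1 * y5 - x5 * y1) - 1 / 10 * (x2 * y3 - x3 * y2)
    - (x2 * y4 - x4 * y2) + (x2 * y5 - x5 * y2) - (x3 * y5 - x5 * y3))
   (- (243 / 100 * (x1 * y2 - x2 * y1)) - 9 / 5 * (x1 * y4 - x4 * y1)
    + 9 / 10 * (x1 * y5 - x5 * y1) + 9 / 10 * (x2 * y4 - x4 * y2)
    - 9 / 5 * (x2 * y5 - x5 * y2) - (x4 * y5 - x5 * y4))
   (- (567 / 100 * (x1 * y3 - x3 * y1)) + 9 / 10 * (x1 * y4 - x4 * y1)
    + 9 / 10 * (x1 * y5 - x5 * y1) + 9 / 10 * (x2 * y4 - x4 * y2)
    - 9 / 5 * (x2 * y5 - x5 * y2) + 11 / 10 * (x3 * y4 - x4 * y3)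
    - 11 / 5 * (x3 * y5 - x5 * y3))
   (9 / 5 * (x1 * y4 - x4 * y1) - 9 / 10 * (x1 * y5 - x5 * y1) - 567 / 100 * (x2 * y3 - x3 * y2)
    - 9 / 10 * (x2 * y4 - x4 * y2) - 9 / 10 * (x2 * y5 - x5 * y2)
    + 11 / 5 * (x3 * y4 - x4 * y3) - 11 / 10 * (x3 * y5 - x5 * y3)).
Proof.
rewrite /cb; set a := row5 x1 _ _ _ _; set b := row5 y1 _ _ _ _.
have [a1 a2 a3 a4 a5] : [/\ cf a 1 = x1, cf a 2 = x2, cf a 3 = x3, cf a 4 = x4 & cf a 5 = x5].
  by rewrite !row5E.
have [b1 b2 b3 b4 b5] : [/\ cf b 1 = y1, cf b 2 = y2, cf b 3 = y3, cf b 4 = y4 & cf b 5 = y5].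
  by rewrite !row5E.
by rewrite a1 a2 a3 a4 a5 b1 b2 b3 b4 b5.
Qed.

Lemma row5_lin (a x1 x2 x3 x4 x5 y1 y2 y3 y4 y5 : R) :
  a *: row5 x1 x2 x3 x4 x5 + row5 y1 y2 y3 y4 y5 =
  row5 (a * x1 + y1) (a * x2 + y2) (a * x3 + y3) (a * x4 + y4) (a * x5 + y5).
Proof. by apply: row5P; rewrite cf_lin !row5E. Qed.

Lemma cb_linearl y : linear (cb^~ y).
Proof.
move=> a; elim/(@row5_ind R) => x1 x2 x3 x4 x5; elim/(@row5_ind R) => z1 z2 z3 z4 z5.
elim/(@row5_ind R): y => y1 y2 y3 y4 y5.
by rewrite row5_lin !cb_row5 row5_lin; congr row5; ring.
Qed.

Lemma cb_linearr x : linear (cb x).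
Proof.
move=> a; elim/(@row5_ind R) => y1 y2 y3 y4 y5; elim/(@row5_ind R) => z1 z2 z3 z4 z5.
elim/(@row5_ind R): x => x1 x2 x3 x4 x5.
by rewrite row5_lin !cb_row5 row5_lin; congr row5; ring.
Qed.

Lemma cb_anti x y : cb x y = - cb y x.
Proof.
elim/(@row5_ind R): x => x1 x2 x3 x4 x5; elim/(@row5_ind R): y => y1 y2 y3 y4 y5.
rewrite -scaleN1r -[RHS]addr0 -(row5_eta 0) !cb_row5 row5_lin.
by congr row5; rewrite mxE; ring.
Qed.

Lemma frD x y : fr (x + y) = fr x + fr y.
Proof. exact: linearD. Qed.

Lemma frB x y : fr (x - y) = fr x - fr y.
Proof. exact: linearB. Qed.

Lemma mul3E (K L : 'M[R]_3) i j : (K *m L) i j = K i (ix 1) * L (ix 1) j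
  + K i (ix 2) * L (ix 2) j + K i (ix 3) * L (ix 3) j.
Proof. by rewrite mxE sum3. Qed.

Lemma fr_cb x y : fr y *m fr x - fr x *m fr y = fr (cb x y).
Proof.
elim/(@row5_ind R): x => x1 x2 x3 x4 x5; elim/(@row5_ind R): y => y1 y2 y3 y4 y5.
rewrite cb_row5.
move E1: (X in _ = fr (row5 X _ _ _ _)) => c1; move E2: (X in _ = fr (row5 _ X _ _ _)) => c2.
move E3: (X in _ = fr (row5 _ _ X _ _)) => c3; move E4: (X in _ = fr (row5 _ _ _ X _)) => c4.
move E5: (X in _ = fr (row5 _ _ _ _ X)) => c5.
by apply/matrixP; apply: ord3P; apply: ord3P;
  rewrite [LHS]mxE [X in _ + X]mxE !mul3E !fr_entries !row5E -?E1 -?E2 -?E3 -?E4 -?E5;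
  field.
Qed.

Lemma fr_inj x : fr x = 0 -> x = 0.
Proof.
move=> E; have e i j : fr x i j = 0 by rewrite E mxE.
have := e (ix 2) (ix 2); have := e (ix 3) (ix 3); have := e (ix 1) (ix 2).
have := e (ix 2) (ix 1); have := e (ix 3) (ix 1); rewrite !fr_entries => *.
by apply: row5P; rewrite [RHS]mxE; lra.
Qed.

End Bracket.

(** * Vector fields in frame coordinates *)

Section Fields.
Context {R : realType}.
Local Notation V := 'M[R]_(3, 2).
Local Notation fV := (@fin_dim_mx R 3 2).
Local Notation f5 := (@fin_dim_mx R 1 5).
Variables (A : R) (A0 : A != 0) (U : set V) (hU : open_in (ants_manifold A) U).
Implicit Types (x y z : V -> 'rV[R]_5) (p v : V).

Definition fld x : V -> V := fun p => fr (x p) *m p.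

Lemma openin_ants p : U p -> ants_manifold A p.
Proof. by case: hU => O _ -> []. Qed.

Lemma openin_dt p : U p -> dt p != 0.
Proof. by move=> /openin_ants; exact: ants_dt_neq0. Qed.

Lemma tangentP p v : U p -> tangent U p v <-> ddt p v = 0.
Proof.
move=> Up; rewrite (tangent_open _ hU Up); have Mp := openin_ants Up; split.
  exact: tangent_ddt.
by move=> /(ddt_affine A0 Mp)[al [be [ga [b1 [b2 ->]]]]]; exact: affine_tangent.
Qed.

Lemma fr_tangent x p : U p -> tangent U p (fld x p).
Proof. by move=> Up; apply/tangentP => //; exact: ddt_fr. Qed.

Lemma fld_co p v : U p -> tangent U p v -> fr (co p v) *m p = v.
Proof. by move=> Up /(tangentP _ Up); apply: fr_co; exact: openin_dt. Qed.

Lemma co_fld x p : U p -> co p (fld x p) = x p.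
Proof. by move=> Up; rewrite /fld co_fr //; exact: openin_dt. Qed.

Definition frmul (x : 'rV[R]_5) (p : V) : V := fr x *m p.

Lemma frmul_linearl p : linear (frmul^~ p).
Proof. by move=> a x y; rewrite /frmul linearP mulmxDl scalemxAl. Qed.

Lemma frmul_linearr (x : 'rV[R]_5) : linear (frmul x).
Proof. by move=> a p q; rewrite /frmul mulmxDr scalemxAr. Qed.

Lemma fld_smooth x : smooth_on U x -> smooth_on U (fld x).
Proof.
move=> sx.
exact: (smooth_on_bilin frmul_linearl frmul_linearr f5 fV sx (@smooth_on_id _ _ U)).
Qed.

Lemma fld_vfield x : smooth_on U x -> vfield U (fld x).
Proof. by move=> sx; split=> [|p Up]; [exact: fld_smooth|exact: fr_tangent]. Qed.

Lemma dif_fld x p v : smooth_on U x -> U p -> tangent U p v ->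
  dif U (fld x) p v = fr (dif U x p v) *m p + fr (x p) *m v.
Proof.
move=> sx Up tv.
have := dif_bilin frmul_linearl frmul_linearr f5 fV fV fV sx (@smooth_on_id _ _ U) Up tv.
by rewrite (dif_id fV Up tv).
Qed.

Lemma smooth_row5 (a b c d e : V -> R) : smooth_on U a -> smooth_on U b -> smooth_on U c ->
  smooth_on U d -> smooth_on U e -> smooth_on U (fun p => row5 (a p) (b p) (c p) (d p) (e p)).
Proof.
move=> sa sb sc sd se; apply/smooth_on_mxP => i; rewrite ord1; apply: ord5P.
- by apply: smooth_on_eq sa => p _; rewrite row5E.
- by apply: smooth_on_eq sb => p _; rewrite row5E.
- by apply: smooth_on_eq sc => p _; rewrite row5E.
- by apply: smooth_on_eq sd => p _; rewrite row5E.
- by apply: smooth_on_eq se => p _; rewrite row5E.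
Qed.

Lemma smooth_dt : smooth_on U (@dt R).
Proof.
exact: (smooth_on_bilin bdt_linearl bdt_linearr fV fV
  (@smooth_on_id _ _ U) (@smooth_on_id _ _ U)).
Qed.

Lemma co_smooth (X : V -> V) : smooth_on U X -> smooth_on U (fun p => co p (X p)).
Proof.
move=> sX.
have sp i k : smooth_on U (fun p : V => p i k).
  by have /smooth_on_mxP := @smooth_on_id _ V U; apply.
have sv i k : smooth_on U (fun p : V => X p i k) by move/smooth_on_mxP: sX.
have sd : smooth_on U (fun p => (dt p)^-1).
  by apply: smooth_onV; [exact: openin_dt|exact: smooth_dt].
rewrite /co; apply: smooth_row5;
  do ![exact: sp|exact: sv|exact: sd|exact: smooth_on_cst|apply: smooth_onB|
       apply: smooth_onN|apply: smooth_onD|apply: smooth_onM].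
Qed.

(** Vector fields on [U] amount to smooth functions with values in ['rV_5], and are handled in this
    form from here on. *)
Lemma fld_of X : vfield U X -> smooth_on U (fun p => co p (X p)) /\
  forall p, U p -> X p = fld (fun p => co p (X p)) p.
Proof.
move=> [sX tX]; split=> [|p Up]; first exact: co_smooth.
by rewrite /fld fld_co //; exact: tX.
Qed.

(** The Lie bracket of [fld x] and [fld y] in frame coordinates: the coefficients are differentiated
    along the fields, and the frame contributes its structure constants. *)
Definition br x y : V -> 'rV[R]_5 := fun p =>
  dif U y p (fld x p) - dif U x p (fld y p) + cb (x p) (y p).

Lemma smooth_cb x y : smooth_on U x -> smooth_on U y -> smooth_on U (fun p => cb (x p) (y p)).
Proof. exact: (smooth_on_bilin cb_linearl cb_linearr f5 f5). Qed.

Lemma smooth_br x y : smooth_on U x -> smooth_on U y -> smooth_on U (br x y).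
Proof.
move=> sx sy; have vx := fld_vfield sx; have vy := fld_vfield sy.
have s1 := dif_smooth fV f5 sy vx; have s2 := dif_smooth fV f5 sx vy.
exact: (smooth_onD (smooth_onB s1 s2) (smooth_cb sx sy)).
Qed.

Lemma lie_fld x y p : smooth_on U x -> smooth_on U y -> U p ->
  lie U (fld x) (fld y) p = fld (br x y) p.
Proof.
move=> sx sy Up; have tx := fr_tangent x Up; have ty := fr_tangent y Up.
transitivity ((fr (dif U y p (fld x p)) *m p + fr (y p) *m fld x p)
  - (fr (dif U x p (fld y p)) *m p + fr (x p) *m fld y p)).
  by congr (_ - _); apply: dif_fld.
rewrite [RHS]/fld /br frD frB.
move: (dif U y p (fld x p)) (dif U x p (fld y p)) => a b; rewrite /fld.
rewrite -fr_cb !mulmxDl !mulNmx !mulmxA opprD !addrA.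
by rewrite -!addrA; congr (_ + _); rewrite addrCA.
Qed.

Lemma lie_eq (X X' Y Y' : V -> V) p : vfield U X -> vfield U Y ->
  (forall q, U q -> X q = X' q) -> (forall q, U q -> Y q = Y' q) -> U p ->
  lie U X Y p = lie U X' Y' p.
Proof.
move=> [sX tX] [sY tY] EX EY Up; rewrite /lie -(EX p Up) -(EY p Up).
have e1 := dif_eq fV Up (tX p Up) fV sY EY; have e2 := dif_eq fV Up (tY p Up) fV sX EX.
exact: (congr2 (fun a b => a - b) e1 e2).
Qed.

Lemma lie_vfield (X Y : V -> V) : vfield U X -> vfield U Y -> vfield U (lie U X Y).
Proof.
move=> vX vY; have [sx EX] := fld_of vX; have [sy EY] := fld_of vY.
have E p : U p -> fld (br (fun p => co p (X p)) (fun p => co p (Y p))) p = lie U X Y p.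
  by move=> Up; rewrite (lie_eq vX vY EX EY Up) lie_fld.
have [s t] := fld_vfield (smooth_br sx sy); split; first exact: smooth_on_eq E s.
by move=> p Up; rewrite -E //; exact: t.
Qed.

Lemma dif_comm_W (W : normedModType R) (f : V -> W) (X Y : V -> V) p : fin_dim W ->
  U p -> smooth_on U f -> vfield U X -> vfield U Y ->
  dif U (fun q => dif U f q (Y q)) p (X p) - dif U (fun q => dif U f q (X q)) p (Y p)
  = dif U f p (lie U X Y p).
Proof.
move=> fW Up sf vX vY; have [I [b [l [lc lb]]]] := fW.
have vL := lie_vfield vX vY.
have dl i Z q : vfield U Z -> U q ->
    dif U (fun q => l i (f q)) q (Z q) = l i (dif U f q (Z q)).
  by move=> vZ Uq; apply: (dif_linear fV Uq (vZ.2 _ Uq) fW fin_dim_R (lc i) sf).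
apply: (co_inj lb) => i; rewrite linearB -(dl i _ _ vL Up).
have sl : smooth_on U (fun q => l i (f q)) by apply: smooth_on_linear.
rewrite -(dif_comm fV Up sl vX vY).
have dd Z Z' : vfield U Z -> vfield U Z' ->
   l i (dif U (fun q => dif U f q (Z q)) p (Z' p)) =
   dif U (fun q => dif U (fun r => l i (f r)) q (Z q)) p (Z' p).
  move=> vZ vZ'.
  rewrite -(dif_linear fV Up (vZ'.2 _ Up) fW fin_dim_R (lc i) (dif_smooth fV fW sf vZ)).
  apply: (dif_eq fV Up (vZ'.2 _ Up) fin_dim_R).
    exact: (smooth_on_linear (lc i) (dif_smooth fV fW sf vZ)).
  by move=> q Uq; exact: esym (dl i Z q vZ Uq).
exact: (congr2 (fun a b => a - b) (dd _ _ vY vX) (dd _ _ vX vY)).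
Qed.

Lemma dif_comm_fld (W : normedModType R) (f : V -> W) x y p : fin_dim W ->
  U p -> smooth_on U f -> smooth_on U x -> smooth_on U y ->
  dif U (fun q => dif U f q (fld y q)) p (fld x p)
  - dif U (fun q => dif U f q (fld x q)) p (fld y p) = dif U f p (fld (br x y) p).
Proof.
move=> fW Up sf sx sy.
by rewrite (dif_comm_W fW Up sf (fld_vfield sx) (fld_vfield sy)) lie_fld.
Qed.

End Fields.

(** * Infinitesimal symmetries *)

Section Symmetries.
Context {R : realType}.
Local Notation V := 'M[R]_(3, 2).
Local Notation fV := (@fin_dim_mx R 3 2).
Local Notation f5 := (@fin_dim_mx R 1 5).
Variables (A : R) (A0 : A != 0) (U : set V) (hU : open_in (ants_manifold A) U).
Implicit Types (p v : V) (f g : V -> R).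

(** Inherited from the matrix commutator through the injective map [fr]. *)
Lemma cb_jacobi (x y z : 'rV[R]_5) : cb (cb x y) z - cb (cb x z) y = cb x (cb y z).
Proof.
apply/eqP; rewrite -subr_eq0; apply/eqP/fr_inj.
rewrite !frB -!fr_cb; move: (fr x) (fr y) (fr z) => a b c.
rewrite !mulmxBl !mulmxBr !mulmxA.
move: (c *m b *m a) (c *m a *m b) (b *m a *m c) (a *m b *m c) (b *m c *m a) (a *m c *m b).
by move=> *; apply/matrixP => i j; rewrite !mxE; ring.
Qed.

Definition ev (k : nat) : 'rV[R]_5 :=
  row5 (k == 1)%:R (k == 2)%:R (k == 3)%:R (k == 4)%:R (k == 5)%:R.

Lemma ev_expand (W : lmodType R) (L : 'rV[R]_5 -> W) u : linear L ->
  L u = cf u 1 *: L (ev 1) + cf u 2 *: L (ev 2) + cf u 3 *: L (ev 3)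
        + cf u 4 *: L (ev 4) + cf u 5 *: L (ev 5).
Proof.
move=> Ll; have L0 := linear_at0 Ll.
have E : u = cf u 1 *: ev 1 + (cf u 2 *: ev 2 + (cf u 3 *: ev 3 + (cf u 4 *: ev 4
     + (cf u 5 *: ev 5 + 0)))).
  by apply: row5P; rewrite !cf_lin !row5E [cf 0 _]mxE /=; ring.
by rewrite {1}E !Ll L0 addr0 !addrA.
Qed.

Lemma cfB (y z : 'rV[R]_5) k : cf (y - z) k = cf y k - cf z k.
Proof. by rewrite !mxE. Qed.

Lemma cf_comb (a1 a2 a3 a4 a5 : R) (y1 y2 y3 y4 y5 z1 z2 : 'rV[R]_5) k :
  cf (a1 *: y1 + a2 *: y2 + a3 *: y3 + a4 *: y4 + a5 *: y5 - z1 - z2) k =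
  a1 * cf y1 k + a2 * cf y2 k + a3 * cf y3 k + a4 * cf y4 k + a5 * cf y5 k - cf z1 k - cf z2 k.
Proof. by rewrite !mxE. Qed.

Definition De k f : V -> R := fun p => dif U f p (fld (fun=> ev k) p).

Lemma ev_vfield k : vfield U (fld (fun=> ev k)).
Proof. exact: (fld_vfield A0 hU (@smooth_on_cst _ _ _ U _)). Qed.

Lemma fr_tan (u : 'rV[R]_5) p : U p -> tangent U p (fr u *m p).
Proof. exact: (fr_tangent A0 hU (fun=> u)). Qed.

Lemma De_eq k f g p : U p -> smooth_on U f -> (forall q, U q -> f q = g q) ->
  De k f p = De k g p.
Proof. by move=> Up sf E; exact: (dif_eq fV Up (fr_tan _ Up) fin_dim_R sf E). Qed.

(** Five terms, padded with zero coefficients if need be, cover every linear relation of the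
    prolongation. *)
Lemma De_lin k f (a1 a2 a3 a4 a5 : R) (g1 g2 g3 g4 g5 : V -> R) p : U p ->
  smooth_on U g1 -> smooth_on U g2 -> smooth_on U g3 -> smooth_on U g4 -> smooth_on U g5 ->
  (forall q, U q -> f q = a1 * g1 q + a2 * g2 q + a3 * g3 q + a4 * g4 q + a5 * g5 q) ->
  De k f p = a1 * De k g1 p + a2 * De k g2 p + a3 * De k g3 p + a4 * De k g4 p + a5 * De k g5 p.
Proof.
move=> Up s1 s2 s3 s4 s5 E.
have sZ a g : smooth_on U g -> smooth_on U (fun q => a * g q).
  by move=> sg; apply: smooth_onM => //; exact: smooth_on_cst.
have dZ a g : smooth_on U g -> De k (fun q => a * g q) p = a * De k g p.
  by move=> sg; exact: (difZ fV Up (fr_tan _ Up)).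
have dD g h : smooth_on U g -> smooth_on U h ->
    De k (fun q => g q + h q) p = De k g p + De k h p.
  by move=> sg sh; exact: (difD fV Up (fr_tan _ Up) fin_dim_R sg sh).
have t12 := smooth_onD (sZ a1 _ s1) (sZ a2 _ s2).
have t123 := smooth_onD t12 (sZ a3 _ s3).
have t1234 := smooth_onD t123 (sZ a4 _ s4).
have t := smooth_onD t1234 (sZ a5 _ s5).
have -> : De k f p = De k (fun q => a1 * g1 q + a2 * g2 q + a3 * g3 q + a4 * g4 q + a5 * g5 q) p.
  by apply: esym; apply: De_eq => // q Uq; rewrite E.
rewrite (dD _ _ t1234 (sZ a5 _ s5)) (dD _ _ t123 (sZ a4 _ s4)) (dD _ _ t12 (sZ a3 _ s3)).
rewrite (dD _ _ (sZ a1 _ s1) (sZ a2 _ s2)).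
by rewrite (dZ a1 _ s1) (dZ a2 _ s2) (dZ a3 _ s3) (dZ a4 _ s4) (dZ a5 _ s5).
Qed.

Lemma De_zero k f p : U p -> (forall q, U q -> f q = 0) -> De k f p = 0.
Proof.
move=> Up E; rewrite (@De_eq k f (fun=> 0)) //.
  exact: (dif_cst fV Up (fr_tan _ Up) _ fin_dim_R).
by apply: (@smooth_on_eq _ _ _ _ (fun=> 0)) => [q Uq|]; [rewrite E|exact: smooth_on_cst].
Qed.

Lemma br_cst (u w : 'rV[R]_5) p : U p -> br U (fun=> u) (fun=> w) p = cb u w.
Proof.
move=> Up; rewrite /br.
rewrite (dif_cst fV Up (fr_tan _ Up) _ f5) (dif_cst fV Up (fr_tan _ Up) _ f5).
by rewrite subrr add0r.
Qed.

Lemma dif_fr_linear f p : U p -> smooth_on U f ->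
  linear (fun u : 'rV[R]_5 => dif U f p (fr u *m p) : R).
Proof.
move=> Up sf a u w; rewrite linearP mulmxDl -scalemxAl.
exact: (dif_linearr fV Up sf).
Qed.

Lemma De_comm i j f p : U p -> smooth_on U f ->
  De i (De j f) p - De j (De i f) p =
  cf (cb (ev i) (ev j)) 1 * De 1 f p + cf (cb (ev i) (ev j)) 2 * De 2 f p
  + cf (cb (ev i) (ev j)) 3 * De 3 f p + cf (cb (ev i) (ev j)) 4 * De 4 f p
  + cf (cb (ev i) (ev j)) 5 * De 5 f p.
Proof.
move=> Up sf.
have H := dif_comm_fld A0 hU fin_dim_R Up sf (@smooth_on_cst _ _ _ U (ev i))
  (@smooth_on_cst _ _ _ U (ev j)).
have B := congr1 (fun u => dif U f p (fr u *m p)) (br_cst (ev i) (ev j) Up).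
exact: (etrans H (etrans B (ev_expand (cb (ev i) (ev j)) (dif_fr_linear Up sf)))).
Qed.

Section Deviation.
Variables (x : V -> 'rV[R]_5) (sx : smooth_on U x).

Lemma br_cstr (u : 'rV[R]_5) p : U p ->
  br U x (fun=> u) p = cb (x p) u - dif U x p (fr u *m p).
Proof.
move=> Up; rewrite /br (dif_cst fV Up (fr_tangent A0 hU x Up) _ f5) sub0r addrC.
by [].
Qed.

Lemma br_cstr_smooth (u : 'rV[R]_5) : smooth_on U (br U x (fun=> u)).
Proof. exact: (smooth_br A0 hU sx (@smooth_on_cst _ _ _ U u)). Qed.

Lemma br_cstr_linear p : U p -> linear (fun u => br U x (fun=> u) p).
Proof.
move=> Up a u w; rewrite !br_cstr // cb_linearr scalerBr [RHS]addrACA; congr (_ + _).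
rewrite -opprD; congr (- _); apply/rowP => k.
have e t := dif_mx fV Up (fr_tan t Up) 0 k sx.
have sk : smooth_on U (fun q => x q 0 k) by move/smooth_on_mxP: sx; apply.
rewrite -[LHS]e; transitivity (a * dif U (fun q => x q 0 k) p (fr u *m p)
  + dif U (fun q => x q 0 k) p (fr w *m p)); first exact: (dif_fr_linear Up sk a u w).
rewrite [RHS]mxE [X in _ = X + _]mxE.
exact: (congr2 (fun s t => a * s + t) (e u) (e w)).
Qed.

(** The Jacobi identity for [fld x] and two constant frame fields, as a first order equation on the
    brackets of [fld x] with the frame. *)
Lemma br_jacobi (u w : 'rV[R]_5) p : U p ->
  dif U (br U x (fun=> w)) p (fr u *m p) - dif U (br U x (fun=> u)) p (fr w *m p) =
  br U x (fun=> cb u w) p - cb (br U x (fun=> u) p) w - cb u (br U x (fun=> w) p).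
Proof.
move=> Up.
have cb0 (y : 'rV[R]_5) : cb y 0 = 0 by exact: linear_at0 (cb_linearr y).
have sc (t : 'rV[R]_5) := smooth_cb sx (@smooth_on_cst _ _ _ U t).
have vt (t : 'rV[R]_5) := fld_vfield A0 hU (@smooth_on_cst _ _ _ U t).
have sd (t : 'rV[R]_5) := dif_smooth fV f5 sx (vt t).
have dE (s : 'rV[R]_5) : dif U x p (fr s *m p) = cb (x p) s - br U x (fun=> s) p.
  rewrite (br_cstr s Up); exact: esym (subKr _ _).
(* [T s t] abbreviates the second derivative of [x] along the frame fields of [t], then [s]; only
   its antisymmetric part matters, and the commutation of derivations makes it first order. *)
have [T [key C]] : exists T : 'rV[R]_5 -> 'rV[R]_5 -> 'rV[R]_5,
   (forall t s, dif U (br U x (fun=> t)) p (fr s *m p) = cb (dif U x p (fr s *m p)) t - T s t)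
   /\ T u w - T w u = dif U x p (fr (cb u w) *m p).
  exists (fun s t => dif U (fun q => dif U x q (fld (fun=> t) q)) p (fld (fun=> s) p)).
  split=> [t s|].
    have E q : U q -> br U x (fun=> t) q = cb (x q) t - dif U x q (fld (fun=> t) q).
      by move=> Uq; rewrite br_cstr.
    rewrite (dif_eq fV Up (fr_tan s Up) f5 (br_cstr_smooth t) E).
    rewrite (difB fV Up (fr_tan s Up) f5 (sc t) (sd t)).
    have := dif_bilin (@cb_linearl R) (@cb_linearr R) f5 f5 f5 fV sx (@smooth_on_cst _ _ _ U t)
       Up (fr_tan s Up).
    by rewrite (dif_cst fV Up (fr_tan s Up) _ f5) cb0 addr0 => ->.
  have C := dif_comm_fld A0 hU f5 Up sx (@smooth_on_cst _ _ _ U u) (@smooth_on_cst _ _ _ U w).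
  exact: (etrans C (congr1 (dif U x p)
    (congr1 (fun y => fr y *m p) (br_cst u w Up) : fld _ p = fr (cb u w) *m p))).
rewrite (key w u) (key u w) !dE; move: C; rewrite dE => /eqP; rewrite subr_eq => /eqP ->.
have bB (a b c : 'rV[R]_5) : cb (a - b) c = cb a c - cb b c.
  by rewrite -[a - b]addrC -scaleN1r cb_linearl scaleN1r addrC.
rewrite !bB -(cb_jacobi (x p) u w) (cb_anti u (br U x (fun=> w) p)).
move: (cb (cb (x p) u) w) (cb (cb (x p) w) u) (cb (br U x (fun=> u) p) w)
  (cb (br U x (fun=> w) p) u) (br U x (fun=> cb u w) p) (T w u) => a b c d e t.
clear; by apply/rowP => k; rewrite !mxE; ring.
Qed.

Definition dev i l : V -> R := fun p => cf (br U x (fun=> ev i) p) l.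

Lemma dev_smooth i l : smooth_on U (dev i l).
Proof. by have /smooth_on_mxP := br_cstr_smooth (ev i); apply. Qed.

Lemma dev_eq i j l p : U p -> De i (dev j l) p - De j (dev i l) p =
  cf (cb (ev i) (ev j)) 1 * dev 1 l p + cf (cb (ev i) (ev j)) 2 * dev 2 l p
  + cf (cb (ev i) (ev j)) 3 * dev 3 l p + cf (cb (ev i) (ev j)) 4 * dev 4 l p
  + cf (cb (ev i) (ev j)) 5 * dev 5 l p
  - cf (cb (row5 (dev i 1 p) (dev i 2 p) (dev i 3 p) (dev i 4 p) (dev i 5 p)) (ev j)) l
  - cf (cb (ev i) (row5 (dev j 1 p) (dev j 2 p) (dev j 3 p) (dev j 4 p) (dev j 5 p))) l.
Proof.
move=> Up.
have rE k : row5 (dev k 1 p) (dev k 2 p) (dev k 3 p) (dev k 4 p) (dev k 5 p)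
    = br U x (fun=> ev k) p by apply: row5P; rewrite row5E.
have J := congr1 (fun y : 'rV[R]_5 => cf y l) (br_jacobi (ev i) (ev j) Up).
have dd a b : De a (dev b l) p = cf (dif U (br U x (fun=> ev b)) p (fr (ev a) *m p)) l.
  exact: (dif_mx fV Up (fr_tan _ Up) _ _ (br_cstr_smooth (ev b))).
rewrite !rE !dd; move: J; rewrite (ev_expand (cb (ev i) (ev j)) (br_cstr_linear Up)) => J.
exact: (etrans (esym (cfB _ _ l)) (etrans J (cf_comb _ _ _ _ _ _ _ _ _ _ _ _ l))).
Qed.

End Deviation.

End Symmetries.

Section Brackets.
Context {R : realType}.

(** Brackets with basis vectors, tabulated as rewriting rules: each instance of the Jacobi identity
    then becomes a linear relation for [lra]. *)
Lemma cb_evr (y1 y2 y3 y4 y5 : R) : let y := row5 y1 y2 y3 y4 y5 in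
  (cb y (ev 1) = row5 (- (1 / 10 * y3) - y4 + y5) (- (1 / 5 * y3) + y5) (243 / 100 * y2 + 9 / 5
      * y4 - 9 / 10 * y5) (567 / 100 * y3 - 9 / 10 * y4 - 9 / 10 * y5) (- (9 / 5 * y4) + 9 / 10
      * y5)) *
  (cb y (ev 2) = row5 (1 / 5 * y3 + y4) (1 / 10 * y3 + y4 - y5) (- (243 / 100 * y1) - 9 / 10 *
      y4 + 9 / 5 * y5) (- (9 / 10 * y4) + 9 / 5 * y5) (567 / 100 * y3 + 9 / 10 * y4 + 9 / 10 *
      y5)) *
  (cb y (ev 3) = row5 (1 / 10 * y1 - 1 / 5 * y2 + y4) (1 / 5 * y1 - 1 / 10 * y2 + y5) (0) (-
      (567 / 100 * y1) - 11 / 10 * y4 + 11 / 5 * y5) (- (567 / 100 * y2) - 11 / 5 * y4 + 11 / 10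
      * y5)) *
  (cb y (ev 4) = row5 (y1 - y2 - y3) (- (y2)) (- (9 / 5 * y1) + 9 / 10 * y2 + y5) (9 / 10 * y1 +
      9 / 10 * y2 + 11 / 10 * y3) (9 / 5 * y1 - 9 / 10 * y2 + 11 / 5 * y3)) *
  (cb y (ev 5) = row5 (- (y1)) (- (y1) + y2 - y3) (9 / 10 * y1 - 9 / 5 * y2 - y4) (9 / 10 * y1 -
      9 / 5 * y2 - 11 / 5 * y3) (- (9 / 10 * y1) - 9 / 10 * y2 - 11 / 10 * y3)).
Proof.
by do !split; rewrite /ev /= cb_row5; congr row5; lra.
Qed.

Lemma cb_evl (y1 y2 y3 y4 y5 : R) : let y := row5 y1 y2 y3 y4 y5 in
  (cb (ev 1) y = row5 (1 / 10 * y3 + y4 - y5) (1 / 5 * y3 - y5) (- (243 / 100 * y2) - 9 / 5 * y4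
      + 9 / 10 * y5) (- (567 / 100 * y3) + 9 / 10 * y4 + 9 / 10 * y5) (9 / 5 * y4 - 9 / 10 *
      y5)) *
  (cb (ev 2) y = row5 (- (1 / 5 * y3) - y4) (- (1 / 10 * y3) - y4 + y5) (243 / 100 * y1 + 9 / 10
      * y4 - 9 / 5 * y5) (9 / 10 * y4 - 9 / 5 * y5) (- (567 / 100 * y3) - 9 / 10 * y4 - 9 / 10 *
      y5)) *
  (cb (ev 3) y = row5 (- (1 / 10 * y1) + 1 / 5 * y2 - y4) (- (1 / 5 * y1) + 1 / 10 * y2 - y5)
      (0) (567 / 100 * y1 + 11 / 10 * y4 - 11 / 5 * y5) (567 / 100 * y2 + 11 / 5 * y4 - 11 / 10
      * y5)) *
  (cb (ev 4) y = row5 (- (y1) + y2 + y3) (y2) (9 / 5 * y1 - 9 / 10 * y2 - y5) (- (9 / 10 * y1) -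
      9 / 10 * y2 - 11 / 10 * y3) (- (9 / 5 * y1) + 9 / 10 * y2 - 11 / 5 * y3)) *
  (cb (ev 5) y = row5 (y1) (y1 - y2 + y3) (- (9 / 10 * y1) + 9 / 5 * y2 + y4) (- (9 / 10 * y1) +
      9 / 5 * y2 + 11 / 5 * y3) (9 / 10 * y1 + 9 / 10 * y2 + 11 / 10 * y3)).
Proof.
by do !split; rewrite /ev /= cb_row5; congr row5; lra.
Qed.

Lemma cb_ev_ev :
  (cb (ev 1) (ev 2) = row5 0 0 (- (243 / 100)) 0 0 :> 'rV[R]_5) *
  (cb (ev 1) (ev 3) = row5 (1 / 10) (1 / 5) 0 (- (567 / 100)) 0 :> 'rV[R]_5) *
  (cb (ev 1) (ev 4) = row5 1 0 (- (9 / 5)) (9 / 10) (9 / 5) :> 'rV[R]_5) *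
  (cb (ev 1) (ev 5) = row5 (- 1) (- 1) (9 / 10) (9 / 10) (- (9 / 10)) :> 'rV[R]_5) *
  (cb (ev 2) (ev 3) = row5 (- (1 / 5)) (- (1 / 10)) 0 0 (- (567 / 100)) :> 'rV[R]_5) *
  (cb (ev 2) (ev 4) = row5 (- 1) (- 1) (9 / 10) (9 / 10) (- (9 / 10)) :> 'rV[R]_5) *
  (cb (ev 2) (ev 5) = row5 0 1 (- (9 / 5)) (- (9 / 5)) (- (9 / 10)) :> 'rV[R]_5) *
  (cb (ev 3) (ev 4) = row5 (- 1) 0 0 (11 / 10) (11 / 5) :> 'rV[R]_5) *
  (cb (ev 3) (ev 5) = row5 0 (- 1) 0 (- (11 / 5)) (- (11 / 10)) :> 'rV[R]_5) *
  (cb (ev 4) (ev 5) = row5 0 0 (- 1) 0 0 :> 'rV[R]_5).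
Proof.
by do !split; rewrite [in LHS]/ev /= cb_row5; congr row5; lra.
Qed.

End Brackets.

(* [D i] is the derivative along the frame field [E_i] and [M i l] the [l]-th component of
   [X, E_i] for a symmetry [X]; [Meq] is the Jacobi identity.  The unknowns are eliminated by
   increasing weight; the seven remaining ones satisfy a closed first order system, whose
   integrability conditions kill them. *)
Section Prolongation.
Context {R : realType} {T : Type}.
Variables (U : set T) (S : (T -> R) -> Prop) (D : nat -> (T -> R) -> T -> R).
Variable M : nat -> nat -> T -> R.
Hypothesis Dlin : forall k f (a1 a2 a3 a4 a5 : R) (g1 g2 g3 g4 g5 : T -> R) p, U p ->
  S g1 -> S g2 -> S g3 -> S g4 -> S g5 ->
  (forall q, U q -> f q = a1 * g1 q + a2 * g2 q + a3 * g3 q + a4 * g4 q + a5 * g5 q) ->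
  D k f p = a1 * D k g1 p + a2 * D k g2 p + a3 * D k g3 p + a4 * D k g4 p + a5 * D k g5 p.
Hypothesis Dzero : forall k f p, U p -> (forall q, U q -> f q = 0) -> D k f p = 0.
Hypothesis Dcomm : forall i j f p, U p -> S f -> D i (D j f) p - D j (D i f) p =
  cf (cb (ev i) (ev j)) 1 * D 1 f p + cf (cb (ev i) (ev j)) 2 * D 2 f p
  + cf (cb (ev i) (ev j)) 3 * D 3 f p + cf (cb (ev i) (ev j)) 4 * D 4 f p
  + cf (cb (ev i) (ev j)) 5 * D 5 f p.
Hypothesis SM : forall i l, S (M i l).
Hypothesis Meq : forall i j l p, U p -> D i (M j l) p - D j (M i l) p =
  cf (cb (ev i) (ev j)) 1 * M 1 l p + cf (cb (ev i) (ev j)) 2 * M 2 l p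
  + cf (cb (ev i) (ev j)) 3 * M 3 l p + cf (cb (ev i) (ev j)) 4 * M 4 l p
  + cf (cb (ev i) (ev j)) 5 * M 5 l p
  - cf (cb (row5 (M i 1 p) (M i 2 p) (M i 3 p) (M i 4 p) (M i 5 p)) (ev j)) l
  - cf (cb (ev i) (row5 (M j 1 p) (M j 2 p) (M j 3 p) (M j 4 p) (M j 5 p))) l.
Hypothesis M4 : forall p, U p -> [/\ M 4 1 p = 0, M 4 2 p = 0 & M 4 3 p = 0].
Hypothesis M5 : forall p, U p -> [/\ M 5 1 p = 0, M 5 2 p = 0 & M 5 3 p = 0].

Let M41 p : U p -> M 4 1 p = 0. Proof. by move=> /M4[]. Qed.
Let M42 p : U p -> M 4 2 p = 0. Proof. by move=> /M4[]. Qed.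
Let M43 p : U p -> M 4 3 p = 0. Proof. by move=> /M4[]. Qed.
Let M51 p : U p -> M 5 1 p = 0. Proof. by move=> /M5[]. Qed.
Let M52 p : U p -> M 5 2 p = 0. Proof. by move=> /M5[]. Qed.
Let M53 p : U p -> M 5 3 p = 0. Proof. by move=> /M5[]. Qed.

Ltac eqn i j l Up := let H := fresh "H" in have H := Meq i j l Up;
  rewrite !cb_ev_ev !cb_evr !cb_evl !row5E in H.
Ltac zer Up := rewrite ?(M41 Up) ?(M42 Up) ?(M43 Up) ?(M51 Up) ?(M52 Up) ?(M53 Up).

(** Since [[E_4, E_5] = - E_3], the equation for the pair (4, 5) expresses [[X, E_3]] by [[X, E_4]]
    and [[X, E_5]]; the derivatives in it are those of vanishing components. *)
Let M31 p : U p -> M 3 1 p = 0.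
Proof.
move=> Up; eqn 4%N 5%N 1%N Up; move: H; rewrite !Dzero //; zer Up; lra.
Qed.

Let M32 p : U p -> M 3 2 p = 0.
Proof. by move=> Up; eqn 4%N 5%N 2%N Up; move: H; rewrite !Dzero //; zer Up; lra. Qed.

Let M33 p : U p -> M 3 3 p = M 4 4 p + M 5 5 p.
Proof. by move=> Up; eqn 4%N 5%N 3%N Up; move: H; rewrite !Dzero //; zer Up; lra. Qed.

Ltac zer3 Up := zer Up; rewrite ?(M31 Up) ?(M32 Up) ?(M33 Up).

(** [[E_3, E_4]] and [[E_3, E_5]] reach [- E_1] and [- E_2] modulo [D], so the pairs (3, 4) and (3,
    5) determine the first two components of [[X, E_1]] and [[X, E_2]]. *)
Let M11 p : U p -> M 1 1 p = 2 * M 4 4 p + M 5 5 p.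
Proof. by move=> Up; eqn 3%N 4%N 1%N Up; move: H; rewrite !Dzero //; zer3 Up; lra. Qed.
Let M12 p : U p -> M 1 2 p = M 4 5 p.
Proof. by move=> Up; eqn 3%N 4%N 2%N Up; move: H; rewrite !Dzero //; zer3 Up; lra. Qed.
Let M21 p : U p -> M 2 1 p = M 5 4 p.
Proof. by move=> Up; eqn 3%N 5%N 1%N Up; move: H; rewrite !Dzero //; zer3 Up; lra. Qed.
Let M22 p : U p -> M 2 2 p = M 4 4 p + 2 * M 5 5 p.
Proof. by move=> Up; eqn 3%N 5%N 2%N Up; move: H; rewrite !Dzero //; zer3 Up; lra. Qed.

Let D2lin k f (a1 a2 : R) (g1 g2 : T -> R) p : U p -> S g1 -> S g2 ->
  (forall q, U q -> f q = a1 * g1 q + a2 * g2 q) ->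
  D k f p = a1 * D k g1 p + a2 * D k g2 p.
Proof.
move=> Up s1 s2 E; rewrite (@Dlin k f a1 a2 0 0 0 g1 g2 g1 g1 g1) //; first by ring.
by move=> q Uq; rewrite E //; ring.
Qed.

Let D33 k p : U p -> D k (M 3 3) p = D k (M 4 4) p + D k (M 5 5) p.
Proof.
by move=> Up; rewrite (@D2lin k _ 1 1 (M 4 4) (M 5 5)) // => [|q Uq]; rewrite ?M33 //; ring.
Qed.
Let D11 k p : U p -> D k (M 1 1) p = 2 * D k (M 4 4) p + D k (M 5 5) p.
Proof.
by move=> Up; rewrite (@D2lin k _ 2 1 (M 4 4) (M 5 5)) // => [|q Uq]; rewrite ?M11 //; ring.
Qed.
Let D22 k p : U p -> D k (M 2 2) p = D k (M 4 4) p + 2 * D k (M 5 5) p.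
Proof.
by move=> Up; rewrite (@D2lin k _ 1 2 (M 4 4) (M 5 5)) // => [|q Uq]; rewrite ?M22 //; ring.
Qed.
Let D12 k p : U p -> D k (M 1 2) p = D k (M 4 5) p.
Proof.
by move=> Up; rewrite (@D2lin k _ 1 0 (M 4 5) (M 4 5)) // => [|q Uq]; rewrite ?M12 //; ring.
Qed.
Let D21 k p : U p -> D k (M 2 1) p = D k (M 5 4) p.
Proof.
by move=> Up; rewrite (@D2lin k _ 1 0 (M 5 4) (M 5 4)) // => [|q Uq]; rewrite ?M21 //; ring.
Qed.

Let D41 k p : U p -> D k (M 4 1) p = 0. Proof. by move=> Up; apply: Dzero. Qed.
Let D42 k p : U p -> D k (M 4 2) p = 0. Proof. by move=> Up; apply: Dzero. Qed.
Let D43 k p : U p -> D k (M 4 3) p = 0. Proof. by move=> Up; apply: Dzero. Qed.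
Let D51 k p : U p -> D k (M 5 1) p = 0. Proof. by move=> Up; apply: Dzero. Qed.
Let D52 k p : U p -> D k (M 5 2) p = 0. Proof. by move=> Up; apply: Dzero. Qed.
Let D53 k p : U p -> D k (M 5 3) p = 0. Proof. by move=> Up; apply: Dzero. Qed.
Let D31 k p : U p -> D k (M 3 1) p = 0. Proof. by move=> Up; apply: Dzero. Qed.
Let D32 k p : U p -> D k (M 3 2) p = 0. Proof. by move=> Up; apply: Dzero. Qed.

Ltac zerD H Up := rewrite ?(D41 _ Up) ?(D42 _ Up) ?(D43 _ Up) ?(D51 _ Up) ?(D52 _ Up)
  ?(D53 _ Up) ?(D31 _ Up) ?(D32 _ Up) ?(D33 _ Up) ?(D11 _ Up) ?(D22 _ Up) ?(D12 _ Up)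
  ?(D21 _ Up) ?(M41 Up) ?(M42 Up) ?(M43 Up) ?(M51 Up) ?(M52 Up) ?(M53 Up)
  ?(M31 Up) ?(M32 Up) ?(M33 Up) ?(M11 Up) ?(M12 Up) ?(M21 Up) ?(M22 Up) in H.
Ltac eqnD i j l Up := let H := fresh "H" in have H := Meq i j l Up;
  rewrite !cb_ev_ev !cb_evr !cb_evl !row5E in H; zerD H Up.

(** As [M 1 1 + M 2 2 = 3 M 3 3], the derivatives along [E_5], respectively [E_4], cancel in the
    corresponding combination of the three equations, and an algebraic relation is left. *)
Let weight1 p : U p -> [/\ M 3 4 p = 4 / 3 * M 2 3 p & M 3 5 p = - (4 / 3) * M 1 3 p].
Proof.
move=> Up; split.
  by eqnD 1%N 5%N 1%N Up; eqnD 3%N 5%N 3%N Up; eqnD 2%N 5%N 2%N Up; lra.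
by eqnD 2%N 4%N 2%N Up; eqnD 3%N 4%N 3%N Up; eqnD 1%N 4%N 1%N Up; lra.
Qed.

Let M34 p : U p -> M 3 4 p = 4 / 3 * M 2 3 p. Proof. by move=> /weight1[]. Qed.
Let M35 p : U p -> M 3 5 p = - (4 / 3) * M 1 3 p. Proof. by move=> /weight1[]. Qed.
Let D34 k p : U p -> D k (M 3 4) p = 4 / 3 * D k (M 2 3) p.
Proof.
by move=> Up; rewrite (@D2lin k _ (4 / 3) 0 (M 2 3) (M 2 3)) // => [|q Uq]; rewrite ?M34 //; ring.
Qed.
Let D35 k p : U p -> D k (M 3 5) p = - (4 / 3) * D k (M 1 3) p.
Proof.
by move=> Up; rewrite (@D2lin k _ (- (4 / 3)) 0 (M 1 3) (M 1 3)) // => [|q Uq]; rewrite ?M35 //; ring.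
Qed.

Ltac eqnW i j l Up := let H := fresh "H" in have H := Meq i j l Up;
  rewrite !cb_ev_ev !cb_evr !cb_evl !row5E in H; zerD H Up;
  rewrite ?(D34 _ Up) ?(D35 _ Up) ?(M34 Up) ?(M35 Up) in H.

(** In each group of equations the derivatives cancel. For [M 1 5], for instance, the instances (1,
    4, 3), (3, 4, 5) and (1, 3, 2) are added with weights 4/3, 1 and 1. *)
Let weight2 p : U p -> [/\ M 1 5 p = 0, M 2 4 p = 0 & M 2 5 p = M 1 4 p].
Proof.
move=> Up; split.
- by eqnW 1%N 4%N 3%N Up; eqnW 3%N 4%N 5%N Up; eqnW 1%N 3%N 2%N Up; lra.
- by eqnW 2%N 5%N 3%N Up; eqnW 2%N 3%N 1%N Up; eqnW 3%N 5%N 4%N Up; lra.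
- by eqnW 3%N 5%N 5%N Up; eqnW 1%N 5%N 3%N Up; eqnW 2%N 3%N 2%N Up; eqnW 1%N 3%N 1%N Up; lra.
Qed.

Let M15 p : U p -> M 1 5 p = 0. Proof. by move=> /weight2[]. Qed.
Let M24 p : U p -> M 2 4 p = 0. Proof. by move=> /weight2[]. Qed.
Let M25 p : U p -> M 2 5 p = M 1 4 p. Proof. by move=> /weight2[]. Qed.
Let D15 k p : U p -> D k (M 1 5) p = 0. Proof. by move=> Up; apply: Dzero. Qed.
Let D24 k p : U p -> D k (M 2 4) p = 0. Proof. by move=> Up; apply: Dzero. Qed.
Let D25 k p : U p -> D k (M 2 5) p = D k (M 1 4) p.
Proof.
by move=> Up; rewrite (@D2lin k _ 1 0 (M 1 4) (M 1 4)) // => [|q Uq]; rewrite ?M25 //; ring.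
Qed.

Ltac eqnE i j l Up := let H := fresh "H" in have H := Meq i j l Up;
  rewrite !cb_ev_ev !cb_evr !cb_evl !row5E in H; zerD H Up;
  rewrite ?(D34 _ Up) ?(D35 _ Up) ?(M34 Up) ?(M35 Up) ?(D15 _ Up) ?(D24 _ Up) ?(D25 _ Up)
    ?(M15 Up) ?(M24 Up) ?(M25 Up) in H.

Local Notation a := (M 4 4).
Local Notation b := (M 4 5).
Local Notation c := (M 5 4).
Local Notation d := (M 5 5).
Local Notation q := (M 1 3).
Local Notation s := (M 2 3).
Local Notation r := (M 1 4).

Let order1 p : U p ->
  [/\ D 4 q p = - q p - 18 / 5 * a p + 9 / 5 * b p,
      D 4 s p = q p + s p + 9 / 10 * (a p + d p) - 9 / 5 * (b p + c p) + r p,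
      D 5 q p = q p + s p + 9 / 10 * (a p + d p) - 9 / 5 * (b p + c p) - r p &
      D 5 s p = - s p - 18 / 5 * d p + 9 / 5 * c p] /\
  [/\ D 5 a p = 2 * c p + 1 / 3 * s p - d p & D 5 b p = 2 * b p - a p - q p].
Proof.
move=> Up; split; split.
- by eqnE 1%N 4%N 3%N Up; lra.
- by eqnE 2%N 4%N 3%N Up; lra.
- by eqnE 1%N 5%N 3%N Up; lra.
- by eqnE 2%N 5%N 3%N Up; lra.
- by eqnE 2%N 5%N 2%N Up; eqnE 3%N 5%N 3%N Up; lra.
- by eqnE 1%N 5%N 2%N Up; lra.
Qed.

Let order1' p : U p ->
  [/\ D 1 q p = - (9 / 5) * r p + 9 / 10 * q p + 9 / 5 * s p,
      D 1 s p = 9 / 10 * r p + 9 / 10 * q p - 9 / 10 * s p + 243 / 100 * (a p + d p),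
      D 2 q p = - (243 / 100) * (a p + d p) + 9 / 10 * r p + 9 / 10 * q p - 9 / 10 * s p &
      D 2 s p = - (9 / 5) * r p - 9 / 10 * s p - 9 / 5 * q p].
Proof.
move=> Up; split.
- by eqnE 1%N 3%N 5%N Up; lra.
(* Three linear equations in the three derivatives [D 1 s], [D 2 q] and [D 3 r]. *)
- by eqnE 2%N 3%N 5%N Up; eqnE 1%N 3%N 4%N Up; eqnE 1%N 2%N 3%N Up; lra.
- by eqnE 2%N 3%N 5%N Up; eqnE 1%N 3%N 4%N Up; eqnE 1%N 2%N 3%N Up; lra.
- by eqnE 2%N 3%N 4%N Up; lra.
Qed.

(** Integrability: [E_1] and [E_2] are commuted on [q] and [s], whose derivatives along them are
    known. As [[E_1, E_2]] is a multiple of [E_3], the derivatives [D 3 q] and [D 3 s] enter,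
    supplied by the pairs (1, 3) and (2, 3); those of [r] come from the pair (1, 2). *)
Let qs0 p : U p -> q p = 0 /\ s p = 0.
Proof.
move=> Up.
have E1q k : D k (D 1 q) p = - (9 / 5) * D k r p + 9 / 10 * D k q p + 9 / 5 * D k s p.
  rewrite (@Dlin k _ (- (9 / 5)) (9 / 10) (9 / 5) 0 0 r q s q q) //; first by ring.
  by move=> t Ut; have [-> _ _ _] := order1' Ut; ring.
have E1s k : D k (D 1 s) p = 9 / 10 * D k r p + 9 / 10 * D k q p - 9 / 10 * D k s p
    + 243 / 100 * (D k a p + D k d p).
  rewrite (@Dlin k _ (9 / 10) (9 / 10) (- (9 / 10)) (243 / 100) (243 / 100) r q s a d) //.
    by ring.
  by move=> t Ut; have [_ -> _ _] := order1' Ut; ring.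
have E2q k : D k (D 2 q) p = - (243 / 100) * (D k a p + D k d p) + 9 / 10 * D k r p
    + 9 / 10 * D k q p - 9 / 10 * D k s p.
  rewrite (@Dlin k _ (9 / 10) (9 / 10) (- (9 / 10)) (- (243 / 100)) (- (243 / 100)) r q s a d) //.
    by ring.
  by move=> t Ut; have [_ _ -> _] := order1' Ut; ring.
have E2s k : D k (D 2 s) p = - (9 / 5) * D k r p - 9 / 10 * D k s p - 9 / 5 * D k q p.
  rewrite (@Dlin k _ (- (9 / 5)) (- (9 / 5)) (- (9 / 10)) 0 0 r q s q q) //; first by ring.
  by move=> t Ut; have [_ _ _ ->] := order1' Ut; ring.
have Cq := Dcomm 1 2 Up (SM 1 3); have Cs := Dcomm 1 2 Up (SM 2 3).
rewrite !(E1q, E2q) !cb_ev_ev !row5E in Cq; rewrite !(E1s, E2s) !cb_ev_ev !row5E in Cs.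
have [h1 h2 h3 h4] := order1' Up; eqnE 2%N 3%N 3%N Up; eqnE 1%N 3%N 3%N Up; split.
  by eqnE 1%N 2%N 5%N Up; lra.
by eqnE 1%N 2%N 3%N Up; eqnE 1%N 2%N 4%N Up; lra.
Qed.

Lemma prolongation_zero p : U p -> forall i l, (0 < i <= 5)%N -> (0 < l <= 5)%N -> M i l p = 0.
Proof.
have q0 p' : U p' -> q p' = 0 by move=> /qs0[].
have s0 p' : U p' -> s p' = 0 by move=> /qs0[].
(* With [q = s = 0] identically, the equations [order1] for their derivatives become algebraic and
   leave [a] as the only unknown. *)
have rel p' : U p' -> [/\ b p' = 2 * a p', c p' = - (2 * a p'), d p' = - a p' & r p' = 0].
  move=> Up; have [[h1 h2 h3 h4] _] := order1 Up.
  rewrite !(Dzero _ Up q0) !(Dzero _ Up s0) (q0 _ Up) (s0 _ Up) in h1 h2 h3 h4.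
  by split; lra.
move=> Up; have [_ [h1 h2]] := order1 Up; have [hb hc hd hr] := rel p Up.
(* Differentiating [b = 2 a] along [E_5] and inserting both derivatives from [order1] yields
   [3 a = -6 a]. *)
have Db : D 5 b p = 2 * D 5 a p.
  rewrite (@D2lin 5 _ 2 0 a a) //; first by ring.
  by move=> t Ut; have [-> _ _ _] := rel t Ut; ring.
have ha : a p = 0 by rewrite (q0 _ Up) (s0 _ Up) Db in h1 h2; lra.
move=> [|[|[|[|[|[|//]]]]]] // [|[|[|[|[|[|//]]]]]] // _ _;
  rewrite ?(M41 Up) ?(M42 Up) ?(M43 Up) ?(M51 Up) ?(M52 Up) ?(M53 Up) ?(M31 Up) ?(M32 Up)
   ?(M33 Up) ?(M11 Up) ?(M12 Up) ?(M21 Up) ?(M22 Up) ?(M34 Up) ?(M35 Up) ?(M15 Up) ?(M24 Up)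
   ?(M25 Up) ?(q0 _ Up) ?(s0 _ Up) ?hb ?hc ?hd ?hr ?ha //; ring.
Qed.

End Prolongation.

(** * Affine decomposition of triples of vectors *)

Section Affine.
Context {R : realType}.
Local Notation V := 'M[R]_(3, 2).
Local Notation fV := (@fin_dim_mx R 3 2).

Notation e22 h i j := (fun_of_matrix h (@ix 1 i) (@ix 1 j)).

Lemma det22 (h : 'M[R]_2) : \det h = e22 h 1 1 * e22 h 2 2 - e22 h 1 2 * e22 h 2 1.
Proof.
rewrite (expand_det_row _ (ix 1)) sum2 /cofactor !det_mx11 !mxE /ix !inordK //=.
rewrite !expr1 expr0 mul1r mulN1r mulrN.
have -> : lift (inord 0) 0 = inord 1 :> 'I_2 by apply: val_inj; rewrite /= /bump !inordK.
by have -> : lift (inord 1) 0 = inord 0 :> 'I_2 by apply: val_inj; rewrite /= /bump !inordK.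
Qed.

Lemma tr22 (h : 'M[R]_2) : \tr h = e22 h 1 1 + e22 h 2 2.
Proof. by rewrite /mxtrace sum2. Qed.

Definition ones : 'cV[R]_3 := const_mx 1.

Lemma fr_ones x : fr x *m ones = 0.
Proof.
apply/matrixP => i j; rewrite ord1 !mxE sum3 !(mxE _ _ (ix _) 0); move: i.
by apply: ord3P; rewrite !fr_entries; field.
Qed.

(** The first two rows of the inverse of the 3x3 matrix formed by [p] and the column [ones]: it
    recovers [h] from [p *m h + ones *m b]. *)
Definition Qm (p : V) : 'M[R]_(2, 3) := \matrix_(i, j) nth 0 (nth [::]
  [:: [:: (en p 2 2 - en p 3 2) / dt p; (en p 3 2 - en p 1 2) / dt p;
          (en p 1 2 - en p 2 2) / dt p];
      [:: (en p 3 1 - en p 2 1) / dt p; (en p 1 1 - en p 3 1) / dt p;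
          (en p 2 1 - en p 1 1) / dt p]] i) j.

Lemma QmE (p : V) :
  (Qm p (ix 1) (ix 1) = (en p 2 2 - en p 3 2) / dt p) *
  (Qm p (ix 1) (ix 2) = (en p 3 2 - en p 1 2) / dt p) *
  (Qm p (ix 1) (ix 3) = (en p 1 2 - en p 2 2) / dt p) *
  (Qm p (ix 2) (ix 1) = (en p 3 1 - en p 2 1) / dt p) *
  (Qm p (ix 2) (ix 2) = (en p 1 1 - en p 3 1) / dt p) *
  (Qm p (ix 2) (ix 3) = (en p 2 1 - en p 1 1) / dt p).
Proof. by rewrite !mxE /ix !inordK. Qed.

Lemma ix12 : (@ix 1 1 == ix 2) = false.
Proof. by apply/eqP => /(congr1 val); rewrite /= /ix !inordK. Qed.

Lemma ix21 : (@ix 1 2 == ix 1) = false.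
Proof. by rewrite eq_sym ix12. Qed.

Lemma Qm_p (p : V) : dt p != 0 -> Qm p *m p = 1%:M.
Proof.
move=> p0; apply/matrixP; apply: ord2P; apply: ord2P;
  rewrite [LHS]mxE sum3 !QmE [RHS]mxE ?eqxx ?ix12 ?ix21 /=; rewrite /dt in p0 *; field; exact: p0.
Qed.

Lemma Qm_ones (p : V) : Qm p *m ones = 0.
Proof.
apply/matrixP => i j; rewrite ord1 [LHS]mxE sum3 !(mxE _ _ (ix _) 0) [RHS]mxE; move: i.
by apply: ord2P; rewrite !QmE; ring.
Qed.

Definition offset (p v : V) : 'rV[R]_2 := row (ix 1) (v - p *m (Qm p *m v)).

Lemma mul2E m n (K : 'M[R]_(m, 2)) (L : 'M[R]_(2, n)) i j :
  (K *m L) i j = K i (ix 1) * L (ix 1) j + K i (ix 2) * L (ix 2) j.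
Proof. by rewrite mxE sum2. Qed.

Lemma mul3E' m n (K : 'M[R]_(m, 3)) (L : 'M[R]_(3, n)) i j :
  (K *m L) i j = K i (ix 1) * L (ix 1) j + K i (ix 2) * L (ix 2) j + K i (ix 3) * L (ix 3) j.
Proof. by rewrite mxE sum3. Qed.

Lemma onesE n (b : 'rV[R]_n) i j : (ones *m b) i j = b 0 j.
Proof. by rewrite mxE big_ord1 mxE mul1r. Qed.

Lemma affine_dec (p v : V) : dt p != 0 -> v = p *m (Qm p *m v) + ones *m offset p v.
Proof.
move=> p0.
have oE j : offset p v 0 j = v (ix 1) j - (p *m (Qm p *m v)) (ix 1) j by rewrite !mxE.
have key i j : (p *m (Qm p *m v) + ones *m offset p v) i j =
   (p *m (Qm p *m v)) i j + (v (ix 1) j - (p *m (Qm p *m v)) (ix 1) j).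
  by rewrite mxE onesE oE.
apply/matrixP => i j; rewrite key !mul2E !mul3E' !QmE; move: i.
by apply: ord3P; rewrite /dt in p0 *; field; exact: p0.
Qed.

Lemma Qm_affine (p : V) (h : 'M[R]_2) (b : 'rV[R]_2) : dt p != 0 ->
  Qm p *m (p *m h + ones *m b) = h.
Proof. by move=> p0; rewrite mulmxDr !mulmxA Qm_p // Qm_ones mul1mx mul0mx addr0. Qed.

Lemma offset_affine (p : V) (h : 'M[R]_2) (b : 'rV[R]_2) : dt p != 0 ->
  offset p (p *m h + ones *m b) = b.
Proof.
move=> p0; rewrite /offset Qm_affine // addrAC subrr add0r.
by apply/rowP => j; rewrite mxE onesE.
Qed.

Lemma affine_inj (p : V) (h : 'M[R]_2) (b : 'rV[R]_2) : dt p != 0 ->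
  p *m h + ones *m b = 0 -> h = 0 /\ b = 0.
Proof.
move=> p0 E; split; first by rewrite -(Qm_affine h b p0) E mulmx0.
by rewrite -(offset_affine h b p0) E /offset !mulmx0 subr0; apply/rowP => j; rewrite !mxE.
Qed.

Lemma dt_affine (p : V) (h : 'M[R]_2) (b : 'rV[R]_2) :
  dt (p *m h + ones *m b) = dt p * \det h.
Proof.
have E i j : (p *m h + ones *m b) i j = p i (ix 1) * h (ix 1) j + p i (ix 2) * h (ix 2) j + b 0 j.
  by rewrite mxE onesE mul2E.
by rewrite /dt !E det22; ring.
Qed.

Lemma ddt_affine_field (p : V) (h : 'M[R]_2) (b : 'rV[R]_2) :
  ddt p (p *m h + ones *m b) = dt p * \tr h.
Proof.
have E i j : (p *m h + ones *m b) i j = p i (ix 1) * h (ix 1) j + p i (ix 2) * h (ix 2) j + b 0 j.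
  by rewrite mxE onesE mul2E.
by rewrite /ddt /dt !E tr22; ring.
Qed.

(** The rows of [fr x] sum to 0, so translations disappear, and left and right multiplication
    commute: affine maps preserve the frame. *)
Lemma fr_affine x (p : V) (h : 'M[R]_2) (b : 'rV[R]_2) :
  fr x *m (p *m h + ones *m b) = fr x *m p *m h.
Proof. by rewrite mulmxDr !mulmxA fr_ones mul0mx addr0. Qed.

Lemma ants_affine (A : R) (p : V) (h : 'M[R]_2) (b : 'rV[R]_2) : \det h = 1 ->
  ants_manifold A p -> ants_manifold A (p *m h + ones *m b).
Proof. by rewrite /ants_manifold /= !signed_areaE dt_affine => ->; rewrite mulr1. Qed.

Lemma det_Qm (A : R) (p q : V) : A != 0 -> ants_manifold A p -> ants_manifold A q ->
  \det (Qm p *m q) = 1.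
Proof.
move=> A0 Mp Mq; have p0 := ants_dt_neq0 A0 Mp.
have := dt_affine p (Qm p *m q) (offset p q).
rewrite -(affine_dec q p0) (ants_dt Mp) (ants_dt Mq) => /esym/eqP.
rewrite -[X in _ == X]mulr1 => /eqP/mulfI; apply.
by rewrite -(ants_dt Mp).
Qed.

End Affine.

Section Chart.
Context {R : realType}.
Local Notation V := 'M[R]_(3, 2).
Local Notation fV := (@fin_dim_mx R 3 2).

Lemma open_neq0 (W : normedModType R) (f : W -> R) : continuous f -> open [set x | f x != 0].
Proof.
move=> cf; rewrite openE => x fx.
exact: (cvgr_neq0 _ (cf x) fx).
Qed.

Lemma mulmx_smooth (W : normedModType R) (N : set W) m n k (f : W -> 'M[R]_(m, n))
    (g : W -> 'M[R]_(n, k)) : smooth_on N f -> smooth_on N g ->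
  smooth_on N (fun x => f x *m g x).
Proof.
move=> sf sg; apply: (smooth_on_bilin (B := @mulmx R m n k)) => //.
- by move=> w a u v; rewrite mulmxDl scalemxAl.
- by move=> u a w w'; rewrite mulmxDr scalemxAr.
- exact: fin_dim_mx.
- exact: fin_dim_mx.
Qed.

Lemma mulmx_dif (W : normedModType R) (N : set W) m n k (f : W -> 'M[R]_(m, n))
    (g : W -> 'M[R]_(n, k)) p v : fin_dim W -> N p -> tangent N p v ->
  smooth_on N f -> smooth_on N g ->
  dif N (fun x => f x *m g x) p v = dif N f p v *m g p + f p *m dif N g p v.
Proof.
move=> fW Np tv sf sg; apply: (dif_bilin (B := @mulmx R m n k)) => //.
- by move=> w a u v'; rewrite mulmxDl scalemxAl.
- by move=> u a w w'; rewrite mulmxDr scalemxAr.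
- exact: fin_dim_mx.
- exact: fin_dim_mx.
- exact: fin_dim_mx.
Qed.

(** A chart of the matrices of determinant 1 whose upper left entry is not 0: the determinant forces
    the lower right entry. *)
Definition chart_mx (y : 'rV[R]_5) : 'M[R]_2 := \matrix_(i, j) nth 0 (nth [::]
  [:: [:: cf y 1; cf y 2]; [:: cf y 3; (1 + cf y 2 * cf y 3) / cf y 1]] i) j.

Definition chart_off (y : 'rV[R]_5) : 'rV[R]_2 := \row_j nth 0 [:: cf y 4; cf y 5] j.

Lemma chart_mxE y : (chart_mx y (ix 1) (ix 1) = cf y 1) * (chart_mx y (ix 1) (ix 2) = cf y 2) *
  (chart_mx y (ix 2) (ix 1) = cf y 3) *
  (chart_mx y (ix 2) (ix 2) = (1 + cf y 2 * cf y 3) / cf y 1).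
Proof. by rewrite !mxE /ix !inordK. Qed.

Lemma chart_offE y : (chart_off y 0 (ix 1) = cf y 4) * (chart_off y 0 (ix 2) = cf y 5).
Proof. by rewrite !mxE /ix !inordK. Qed.

(** Each point of the level set is the image of [p] by a unique affine map of determinant 1, so a
    chart of the group around the identity, applied to [p], is a chart around [p]. *)
Lemma ants_submanifold (A : R) : A != 0 -> submanifold 5 (@ants_manifold R A).
Proof.
move=> A0 p Mp; have p0 := ants_dt_neq0 A0 Mp.
pose H (q : V) := Qm p *m q; pose b (q : V) := offset p q.
pose F (y : 'rV[R]_5) : V := p *m chart_mx y + ones *m chart_off y.
pose G (q : V) : 'rV[R]_5 := row5 (H q (ix 1) (ix 1)) (H q (ix 1) (ix 2)) (H q (ix 2) (ix 1))
  (b q 0 (ix 1)) (b q 0 (ix 2)).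
exists [set y | cf y 1 != 0], (ants_manifold A `&` [set q | H q (ix 1) (ix 1) != 0]), F.
have sH (N : set V) : smooth_on N H.
  by apply: mulmx_smooth; [exact: smooth_on_cst|exact: smooth_on_id].
have sHe (N : set V) i j : smooth_on N (fun q => H q i j) by have /smooth_on_mxP := sH N; apply.
have sb (N : set V) j : smooth_on N (fun q => b q 0 j).
  apply: (@smooth_on_eq _ _ _ _ (fun q : V => q (ix 1) j - (p *m (Qm p *m q)) (ix 1) j)).
    by move=> q _; rewrite !mxE.
  apply: smooth_onB; first by have /smooth_on_mxP := @smooth_on_id _ V N; apply.
  have s : smooth_on N (fun q => p *m H q) by apply: mulmx_smooth => //; exact: smooth_on_cst.
  by move/smooth_on_mxP: s; apply.
split.
- exact: (open_neq0 (@mx_entry_continuous R _ _ 0 (ix 1))).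
- exists [set q | H q (ix 1) (ix 1) != 0] => //; apply: open_neq0 => q.
  have [+ _] := smooth_on_openP (@openT _) (sHe setT (ix 1) (ix 1)) 0%N.
  by apply.
- by split=> //=; rewrite /H Qm_p // mxE eqxx oner_neq0.
exists G; split.
- set N := [set y | _].
  have sc k : smooth_on N (fun y : 'rV[R]_5 => cf y k).
    by have /smooth_on_mxP := @smooth_on_id _ 'rV[R]_5 N; apply.
  have sm : smooth_on N chart_mx.
    apply/smooth_on_mxP; apply: ord2P; apply: ord2P.
    + by apply: smooth_on_eq (sc 1%N) => y _; rewrite chart_mxE.
    + by apply: smooth_on_eq (sc 2%N) => y _; rewrite chart_mxE.
    + by apply: smooth_on_eq (sc 3%N) => y _; rewrite chart_mxE.
    + have si : smooth_on N (fun y => (cf y 1)^-1) by apply: smooth_onV.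
      have s1 : smooth_on N (fun y => 1 + cf y 2 * cf y 3).
        by apply: smooth_onD; [exact: smooth_on_cst|exact: smooth_onM].
      by apply: smooth_on_eq (smooth_onM s1 si) => y _; rewrite chart_mxE.
  have so : smooth_on N chart_off.
    apply/smooth_on_mxP => i; rewrite ord1; apply: ord2P.
    + by apply: smooth_on_eq (sc 4%N) => y _; rewrite chart_offE.
    + by apply: smooth_on_eq (sc 5%N) => y _; rewrite chart_offE.
  apply: (smooth_onD (f := fun y => p *m chart_mx y) (g := fun y => ones *m chart_off y)).
    by apply: mulmx_smooth => //; exact: smooth_on_cst.
  by apply: mulmx_smooth => //; exact: smooth_on_cst.
- by apply: smooth_row5; [exact: sHe..|exact: sb|exact: sb].
- move=> y /= y0.
  have HF : H (F y) = chart_mx y by rewrite /H /F Qm_affine.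
  have bF : b (F y) = chart_off y by rewrite /b /F offset_affine.
  split; last by apply: row5P; rewrite row5E ?HF ?bF ?chart_mxE ?chart_offE.
  split; last by rewrite /= HF chart_mxE.
  by apply: ants_affine => //; rewrite det22 !chart_mxE; field.
- move=> q [Mq /= q0]; split; first by rewrite row5E.
  rewrite /F (_ : chart_mx (G q) = H q); last first.
    have := det_Qm A0 Mp Mq; rewrite det22 -/(H q) => D.
    apply/matrixP; apply: ord2P; apply: ord2P; rewrite chart_mxE !row5E //.
    by rewrite -D; field.
  rewrite (_ : chart_off (G q) = b q) -?affine_dec //.
  by apply/rowP; apply: ord2P; rewrite chart_offE row5E.
Qed.

End Chart.

Section AffineFields.
Context {R : realType}.
Local Notation V := 'M[R]_(3, 2).
Local Notation fV := (@fin_dim_mx R 3 2).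
Local Notation f5 := (@fin_dim_mx R 1 5).
Variables (A : R) (A0 : A != 0) (U : set V) (hU : open_in (ants_manifold A) U).
Local Notation D := (@ants_distribution R).

Lemma ix3S : (@ix 2 1 + 1 = ix 2) * (@ix 2 2 + 1 = ix 3) * (@ix 2 3 + 1 = ix 1) *
  (@ix 2 1 + 2 = ix 3) * (@ix 2 2 + 2 = ix 1) * (@ix 2 3 + 2 = ix 2).
Proof. by do !split; apply: val_inj; rewrite /= /ix !inordK. Qed.

Lemma ix3_eq : ((@ix 2 1 == ix 2) = false) * ((@ix 2 1 == ix 3) = false) *
  ((@ix 2 2 == ix 1) = false) * ((@ix 2 2 == ix 3) = false) *
  ((@ix 2 3 == ix 1) = false) * ((@ix 2 3 == ix 2) = false).
Proof. by do !split; apply/eqP => /(congr1 val); rewrite /= /ix !inordK. Qed.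

Lemma distributionP (p v : V) : D p v <-> exists s t : R, v = fr (row5 0 0 0 s t) *m p.
Proof.
have E s t : s *: (Zfield (ix 1) p - Zfield (ix 2) p) + t *: (Zfield (ix 3) p - Zfield (ix 1) p)
   = fr (row5 0 0 0 s t) *m p.
  apply/matrixP => i j; rewrite frE; move: i.
  by apply: ord3P; rewrite !fr_entries !row5E !mxE !ix3S ?eqxx ?ix3_eq; ring.
by split=> -[s [t ->]]; exists s, t; rewrite ?E.
Qed.

(** The transposes make [a] act on points written as rows. The minus sign turns the
    anti-homomorphism from a Lie algebra to its fundamental vector fields into a homomorphism. *)
Definition aff (a : 'M[R]_2 * 'cV[R]_2) (p : V) : V := - (p *m a.1^T + ones *m a.2^T).

Lemma aff_smooth (N : set V) a : smooth_on N (aff a).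
Proof.
apply: smooth_onN; apply: smooth_onD; last exact: smooth_on_cst.
by apply: mulmx_smooth; [exact: smooth_on_id|exact: smooth_on_cst].
Qed.

Lemma aff_tangent a p : sl2R2 a -> U p -> tangent U p (aff a p).
Proof.
move=> a0 Up; apply/(tangentP A0 hU _ Up).
rewrite /aff (_ : - _ = p *m (- a.1^T) + ones *m (- a.2^T)); last first.
  by rewrite !mulmxN opprD.
by rewrite ddt_affine_field linearN /= mxtrace_tr a0 oppr0 mulr0.
Qed.

Lemma aff_vfield a : sl2R2 a -> vfield U (aff a).
Proof. by move=> a0; split=> [|p]; [exact: aff_smooth|exact: aff_tangent]. Qed.

Lemma dif_aff a p v : U p -> tangent U p v -> dif U (aff a) p v = - (v *m a.1^T).
Proof.
move=> Up tv; have sm : smooth_on U (fun q : V => q *m a.1^T).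
  by apply: mulmx_smooth; [exact: smooth_on_id|exact: smooth_on_cst].
have sc := @smooth_on_cst _ _ _ U (ones *m a.2^T).
rewrite (difN fV Up tv fV (smooth_onD sm sc)) (difD fV Up tv fV sm sc).
rewrite (dif_cst fV Up tv _ fV) addr0.
rewrite (mulmx_dif fV Up tv (@smooth_on_id _ _ U) (@smooth_on_cst _ _ _ U a.1^T)).
rewrite (dif_id fV Up tv) (dif_cst fV Up tv) ?mulmx0 ?addr0 //.
exact: fin_dim_mx.
Qed.

(** As [aff a] commutes with the frame, the bracket only differentiates the coordinates of the other
    field; vanishing coordinates stay zero, so sections of [D] are preserved. *)
Lemma lie_aff_fld a (z : V -> 'rV[R]_5) p : sl2R2 a -> U p -> smooth_on U z ->
  lie U (aff a) (fld z) p = fr (dif U z p (aff a p)) *m p.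
Proof.
move=> a0 Up sz; have ta := aff_tangent a0 Up; have tz := fr_tangent A0 hU z Up.
have e1 := dif_fld sz Up ta; have e2 := dif_aff a Up tz.
rewrite [LHS](congr2 (fun s t => s - t) e1 e2) {2}/aff mulmxN fr_affine opprK /fld.
by rewrite -addrA addNr addr0.
Qed.

Lemma section_fld Z : section_of U D Z -> exists z, [/\ smooth_on U z,
  (forall p, U p -> Z p = fld z p) &
  forall p, U p -> [/\ cf (z p) 1 = 0, cf (z p) 2 = 0 & cf (z p) 3 = 0]].
Proof.
move=> [vZ DZ]; have [sz Ez] := fld_of A0 hU vZ; exists (fun p => co p (Z p)); split=> // p Up.
have [s [t ->]] := (distributionP _ _).1 (DZ p Up).
by rewrite co_fr ?row5E //; exact: (openin_dt A0 hU).
Qed.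

Lemma dif_cf0 (z : V -> 'rV[R]_5) k p v : smooth_on U z -> U p -> tangent U p v ->
  (forall q, U q -> cf (z q) k = 0) -> cf (dif U z p v) k = 0.
Proof.
move=> sz Up tv z0; have e := dif_mx fV Up tv 0 (ix k) sz.
rewrite -e; have sk : smooth_on U (fun q => cf (z q) k) by move/smooth_on_mxP: sz; apply.
exact: (etrans (dif_eq fV Up tv fin_dim_R sk z0) (dif_cst fV Up tv _ fin_dim_R)).
Qed.

Lemma aff_symmetry a : sl2R2 a -> symmetry_field U D (aff a).
Proof.
move=> a0; have va := aff_vfield a0; split=> // Z sZ.
have [z [sz EZ z0]] := section_fld sZ; split; first exact: (lie_vfield A0 hU va sZ.1).
move=> p Up; have ta := aff_tangent a0 Up.
rewrite (lie_eq va sZ.1 (fun q _ => erefl) EZ Up) lie_aff_fld //.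
apply/distributionP; exists (cf (dif U z p (aff a p)) 4), (cf (dif U z p (aff a p)) 5).
congr (fr _ *m p); apply: row5P; rewrite row5E //.
- by apply: dif_cf0 => // q /z0[].
- by apply: dif_cf0 => // q /z0[].
- by apply: dif_cf0 => // q /z0[].
Qed.

Lemma aff_lie a b p : sl2R2 a -> sl2R2 b -> U p ->
  aff (sl2R2_bracket a b) p = lie U (aff a) (aff b) p.
Proof.
move=> a0 b0 Up; have ta := aff_tangent a0 Up; have tb := aff_tangent b0 Up.
rewrite [RHS](congr2 (fun s t => s - t) (dif_aff b Up ta) (dif_aff a Up tb)).
rewrite /aff /sl2R2_bracket /= !linearB /= !trmx_mul.
rewrite ?mulNmx ?mulmxDl ?mulmxBr ?mulmxA ?opprD ?opprK.
move: (p *m b.1^T *m a.1^T) (p *m a.1^T *m b.1^T).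
move: (ones *m b.2^T *m a.1^T) (ones *m a.2^T *m b.1^T) => x y z t.
by apply/matrixP => i j; rewrite !mxE; ring.
Qed.

End AffineFields.

Section SymmetryAlgebra.
Context {R : realType}.
Local Notation V := 'M[R]_(3, 2).
Local Notation fV := (@fin_dim_mx R 3 2).
Local Notation f5 := (@fin_dim_mx R 1 5).
Variables (A : R) (A0 : A != 0) (U : set V) (hU : open_in (ants_manifold A) U).
Local Notation D := (@ants_distribution R).

Lemma frame_section k (x : R * R) : ev k = row5 0 0 0 x.1 x.2 ->
  section_of U D (fld (fun=> ev k)).
Proof.
move=> E; split; first exact: (ev_vfield A0 hU).
by move=> p Up; apply/distributionP; exists x.1, x.2; rewrite -E.
Qed.

(** The sections [E_4] and [E_5] of [D], bracketed with a symmetry, give exactly the two vanishing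
    hypotheses of the prolongation. *)
Lemma symmetry_commutes X : symmetry_field U D X -> forall p k, U p -> (0 < k <= 5)%N ->
  br U (fun q => co q (X q)) (fun=> ev k) p = 0.
Proof.
move=> [vX symX]; have [sx EX] := fld_of A0 hU vX; set x := fun q => co q (X q) in sx EX *.
have H (k : nat) (c : R * R) p : ev k = row5 0 0 0 c.1 c.2 -> U p ->
   [/\ dev U x k 1 p = 0, dev U x k 2 p = 0 & dev U x k 3 p = 0].
  move=> ek Up; have sk := frame_section ek.
  have [_ /(_ p Up)] := symX _ sk.
  rewrite (lie_eq vX sk.1 EX (fun q _ => erefl) Up) (lie_fld A0 hU sx (@smooth_on_cst _ _ _ U _) Up).
  move=> /distributionP[s [t E]].
  have p0 := openin_dt A0 hU Up.
  have {}E : br U x (fun=> ev k) p = row5 0 0 0 s t.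
    by rewrite -(co_fr (br U x (fun=> ev k) p) p0) -(co_fr (row5 0 0 0 s t) p0) -E.
  by rewrite /dev E !row5E.
have Z := @prolongation_zero R V U (smooth_on U) (De U) (dev U x)
  (De_lin A0 hU) (De_zero A0 hU) (De_comm A0 hU) (dev_smooth A0 hU sx) (dev_eq A0 hU sx)
  (fun p => H 4%N (1, 0) p erefl) (fun p => H 5%N (0, 1) p erefl).
move=> p k Up k5; apply: row5P; rewrite [RHS]mxE; exact: Z.
Qed.

Lemma Qm_smooth : smooth_on U (@Qm R).
Proof.
have sp i k : smooth_on U (fun p : V => p i k).
  by have /smooth_on_mxP := @smooth_on_id _ V U; apply.
have sd : smooth_on U (fun p => (dt p)^-1).
  by apply: smooth_onV; [exact: (openin_dt A0 hU)|exact: smooth_dt].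
have s i j k l : smooth_on U (fun p : V => (p i j - p k l) / dt p).
  by apply: smooth_onM => //; apply: smooth_onB.
apply/smooth_on_mxP; apply: ord2P; apply: ord3P;
  by apply: smooth_on_eq (s _ _ _ _) => p _; rewrite QmE.
Qed.

Lemma tangent_dif0 (f : V -> R) : smooth_on U f ->
  (forall p k, U p -> (0 < k <= 5)%N -> De U k f p = 0) ->
  forall p v, U p -> tangent U p v -> dif U f p v = 0.
Proof.
move=> sf H p v Up tv; rewrite -(fld_co A0 hU Up tv).
have := ev_expand (co p v) (dif_fr_linear Up sf).
rewrite /= => ->.
have h k : (0 < k <= 5)%N -> dif U f p (fr (ev k) *m p) = 0 by exact: H.
by rewrite (h 1%N) // (h 2%N) // (h 3%N) // (h 4%N) // (h 5%N) // !scaler0 !addr0.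
Qed.

(** Write [X = p a + ones b] with matrix functions [a], [b]. As constant affine fields commute with
    [E_k], the equation [[X, E_k] = 0] says that [p da + ones db] vanishes along [E_k]; hence so do
    [da] and [db], and connectedness makes [a], [b] constant. *)
Lemma symmetry_affine X : U !=set0 -> connected U -> symmetry_field U D X ->
  exists a, sl2R2 a /\ forall p, U p -> X p = aff a p.
Proof.
move=> [p0 Up0] cU symX; have [vX _] := symX; have C := symmetry_commutes symX.
have [sX tX] := vX; have [sx EX] := fld_of A0 hU vX.
pose a (p : V) : 'M[R]_2 := Qm p *m X p; pose b (p : V) : 'rV[R]_2 := offset p (X p).
have sa : smooth_on U a by apply: mulmx_smooth => //; exact: Qm_smooth.
have sb : smooth_on U b.
  apply/smooth_on_mxP => i j; rewrite ord1.
  apply: (@smooth_on_eq _ _ _ _ (fun q : V => (X q - q *m a q) (ix 1) j)).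
    by move=> q _; rewrite [RHS]mxE.
  have s : smooth_on U (fun q => X q - q *m a q).
    by apply: smooth_onB => //; apply: mulmx_smooth => //; exact: smooth_on_id.
  by move/smooth_on_mxP: s; apply.
have Xab p : U p -> X p = p *m a p + ones *m b p.
  by move=> Up; apply: affine_dec; exact: (openin_dt A0 hU).
have key p k : U p -> (0 < k <= 5)%N ->
    dif U a p (fr (ev k) *m p) = 0 /\ dif U b p (fr (ev k) *m p) = 0.
  move=> Up k5; have tk := fr_tan A0 hU (ev k) Up.
  have vk := ev_vfield A0 hU k.
  have spa : smooth_on U (fun q : V => q *m a q).
    by apply: mulmx_smooth => //; exact: smooth_on_id.
  have sob : smooth_on U (fun q : V => ones *m b q).
    by apply: mulmx_smooth => //; exact: smooth_on_cst.
  have e1 := dif_eq fV Up tk fV sX Xab.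
  have e2 := difD fV Up tk fV spa sob.
  have e3 := mulmx_dif fV Up tk (@smooth_on_id _ _ U) sa.
  have e4 := mulmx_dif fV Up tk (@smooth_on_cst _ _ _ U ones) sb.
  rewrite (dif_id fV Up tk) in e3.
  rewrite (dif_cst fV Up tk _ (fin_dim_mx 3 1)) mul0mx add0r in e4.
  have dX := etrans e1 (etrans e2 (congr2 (fun s t => s + t) e3 e4)).
  have dE := dif_fld (@smooth_on_cst _ _ _ U (ev k)) Up (tX p Up).
  rewrite (dif_cst fV Up (tX p Up) _ f5) linear0 mul0mx add0r in dE.
  have L : lie U X (fld (fun=> ev k)) p = 0.
    rewrite (lie_eq vX vk EX (fun q _ => erefl) Up).
    rewrite (lie_fld A0 hU sx (@smooth_on_cst _ _ _ U _) Up) /fld (C p k Up k5).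
    by rewrite linear0 mul0mx.
  have E := etrans (esym (congr2 (fun s t => s - t) dE dX)) L.
  rewrite /= (Xab p Up) fr_affine in E.
  apply: (affine_inj (openin_dt A0 hU Up)).
  move: E; rewrite -addrA opprD addNKr => /eqP; rewrite oppr_eq0 => /eqP.
  exact.
have const (f : V -> R) : smooth_on U f ->
   (forall p k, U p -> (0 < k <= 5)%N -> De U k f p = 0) -> forall p, U p -> f p = f p0.
  move=> sf H p Up; apply: (locally_constant cU) => // q Uq.
  apply: (dif0_locally_constant fV (ants_submanifold A0) hU Uq sf).
  exact: tangent_dif0.
have ca p : U p -> a p = a p0.
  move=> Up; apply/matrixP => i j.
  apply: (const (fun q => a q i j)) => //; first by move/smooth_on_mxP: sa; apply.
  move=> q k Uq k5; have tk := fr_tan A0 hU (ev k) Uq.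
  have e := dif_mx fV Uq tk i j sa; rewrite (key q k Uq k5).1 mxE in e; exact: e.
have cb p : U p -> b p = b p0.
  move=> Up; apply/matrixP => i j.
  apply: (const (fun q => b q i j)) => //; first by move/smooth_on_mxP: sb; apply.
  move=> q k Uq k5; have tk := fr_tan A0 hU (ev k) Uq.
  have e := dif_mx fV Uq tk i j sb; rewrite (key q k Uq k5).2 mxE in e; exact: e.
(* Undoes the sign and the transposes in [aff]. *)
exists (- (a p0)^T, - (b p0)^T); split.
  rewrite /sl2R2 /= linearN /= mxtrace_tr.
  have := (tangentP A0 hU (X p0) Up0).1 (tX p0 Up0).
  rewrite (Xab p0 Up0) ddt_affine_field => /eqP; rewrite mulf_eq0.
  by rewrite (negbTE (openin_dt A0 hU Up0)) /= => /eqP ->; rewrite oppr0.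
move=> p Up; rewrite (Xab p Up) (ca p Up) (cb p Up) /aff /=.
have tN m n (x : 'M[R]_(m, n)) : (- x^T)^T = - x by rewrite linearN /= trmxK.
by rewrite !tN !mulmxN -opprD opprK.
Qed.

Lemma symmetry_algebra : U !=set0 -> connected U ->
  lie_isomorphic (@sl2R2 R) (@sl2R2_bracket R) U [set X | symmetry_field U D X].
Proof.
move=> U0 cU; exists (@aff R); split.
- by move=> a a0; exact: (aff_symmetry A0 hU a0).
- move=> c a b a0 b0 p Up; rewrite /aff /=.
  have tP m n (x y : 'M[R]_(m, n)) : (c *: x + y)^T = c *: x^T + y^T by rewrite linearP.
  rewrite !tP !mulmxDr -!scalemxAr.
  move: (p *m a.1^T) (p *m b.1^T) (ones *m a.2^T) (ones *m b.2^T) => x y z t.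
  by apply/matrixP => i j; rewrite !mxE; ring.
- by move=> a b a0 b0 p Up; exact: (aff_lie A0 hU).
- move=> [a1 a2] a0 H; have [p Up] := U0.
  have := H p Up; rewrite /aff /= => /eqP; rewrite oppr_eq0 => /eqP.
  move=> /(affine_inj (openin_dt A0 hU Up))[/(congr1 trmx) + /(congr1 trmx)].
  by rewrite !trmxK !linear0 => -> ->.
- by move=> X symX; exact: symmetry_affine.
Qed.

End SymmetryAlgebra.

(** * Homogeneity and the group model *)

Section Homogeneity.
Context {R : realType}.
Local Notation V := 'M[R]_(3, 2).
Local Notation fV := (@fin_dim_mx R 3 2).
Local Notation f5 := (@fin_dim_mx R 1 5).
Variables (A : R) (A0 : A != 0).
Local Notation M := (@ants_manifold R A).
Local Notation D := (@ants_distribution R).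

Lemma open_in_refl (W : normedModType R) (N : set W) : open_in N N.
Proof. by exists setT; [exact: openT|rewrite setIT]. Qed.

Let hM := @open_in_refl _ M.

Definition affmap (h : 'M[R]_2) (b : 'rV[R]_2) (p : V) : V := p *m h + ones *m b.

Lemma affmap_smooth (N : set V) h b : smooth_on N (affmap h b).
Proof.
apply: smooth_onD; last exact: smooth_on_cst.
by apply: mulmx_smooth; [exact: smooth_on_id|exact: smooth_on_cst].
Qed.

Lemma dif_affmap (N : set V) h b p v : N p -> tangent N p v -> dif N (affmap h b) p v = v *m h.
Proof.
move=> Np tv; have sm : smooth_on N (fun q : V => q *m h).
  by apply: mulmx_smooth; [exact: smooth_on_id|exact: smooth_on_cst].
have sc := @smooth_on_cst _ _ _ N (ones *m b).
rewrite (difD fV Np tv fV sm sc) (dif_cst fV Np tv _ fV) addr0.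
rewrite (mulmx_dif fV Np tv (@smooth_on_id _ _ N) (@smooth_on_cst _ _ _ N h)).
by rewrite (dif_id fV Np tv) (dif_cst fV Np tv _ (fin_dim_mx 2 2)) mulmx0 addr0.
Qed.

Lemma affmap_comp h b h' b' p :
  affmap h' b' (affmap h b p) = affmap (h *m h') (b *m h' + b') p.
Proof. by rewrite /affmap mulmxDl !mulmxDr !mulmxA addrA. Qed.

Lemma affmap1 p : affmap 1%:M 0 p = p.
Proof. by rewrite /affmap mulmx1 mulmx0 addr0. Qed.

Lemma affmap_equiv h b : \det h = 1 -> dist_equiv M D M D (affmap h b).
Proof.
move=> h1; have uh : h \in unitmx by rewrite unitmxE h1 unitr1.
split.
  exists (affmap (invmx h) (- (b *m invmx h))).
  split; [exact: affmap_smooth|exact: affmap_smooth| |].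
  - move=> x Mx; split; first exact: ants_affine.
    by rewrite affmap_comp mulmxV // subrr affmap1.
  - move=> x Mx; split; first by apply: ants_affine => //; rewrite det_inv h1 invr1.
    by rewrite affmap_comp mulVmx // mulNmx -mulmxA mulVmx // mulmx1 addNr affmap1.
move=> p Mp; apply/seteqP; split=> v.
  move=> /distributionP[s [t ->]]; exists (fr (row5 0 0 0 s t) *m p).
    by apply/distributionP; exists s, t.
  by rewrite dif_affmap // ?fr_affine //; exact: (fr_tan A0 hM).
move=> [u /distributionP[s [t ->]] <-]; apply/distributionP; exists s, t.
by rewrite dif_affmap // ?fr_affine //; exact: (fr_tan A0 hM).
Qed.

Lemma ants_homogeneous : homogeneous M D.
Proof.
split=> [p q Mp Mq|p v Mp tv]; have p0 := ants_dt_neq0 A0 Mp.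
  exists (affmap (Qm p *m q) (offset p q)); split.
    by apply: affmap_equiv; exact: (det_Qm A0).
  by rewrite -/(affmap _ _ _) /affmap -affine_dec.
have tr0 : \tr (Qm p *m v) = 0.
  have := (tangentP A0 hM v Mp).1 tv.
  rewrite {1}(affine_dec v p0) ddt_affine_field => /eqP; rewrite mulf_eq0 (negbTE p0) /=.
  by move/eqP.
exists (aff (- (Qm p *m v)^T, - (offset p v)^T)); split.
  by apply: (aff_symmetry A0 hM); rewrite /sl2R2 /= linearN /= mxtrace_tr tr0 oppr0.
have tN m n (x : 'M[R]_(m, n)) : (- x^T)^T = - x by rewrite linearN /= trmxK.
by rewrite /aff /= !tN !mulmxN -opprD opprK -affine_dec.
Qed.

(* [4 + i] lists the indices 4, 5 of the frame of D, [3 + i] those of its derived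
   distribution, [1 + i] all of them. *)
Definition frk (m n : nat) (i : 'I_n) (p : V) : V := fr (ev (m + i)) *m p.

Lemma frk_vfield (U : set V) m n (i : 'I_n) : open_in M U -> vfield U (frk m i).
Proof. by move=> hU; exact: (ev_vfield A0 hU (m + i)). Qed.

Lemma frk_sum4 (c : 'I_2 -> R) p :
  \sum_i c i *: frk 4 i p = fr (row5 0 0 0 (c (ix 1)) (c (ix 2))) *m p.
Proof.
rewrite sum2 /frk /ix !inordK //= !scalemxAl -mulmxDl; congr (_ *m p).
rewrite -!linearZ -frD; congr fr.
by apply: row5P; rewrite !mxE /ix !inordK //=; ring.
Qed.

Lemma frk_sum3 (c : 'I_3 -> R) p :
  \sum_i c i *: frk 3 i p = fr (row5 0 0 (c (ix 1)) (c (ix 2)) (c (ix 3))) *m p.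
Proof.
rewrite sum3 /frk /ix !inordK //= !scalemxAl -!mulmxDl; congr (_ *m p).
rewrite -!linearZ -!frD; congr fr.
by apply: row5P; rewrite !mxE /ix !inordK //=; ring.
Qed.

Lemma frk_sum1 (c : 'I_5 -> R) p :
  \sum_i c i *: frk 1 i p
  = fr (row5 (c (ix 1)) (c (ix 2)) (c (ix 3)) (c (ix 4)) (c (ix 5))) *m p.
Proof.
rewrite sum5 /frk /ix !inordK //= !scalemxAl -!mulmxDl; congr (_ *m p).
rewrite -!linearZ -!frD; congr fr.
by apply: row5P; rewrite !mxE /ix !inordK //=; ring.
Qed.

Lemma frmul_inj (x : 'rV[R]_5) p : dt p != 0 -> fr x *m p = 0 -> x = 0.
Proof.
move=> p0 E; rewrite -(co_fr x p0) E -(mul0mx _ p) -[0 in LHS](linear0 fr).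
exact: co_fr.
Qed.

Lemma row5_eq0 (a b c d e : R) : row5 a b c d e = 0 -> [/\ a = 0, b = 0, c = 0, d = 0 & e = 0].
Proof.
move=> E; have h k : cf (row5 a b c d e) k = 0 by rewrite E mxE.
by have := h 1%N; have := h 2%N; have := h 3%N; have := h 4%N; have := h 5%N; rewrite !row5E.
Qed.

Lemma frk_independent4 p : dt p != 0 -> independent ((@frk 4 2)^~ p).
Proof.
move=> p0 c; rewrite frk_sum4 => /(frmul_inj p0) /row5_eq0[_ _ _ c1 c2].
by apply: ord2P.
Qed.

Lemma frk_independent3 p : dt p != 0 -> independent ((@frk 3 3)^~ p).
Proof.
move=> p0 c; rewrite frk_sum3 => /(frmul_inj p0) /row5_eq0[_ _ c1 c2 c3].
by apply: ord3P.
Qed.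

Lemma frk_independent1 p : dt p != 0 -> independent ((@frk 1 5)^~ p).
Proof.
move=> p0 c; rewrite frk_sum1 => /(frmul_inj p0) /row5_eq0[c1 c2 c3 c4 c5].
by apply: ord5P.
Qed.

Lemma distribution_span p : D p = span_fam ((@frk 4 2)^~ p).
Proof.
apply/seteqP; split=> v.
  move=> /distributionP[s [t ->]]; exists (fun i => nth 0 [:: s; t] i).
  by rewrite frk_sum4 /ix !inordK.
by move=> [c ->]; rewrite frk_sum4; apply/distributionP; exists (c (ix 1)), (c (ix 2)).
Qed.

Lemma span_set_closed (S T : set V) : (forall v, S v -> T v) -> T 0 ->
  (forall (c : R) u v, T u -> T v -> T (c *: u + v)) -> forall v, span_set S v -> T v.
Proof.
move=> ST T0 Tl v [k [b [Sb [c ->]]]].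
by apply: (big_ind T) => // [x y Tx Ty|i _];
  [rewrite -(scale1r x); exact: Tl|rewrite -[_ *: _]addr0; apply: Tl => //; apply: ST].
Qed.

Lemma derived_ants p : M p -> derived M D p = span_fam ((@frk 3 3)^~ p).
Proof.
move=> Mp; have p0 := ants_dt_neq0 A0 Mp; apply/seteqP; split.
- apply: span_set_closed.
  + move=> v [U [Z [Z' [hU Up sZ sZ' E]]]].
    suff [y1 [y2 [y3 ->]]] : exists y1 y2 y3, v = fr (row5 0 0 y1 y2 y3) *m p.
      exists (fun i => nth 0 [:: y1; y2; y3] i); by rewrite frk_sum3 /ix !inordK.
    have [z [sz EZ z0]] := section_fld A0 hU sZ; have [z' [sz' EZ' z'0]] := section_fld A0 hU sZ'.
    case: E => ->.
      have [s [t ->]] := (distributionP _ _).1 (sZ.2 p Up).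
      by exists 0, s, t.
    rewrite (lie_eq sZ.1 sZ'.1 EZ EZ' Up) (lie_fld A0 hU sz sz' Up) /fld.
    (* On vectors whose first three coordinates vanish, [cb] only has a third component, and
       derivatives of vanishing coordinates vanish: the bracket has no component along [E_1],
       [E_2]. *)
    set y := br U z z' p; exists (cf y 3), (cf y 4), (cf y 5).
    congr (fr _ *m p); apply: row5P; rewrite row5E // /y /br.
      have h k := (fr_tangent A0 hU z Up, fr_tangent A0 hU z' Up).
      have [a1 a2 a3] := z0 p Up; have [b1 b2 b3] := z'0 p Up.
      have d1 : cf (dif U z' p (fld z p)) 1 = 0.
        by apply: dif_cf0 => // [|q /z'0[]//]; exact: (fr_tangent A0 hU).
      have d2 : cf (dif U z p (fld z' p)) 1 = 0.
        by apply: dif_cf0 => // [|q /z0[]//]; exact: (fr_tangent A0 hU).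
      have d3 : cf (cb (z p) (z' p)) 1 = 0 by rewrite row5E a1 a2 a3 b1 b2 b3; ring.
      move: d1 d2 d3; move: (dif _ _ _ _) (dif _ _ _ _) (cb _ _) => u w x d1 d2 d3.
      by rewrite !mxE d1 d2 d3 subrr addr0.
    have [a1 a2 a3] := z0 p Up; have [b1 b2 b3] := z'0 p Up.
    have d1 : cf (dif U z' p (fld z p)) 2 = 0.
      by apply: dif_cf0 => // [|q /z'0[]//]; exact: (fr_tangent A0 hU).
    have d2 : cf (dif U z p (fld z' p)) 2 = 0.
      by apply: dif_cf0 => // [|q /z0[]//]; exact: (fr_tangent A0 hU).
    have d3 : cf (cb (z p) (z' p)) 2 = 0 by rewrite row5E a1 a2 a3 b1 b2 b3; ring.
    move: d1 d2 d3; move: (dif _ _ _ _) (dif _ _ _ _) (cb _ _) => u w x d1 d2 d3.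
    by rewrite !mxE d1 d2 d3 subrr addr0.
  + by exists (fun=> 0); rewrite big1 // => i _; rewrite scale0r.
  + move=> c u v [a ->] [b ->]; exists (fun i => c * a i + b i).
    rewrite scaler_sumr -big_split /=; apply: eq_bigr => i _.
    by rewrite scalerDl scalerA.
- move=> v [c ->].
  have s4 := @frame_section _ _ A0 M hM 4 (1, 0) erefl.
  have s5 := @frame_section _ _ A0 M hM 5 (0, 1) erefl.
  pose w : 'I_3 -> V := fun i => nth 0 [:: lie M (fld (fun=> ev 4)) (fld (fun=> ev 5)) p;
     fld (fun=> ev 4) p; fld (fun=> ev 5) p] i.
  exists 3%N, w; split.
    apply: ord3P; rewrite /w /ix inordK //=.
    + by exists M, (fld (fun=> ev 4)), (fld (fun=> ev 5)); split=> //; right.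
    + by exists M, (fld (fun=> ev 4)), (fld (fun=> ev 5)); split=> //; left.
    + by exists M, (fld (fun=> ev 5)), (fld (fun=> ev 5)); split=> //; left.
  (* The sign comes from [[E_4, E_5] = - E_3]. *)
  exists (fun i => nth 0 [:: - c (ix 1); c (ix 2); c (ix 3)] i).
  rewrite frk_sum3 sum3 /w /ix !inordK //=.
  rewrite (lie_fld A0 hM (@smooth_on_cst _ _ _ M _) (@smooth_on_cst _ _ _ M _) Mp) /fld.
  rewrite (br_cst A0 hM) // !scalemxAl -!mulmxDl; congr (_ *m p).
  rewrite -!linearZ -!frD; congr fr; rewrite cb_ev_ev.
  by apply: row5P; rewrite !mxE /ix !inordK //=; ring.
Qed.

Lemma derived2_ants p : M p -> derived M (derived M D) p = span_fam ((@frk 1 5)^~ p).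
Proof.
move=> Mp; have p0 := ants_dt_neq0 A0 Mp; apply/seteqP; split.
- apply: span_set_closed.
  + move=> v [U [Z [Z' [hU Up [vZ _] [vZ' _] E]]]].
    have [x ->] : exists x, v = fr x *m p.
      case: E => ->; last first.
        have [_ t] := lie_vfield A0 hU vZ vZ'.
        by exists (co p (lie U Z Z' p)); rewrite (fld_co A0 hU Up) //; exact: t.
      by exists (co p (Z p)); rewrite (fld_co A0 hU Up) //; exact: vZ.2.
    exists (fun i => x 0 i); rewrite frk_sum1; congr (fr _ *m p).
    by apply: row5P; rewrite row5E.
  + by exists (fun=> 0); rewrite big1 // => i _; rewrite scale0r.
  + move=> c u v [a ->] [b ->]; exists (fun i => c * a i + b i).
    rewrite scaler_sumr -big_split /=; apply: eq_bigr => i _.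
    by rewrite scalerDl scalerA.
- move=> v [c ->].
  have sec (i : 'I_3) : section_of M (derived M D) (fld (fun=> ev (3 + i))).
    split; first exact: (ev_vfield A0 hM).
    move=> q Mq; rewrite derived_ants //; exists (fun j => (j == i)%:R).
    rewrite (bigD1 i) //= eqxx scale1r big1 ?addr0 // => j /negbTE ->.
    by rewrite scale0r.
  have s3 := sec (ix 1); have s4 := sec (ix 2); have s5 := sec (ix 3).
  rewrite /ix !inordK //= in s3 s4 s5.
  pose w : 'I_5 -> V := fun i => nth 0 [:: lie M (fld (fun=> ev 3)) (fld (fun=> ev 4)) p;
     lie M (fld (fun=> ev 3)) (fld (fun=> ev 5)) p;
     fld (fun=> ev 3) p; fld (fun=> ev 4) p; fld (fun=> ev 5) p] i.
  exists 5%N, w; split.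
    apply: ord5P; rewrite /w /ix inordK //=.
    + by exists M, (fld (fun=> ev 3)), (fld (fun=> ev 4)); split=> //; right.
    + by exists M, (fld (fun=> ev 3)), (fld (fun=> ev 5)); split=> //; right.
    + by exists M, (fld (fun=> ev 3)), (fld (fun=> ev 4)); split=> //; left.
    + by exists M, (fld (fun=> ev 4)), (fld (fun=> ev 5)); split=> //; left.
    + by exists M, (fld (fun=> ev 5)), (fld (fun=> ev 5)); split=> //; left.
  (* Inverts [[E_3, E_4] = - E_1 + 11/10 E_4 + 11/5 E_5] and [[E_3, E_5] = - E_2 - 11/5 E_4 - 11/10
     E_5]. *)
  exists (fun i => nth 0 [:: - c (ix 1); - c (ix 2); c (ix 3);
    c (ix 4) + 11 / 10 * c (ix 1) - 11 / 5 * c (ix 2);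
    c (ix 5) + 11 / 5 * c (ix 1) - 11 / 10 * c (ix 2)] i).
  rewrite frk_sum1 sum5 /w /ix !inordK //=.
  have L i j := lie_fld A0 hM (@smooth_on_cst _ _ _ M (ev i)) (@smooth_on_cst _ _ _ M (ev j)) Mp.
  rewrite (L 3%N 4%N) (L 3%N 5%N) /fld.
  rewrite !(br_cst A0 hM) // !scalemxAl -!mulmxDl; congr (_ *m p).
  rewrite -!linearZ -!frD; congr fr; rewrite !cb_ev_ev.
  by apply: row5P; rewrite !mxE /ix !inordK //=; field.
Qed.

Lemma ants_is_235 : is_235 M D.
Proof.
split; first exact: ants_submanifold.
- move=> p Mp; exists M, (@frk 4 2); split=> //; first by move=> i; exact: frk_vfield.
  move=> q Mq; split; last exact: distribution_span.
  by apply: frk_independent4; exact: (ants_dt_neq0 A0).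
- move=> p Mp; have p0 := ants_dt_neq0 A0 Mp; split.
  + by exists ((@frk 4 2)^~ p); split; [exact: frk_independent4|exact: distribution_span].
  + by exists ((@frk 3 3)^~ p); split; [exact: frk_independent3|exact: derived_ants].
  + by exists ((@frk 1 5)^~ p); split; [exact: frk_independent1|exact: derived2_ants].
Qed.

End Homogeneity.

(** * The left-invariant model on the special affine group *)

Section GroupModel.
Context {R : realType}.
Local Notation V := 'M[R]_(3, 2).
Local Notation G := ('M[R]_2 * 'cV[R]_2)%type.
Local Notation fV := (@fin_dim_mx R 3 2).
Local Notation fG := (fin_dim_prod (@fin_dim_mx R 2 2) (@fin_dim_mx R 2 1)).
Variables (A : R) (A0 : A != 0).
Local Notation M := (@ants_manifold R A).
Local Notation D := (@ants_distribution R).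
Let hM := @open_in_refl R _ M.

(** A triangle of signed area [A] with its first vertex at the origin, so that the translation part
    of an affine image is its first row. *)
Definition base_pt : V := \matrix_(i, j) nth 0 (nth [::]
  [:: [:: 0; 0]; [:: 1; 0]; [:: 0; - (2 * A)]] i) j.

Lemma base_ptE : (en base_pt 1 1 = 0) * (en base_pt 1 2 = 0) * (en base_pt 2 1 = 1) *
  (en base_pt 2 2 = 0) * (en base_pt 3 1 = 0) * (en base_pt 3 2 = - (2 * A)).
Proof. by rewrite !mxE /ix !inordK. Qed.

Lemma dt_base : dt base_pt = - (2 * A).
Proof. by rewrite /dt !base_ptE; ring. Qed.

Lemma ants_base : M base_pt.
Proof. by rewrite /ants_manifold /= signed_areaE dt_base; field. Qed.

Let b0 : dt base_pt != 0. Proof. exact: (ants_dt_neq0 A0 ants_base). Qed.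

(** The orbit map of [base_pt], with transposes because the group acts on columns. Its inverse
    [of_pt] is linear on all matrices, hence is its own differential. *)
Definition to_pt (g : G) : V := base_pt *m g.1^T + ones *m g.2^T.
Definition of_pt (p : V) : G := ((Qm base_pt *m p)^T, (row (ix 1) p)^T).

Lemma offset_base p : offset base_pt p = row (ix 1) p.
Proof.
have r0 : row (ix 1) base_pt = 0 by apply/rowP; apply: ord2P; rewrite !mxE /ix !inordK.
by rewrite /offset linearB /= row_mul r0 mul0mx subr0.
Qed.

Lemma of_ptK p : to_pt (of_pt p) = p.
Proof. by rewrite /to_pt /of_pt /= !trmxK -offset_base -affine_dec. Qed.

Lemma to_ptK g : of_pt (to_pt g) = g.
Proof.
case: g => g1 g2; rewrite /of_pt -offset_base /to_pt /= Qm_affine // offset_affine //.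
by rewrite !trmxK.
Qed.

Lemma of_pt_linear : linear of_pt.
Proof.
move=> a p q; congr pair; rewrite /= -linearP; congr (_^T).
  by rewrite linearP.
by rewrite linearP.
Qed.

HB.instance Definition _ := GRing.isLinear.Build R V G _ of_pt of_pt_linear.

Lemma of_pt_smooth (N : set V) : smooth_on N of_pt.
Proof.
apply: smooth_on_pair; apply/smooth_on_mxP => i j.
  have s : smooth_on N (fun p => Qm base_pt *m p).
    by apply: mulmx_smooth; [exact: smooth_on_cst|exact: smooth_on_id].
  by apply: (@smooth_on_eq _ _ _ _ (fun p => (Qm base_pt *m p) j i)) => [p _|];
    [rewrite [RHS]mxE|move/smooth_on_mxP: s; apply].
by apply: (@smooth_on_eq _ _ _ _ (fun p : V => p (ix 1) i)) => [p _|];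
  [rewrite ord1 !mxE|have /smooth_on_mxP := @smooth_on_id _ V N; apply].
Qed.

Lemma of_pt_continuous : continuous of_pt.
Proof.
move=> p; have [+ _] := smooth_on_openP (@openT _) (@of_pt_smooth setT) 0%N.
by apply.
Qed.

Lemma tr_smooth (W : normedModType R) (N : set W) m n (f : W -> 'M[R]_(m, n)) :
  smooth_on N f -> smooth_on N (fun x => (f x)^T).
Proof.
move=> sf; apply/smooth_on_mxP => i j.
by apply: (@smooth_on_eq _ _ _ _ (fun x => f x j i)) => [x _|];
  [rewrite mxE|move/smooth_on_mxP: sf; apply].
Qed.

Lemma to_pt_smooth (N : set G) : smooth_on N to_pt.
Proof.
have s1 : smooth_on N (fun g : G => g.1^T).
  by apply: tr_smooth; apply: smooth_on_fst; exact: smooth_on_id.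
have s2 : smooth_on N (fun g : G => g.2^T).
  by apply: tr_smooth; apply: smooth_on_snd; exact: smooth_on_id.
apply: smooth_onD; apply: mulmx_smooth => //; exact: smooth_on_cst.
Qed.

Lemma to_pt_ants g : SL2R2 g -> M (to_pt g).
Proof. by move=> g1; apply: ants_affine; rewrite ?det_tr //; exact: ants_base. Qed.

Lemma of_pt_SL p : M p -> SL2R2 (of_pt p).
Proof. by move=> Mp; rewrite /SL2R2 /= det_tr; exact: (det_Qm A0 ants_base Mp). Qed.

Definition left_frame (x : 'rV[R]_5) (g : G) : G :=
  (g.1 *m (of_pt (fr x *m base_pt)).1, g.1 *m (of_pt (fr x *m base_pt)).2).

(** [E_x] is invariant under affine maps, so [of_pt] carries it to the left-invariant field whose
    value at the identity is the image of [fr x *m base_pt]. *)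
Lemma left_frameE x g : left_frame x g = of_pt (fr x *m to_pt g).
Proof.
rewrite /to_pt fr_affine /left_frame /of_pt /=; congr pair.
  have -> : Qm base_pt *m (fr x *m base_pt *m g.1^T) =
     Qm base_pt *m (fr x *m base_pt) *m g.1^T by rewrite !mulmxA.
  by rewrite [RHS]trmx_mul trmxK.
by rewrite [in RHS]row_mul [RHS]trmx_mul trmxK.
Qed.

Definition group_distribution (g : G) : set G :=
  [set v | exists s t : R, v = left_frame (row5 0 0 0 s t) g].

Lemma tangent_of_pt p v : M p -> tangent M p v -> tangent SL2R2 (of_pt p) (of_pt v).
Proof.
move=> Mp [ O [c [ oO O0 sc cM [c0 c1]]]]; exists O, (of_pt \o c); split=> //.
- by move=> k; apply: (Ck_linear oO of_pt_continuous (sc k)).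
- by move=> t /cM; exact: of_pt_SL.
- split; first by rewrite /= c0.
  have dc : derivable c 0 1 by exact: smooth_derivable sc.
  by rewrite derive1E (derive_linear of_pt_continuous dc).2 -derive1E c1.
Qed.

Lemma left_frame_tangent x g : SL2R2 g -> tangent SL2R2 g (left_frame x g).
Proof.
move=> g1; rewrite left_frameE -{1}(to_ptK g); have Mg := to_pt_ants g1.
by apply: tangent_of_pt => //; exact: (fr_tan A0 hM).
Qed.

Lemma left_frame_smooth (N : set G) x : smooth_on N (left_frame x).
Proof.
have s1 : smooth_on N (fun g : G => g.1) by apply: smooth_on_fst; exact: smooth_on_id.
by apply: smooth_on_pair; apply: mulmx_smooth => //; exact: smooth_on_cst.
Qed.

Lemma of_pt_inj p : of_pt p = 0 -> p = 0.
Proof. by move=> E; rewrite -(of_ptK p) E /to_pt /= !trmx0 !mulmx0 addr0. Qed.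

Lemma left_frame_sum (c : 'I_2 -> R) g :
  \sum_i c i *: left_frame (ev (4 + i)) g = left_frame (row5 0 0 0 (c (ix 1)) (c (ix 2))) g.
Proof.
rewrite left_frameE -frk_sum4 linear_sum; apply: eq_bigr => i _.
by rewrite left_frameE /frk linearZ.
Qed.

Lemma group_is_distribution : is_distribution SL2R2 2 group_distribution.
Proof.
move=> g g1; exists SL2R2, (fun i h => left_frame (ev (4 + i)) h); split=> //.
- exact: open_in_refl.
- by move=> i; split=> [|h h1]; [exact: left_frame_smooth|exact: left_frame_tangent].
move=> h h1; split=> [c|].
  rewrite left_frame_sum left_frameE => /of_pt_inj.
  have Mh := to_pt_ants h1.
  move=> /(frmul_inj (ants_dt_neq0 A0 Mh)) /row5_eq0[_ _ _ c1 c2].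
  by apply: ord2P.
apply/seteqP; split=> v.
  move=> [s [t ->]]; exists (fun i => nth 0 [:: s; t] i).
  by rewrite left_frame_sum /ix !inordK.
by move=> [c ->]; rewrite left_frame_sum; exists (c (ix 1)), (c (ix 2)).
Qed.

Lemma left_frame_mul x g h : SL2R2 h ->
  dif SL2R2 (SL2R2_mul g) h (left_frame x h) = left_frame x (SL2R2_mul g h).
Proof.
move=> h1; have tl := left_frame_tangent x h1.
(* Left translation by [g] is this linear map followed by a translation, so its differential is
   [L]. *)
pose L (k : G) : G := (g.1 *m k.1, g.1 *m k.2).
have Ll : linear L by move=> a k k'; congr pair; rewrite /= mulmxDr -scalemxAr.
pose LL : {linear G -> G} := HB.pack L (GRing.isLinear.Build _ _ _ _ _ Ll).
have sL (N : set G) : smooth_on N L.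
  have s1 : smooth_on N (fun g : G => g.1) by apply: smooth_on_fst; exact: smooth_on_id.
  have s2 : smooth_on N (fun g : G => g.2) by apply: smooth_on_snd; exact: smooth_on_id.
  by apply: smooth_on_pair; apply: mulmx_smooth => //; exact: smooth_on_cst.
have Lc : continuous LL.
  move=> k; have [+ _] := smooth_on_openP (@openT _) (sL setT) 0%N.
  by apply.
have e1 : dif SL2R2 (SL2R2_mul g) h (left_frame x h) =
    dif SL2R2 (fun k => L k + (0, g.2)) h (left_frame x h).
  apply: esym; apply: (dif_eq fG h1 tl fG); first exact: (smooth_onD (sL _) (@smooth_on_cst _ _ _ _ _)).
  by move=> k _; congr pair; rewrite /= ?addr0.
rewrite e1 (difD fG h1 tl fG (sL _) (@smooth_on_cst _ _ _ _ _)).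
rewrite (dif_cst fG h1 tl _ fG) addr0.
have e2 := dif_linear fG h1 tl (l := LL) fG fG Lc (@smooth_on_id _ _ _).
rewrite [LHS]e2 (dif_id fG h1 tl) /= /L /left_frame /=.
by congr pair; rewrite mulmxA.
Qed.

Lemma group_left_invariant : left_invariant group_distribution.
Proof.
move=> g h g1 h1; apply/seteqP; split=> v.
  move=> [s [t ->]]; exists (left_frame (row5 0 0 0 s t) h); first by exists s, t.
  exact: left_frame_mul.
by move=> [u [s [t ->]] <-]; exists s, t; exact: left_frame_mul.
Qed.

Lemma group_equivalent : locally_equivalent M D SL2R2 group_distribution.
Proof.
have E : dist_equiv M D SL2R2 group_distribution of_pt.
  split.
    exists to_pt; split; [exact: of_pt_smooth|exact: to_pt_smooth| |].
    - by move=> p Mp; split; [exact: of_pt_SL|exact: of_ptK].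
    - by move=> g g1; split; [exact: to_pt_ants|exact: to_ptK].
  move=> p Mp.
  have dE s t : dif M of_pt p (fr (row5 0 0 0 s t) *m p) = left_frame (row5 0 0 0 s t) (of_pt p).
    have tp := fr_tan A0 hM (row5 0 0 0 s t) Mp.
    have e := dif_linear fV Mp tp (l := of_pt) fV fG of_pt_continuous (@smooth_on_id _ _ _).
    by rewrite [LHS]e (dif_id fV Mp tp) left_frameE of_ptK.
  apply/seteqP; split=> v.
    move=> [s [t ->]]; exists (fr (row5 0 0 0 s t) *m p); last exact: dE.
    by apply/distributionP; exists s, t.
  by move=> [u /distributionP[s [t ->]] <-]; exists s, t; exact: dE.
by split=> [p Mp|g g1]; exists M, SL2R2, of_pt; split=> //; exact: open_in_refl.
Qed.

End GroupModel.

(** * Adapted coframes *)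

Section AdaptedCoframe.
Context {R : realType}.
Local Notation V := 'M[R]_(3, 2).
Local Notation fV := (@fin_dim_mx R 3 2).
Local Notation f5 := (@fin_dim_mx R 1 5).
Variables (A : R) (A0 : A != 0).
Local Notation M := (@ants_manifold R A).
Local Notation D := (@ants_distribution R).
Let hM := @open_in_refl R _ M.

Definition theta0 (i : 'I_5) (p v : V) : R := co p v 0 i.

(** Evaluated on the frame, the structure equations are linear in the components of the forms
    [Omega]; these coefficients are a constant solution. *)
Definition om (x : 'rV[R]_5) (a : 'I_7) : R :=
  let x1 := cf x 1 in let x2 := cf x 2 in let x3 := cf x 3 in
  let x4 := cf x 4 in let x5 := cf x 5 in
  nth 0 [:: 9 / 10 * x1 + 9 / 10 * x2 - 1 / 10 * x3 - x4 + x5;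
            9 / 10 * x1 - 9 / 5 * x2 + 1 / 5 * x3 + x4;
            9 / 5 * x1 - 9 / 10 * x2 - 1 / 5 * x3 + x5;
            - (9 / 10 * x1) - 9 / 10 * x2 + 1 / 10 * x3 + x4 - x5;
            243 / 200 * x2 + 9 / 5 * x4 - 9 / 10 * x5;
            - (243 / 200 * x1) - 9 / 10 * x4 + 9 / 5 * x5;
            81 / 20 * x3] a.

Lemma omE (x : 'rV[R]_5) :
  (om x (ix 1) = 9 / 10 * cf x 1 + 9 / 10 * cf x 2 - 1 / 10 * cf x 3 - cf x 4 + cf x 5) *
  (om x (ix 2) = 9 / 10 * cf x 1 - 9 / 5 * cf x 2 + 1 / 5 * cf x 3 + cf x 4) *
  (om x (ix 3) = 9 / 5 * cf x 1 - 9 / 10 * cf x 2 - 1 / 5 * cf x 3 + cf x 5) *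
  (om x (ix 4) = - (9 / 10 * cf x 1) - 9 / 10 * cf x 2 + 1 / 10 * cf x 3 + cf x 4 - cf x 5) *
  (om x (ix 5) = 243 / 200 * cf x 2 + 9 / 5 * cf x 4 - 9 / 10 * cf x 5) *
  (om x (ix 6) = - (243 / 200 * cf x 1) - 9 / 10 * cf x 4 + 9 / 5 * cf x 5) *
  (om x (ix 7) = 81 / 20 * cf x 3).
Proof. by rewrite /om /ix !inordK. Qed.

Lemma ord7P (P : 'I_7 -> Prop) : P (ix 1) -> P (ix 2) -> P (ix 3) -> P (ix 4) -> P (ix 5) ->
  P (ix 6) -> P (ix 7) -> forall i, P i.
Proof.
move=> P1 P2 P3 P4 P5 P6 P7 [[|[|[|[|[|[|[|//]]]]]]] H];
  [move: P1|move: P2|move: P3|move: P4|move: P5|move: P6|move: P7]; congr P; apply: val_inj;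
  by rewrite /= /ix inordK.
Qed.

Lemma om_linear (c : R) x y a : om (c *: x + y) a = c * om x a + om y a.
Proof. by move: a; apply: ord7P; rewrite !omE !cf_lin; ring. Qed.

Definition omega0 (a : 'I_7) (p v : V) : R := om (co p v) a.

Lemma co_linear (U : set V) p : open_in M U -> U p -> forall (c : R) u v,
  tangent U p u -> tangent U p v -> co p (c *: u + v) = c *: co p u + co p v.
Proof.
move=> hU Up c u v tu tv; have p0 := openin_dt A0 hU Up.
rewrite -{1}(fld_co A0 hU Up tu) -{1}(fld_co A0 hU Up tv) scalemxAl -mulmxDl.
by rewrite -linearZ -frD co_fr.
Qed.

Lemma theta0_form i : form1 M (theta0 i).
Proof.
split=> [p c u v Mp tu tv|X vX].
  by rewrite /theta0 (co_linear hM Mp) // !mxE.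
by have /smooth_on_mxP := co_smooth A0 hM vX.1; apply.
Qed.

Lemma omega0_form a : form1 M (omega0 a).
Proof.
split=> [p c u v Mp tu tv|X vX].
  by rewrite /omega0 (co_linear hM Mp) // om_linear.
have s k : smooth_on M (fun p => cf (co p (X p)) k).
  by have /smooth_on_mxP := co_smooth A0 hM vX.1; apply.
have sZ (c : R) k : smooth_on M (fun p => c * cf (co p (X p)) k).
  by apply: smooth_onM => //; exact: smooth_on_cst.
rewrite /omega0; move: a; apply: ord7P;
  [apply: (@smooth_on_eq _ _ _ _ _ _ (fun p _ => esym (omE (co p (X p))).1.1.1.1.1.1))
  |apply: (@smooth_on_eq _ _ _ _ _ _ (fun p _ => esym (omE (co p (X p))).1.1.1.1.1.2))
  |apply: (@smooth_on_eq _ _ _ _ _ _ (fun p _ => esym (omE (co p (X p))).1.1.1.1.2))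
  |apply: (@smooth_on_eq _ _ _ _ _ _ (fun p _ => esym (omE (co p (X p))).1.1.1.2))
  |apply: (@smooth_on_eq _ _ _ _ _ _ (fun p _ => esym (omE (co p (X p))).1.1.2))
  |apply: (@smooth_on_eq _ _ _ _ _ _ (fun p _ => esym (omE (co p (X p))).1.2))
  |apply: (@smooth_on_eq _ _ _ _ _ _ (fun p _ => esym (omE (co p (X p))).2))];
  do ![exact: sZ|exact: s|apply: smooth_onB|apply: smooth_onN|apply: smooth_onD].
Qed.

(** The Maurer-Cartan equation of the frame: the derivatives of the coordinates of [X] and [Y]
    cancel against those in [br]. *)
Lemma ext_d_theta0 i X Y p : vfield M X -> vfield M Y -> M p ->
  ext_d M (theta0 i) X Y p = - cb (co p (X p)) (co p (Y p)) 0 i.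
Proof.
move=> vX vY Mp; have [sx EX] := fld_of A0 hM vX; have [sy EY] := fld_of A0 hM vY.
have tX := vX.2 p Mp; have tY := vY.2 p Mp.
rewrite /ext_d /theta0.
have L : co p (lie M X Y p) = br M (fun q => co q (X q)) (fun q => co q (Y q)) p.
  rewrite (lie_eq vX vY EX EY Mp) (lie_fld A0 hM sx sy Mp).
  exact: (co_fld A0 hM).
have dx := dif_mx fV Mp tY 0 i sx; have dy := dif_mx fV Mp tX 0 i sy.
rewrite dx dy L /br -(EX p Mp) -(EY p Mp).
move: (dif _ _ _ _) (dif _ _ _ _) (cb _ _) => u v w.
by rewrite !mxE; ring.
Qed.

Lemma structure_equations0 : structure_equations M theta0 omega0.
Proof.
rewrite /structure_equations; cbv beta zeta; move=> X Y p vX vY Mp.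
have E k := @ext_d_theta0 (ix k) X Y p vX vY Mp.
rewrite !E /wedge /theta0 /omega0.
move: (co p (X p)) (co p (Y p)) => x y; rewrite !omE !row5E.
by split; field.
Qed.

Lemma tangent_span p : M p -> tangent M p = span_fam ((@frk R 1 5)^~ p).
Proof.
move=> Mp; apply/seteqP; split=> v.
  move=> tv; exists (fun i => co p v 0 i); rewrite frk_sum1 -{1}(fld_co A0 hM Mp tv).
  by congr (fr _ *m p); apply: row5P; rewrite row5E.
by move=> [c ->]; rewrite frk_sum1; exact: (fr_tan A0 hM).
Qed.

Lemma adapted_coframe0 : adapted_coframe M D theta0 (@frk R 1 5).
Proof.
split.
- split; [exact: theta0_form|by move=> i; exact: (frk_vfield A0)|exact: tangent_span|].
  move=> p i j Mp; rewrite /theta0 /frk co_fr; last exact: (ants_dt_neq0 A0).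
  by move: i j; apply: ord5P; apply: ord5P; rewrite row5E -val_eqE /= /ix !inordK.
- move=> p Mp; have p0 := ants_dt_neq0 A0 Mp; apply/seteqP; split=> v.
    move=> /distributionP[s [t ->]]; rewrite /= /theta0 co_fr // !row5E.
    by split=> //; exact: (fr_tan A0 hM).
  rewrite /= /theta0 => -[tv v1 v2 v3]; apply/distributionP.
  exists (cf (co p v) 4), (cf (co p v) 5); rewrite -{1}(fld_co A0 hM Mp tv).
  by congr (fr _ *m p); apply: row5P; rewrite row5E.
- exists omega0; split; [exact: omega0_form|exact: structure_equations0].
Qed.

Lemma cartan_quartic_exists p : M p -> exists Q, cartan_quartic M D p Q.
Proof.
move=> Mp; exists (quartic_in M theta0 (@frk R 1 5) p), M, theta0, (@frk R 1 5).
by split=> //; exact: adapted_coframe0.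
Qed.

End AdaptedCoframe.

(** Subtracts [c] times an equation from the goal; iterated, it certifies a goal as a linear
    combination of hypotheses, up to a final [field]. *)
Lemma lincomb {R : realType} (c g l r : R) : l = r -> g - c * (l - r) = 0 -> g = 0.
Proof. by move=> ->; rewrite subrr mulr0 subr0. Qed.

Arguments lincomb {R} c {g l r}.

(* Cartan's metric in an adapted frame. *)
Definition gf {R : realType} (x y : 'rV[R]_5) : R :=
  cf x 1 * cf y 5 + cf x 5 * cf y 1 - (cf x 2 * cf y 4 + cf x 4 * cf y 2)
  + 4 / 3 * (cf x 3 * cf y 3).

(* [m i l] is the [l]-th component in the frame [fr] of the vector [e_i] of another adapted frame,
   [D i] the derivative along [e_i] and [d k i j] the number d theta^k (e_i, e_j); [c0], [c1], [c2]
   are the consequences of Cartan's structure equations that do not involve the forms Omega. *)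
Section AdaptedFrames.
Context {R : realType} {T : Type}.
Variables (U : set T) (S : (T -> R) -> Prop) (D : nat -> (T -> R) -> T -> R).
Variables (m : nat -> nat -> T -> R) (d : nat -> nat -> nat -> T -> R).
Hypothesis SM : forall f g, S f -> S g -> S (fun q => f q * g q).
Hypothesis SB : forall f g, S f -> S g -> S (fun q => f q - g q).
Hypothesis DM : forall k f g p, U p -> S f -> S g ->
  D k (fun q => f q * g q) p = D k f p * g p + f p * D k g p.
Hypothesis DB : forall k f g p, U p -> S f -> S g ->
  D k (fun q => f q - g q) p = D k f p - D k g p.
Hypothesis DZ : forall k (c : R) f p, U p -> S f -> D k (fun q => c * f q) p = c * D k f p.
Hypothesis DE : forall k f g p, U p -> S f -> (forall q, U q -> f q = g q) -> D k f p = D k g p.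
Hypothesis D0 : forall k f p, U p -> (forall q, U q -> f q = 0) -> D k f p = 0.
Hypothesis Sm : forall i l, S (m i l).
Hypothesis Heq : forall i j l p, U p -> D i (m j l) p - D j (m i l) p
  + cf (cb (row5 (m i 1 p) (m i 2 p) (m i 3 p) (m i 4 p) (m i 5 p))
           (row5 (m j 1 p) (m j 2 p) (m j 3 p) (m j 4 p) (m j 5 p))) l
  = - (d 1 i j p * m 1 l p + d 2 i j p * m 2 l p + d 3 i j p * m 3 l p
       + d 4 i j p * m 4 l p + d 5 i j p * m 5 l p).
Hypothesis c0 : forall p, U p -> [/\ d 1 4 5 p = 0, d 2 4 5 p = 0 & d 3 4 5 p = 1] /\
  [/\ d 1 3 4 p = 1, d 2 3 4 p = 0, d 1 3 5 p = 0 & d 2 3 5 p = 1].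
Hypothesis c1 : forall p, U p -> 3 * d 3 3 4 p = d 1 1 4 p + d 2 2 4 p /\
  3 * d 3 3 5 p = d 1 1 5 p + d 2 2 5 p.
Hypothesis c2 : forall p, U p ->
  [/\ d 5 3 5 p = 1 / 3 * d 1 1 3 p - 2 / 3 * d 2 2 3 p - 4 / 3 * d 3 1 5 p,
      d 4 3 5 p = - d 1 2 3 p + 4 / 3 * d 3 2 5 p &
      d 5 3 4 p = - d 2 1 3 p - 4 / 3 * d 3 1 4 p].
Hypothesis M4 : forall p, U p -> [/\ m 4 1 p = 0, m 4 2 p = 0 & m 4 3 p = 0].
Hypothesis M5 : forall p, U p -> [/\ m 5 1 p = 0, m 5 2 p = 0 & m 5 3 p = 0].

Local Notation a11 := (m 4 4).
Local Notation a12 := (m 4 5).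
Local Notation a21 := (m 5 4).
Local Notation a22 := (m 5 5).
Definition fdet p : R := a11 p * a22 p - a12 p * a21 p.
Hypothesis delta0 : forall p, U p -> fdet p != 0.

Let m41 p : U p -> m 4 1 p = 0. Proof. by move=> /M4[]. Qed.
Let m42 p : U p -> m 4 2 p = 0. Proof. by move=> /M4[]. Qed.
Let m43 p : U p -> m 4 3 p = 0. Proof. by move=> /M4[]. Qed.
Let m51 p : U p -> m 5 1 p = 0. Proof. by move=> /M5[]. Qed.
Let m52 p : U p -> m 5 2 p = 0. Proof. by move=> /M5[]. Qed.
Let m53 p : U p -> m 5 3 p = 0. Proof. by move=> /M5[]. Qed.

Ltac zer Up := rewrite ?(m41 Up) ?(m42 Up) ?(m43 Up) ?(m51 Up) ?(m52 Up) ?(m53 Up)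
  ?(D0 _ Up m41) ?(D0 _ Up m42) ?(D0 _ Up m43) ?(D0 _ Up m51) ?(D0 _ Up m52) ?(D0 _ Up m53).
Ltac eqn i j l Up := let H := fresh "H" in have H := Heq i j l Up;
  rewrite cb_row5 row5E in H; move: H; zer Up; move=> H.

(** By [c0], [[e_4, e_5]] is [- e_3] modulo [D], while brackets of sections of [D] only leave it
    along [E_3]. Likewise [[e_3, e_4]] and [[e_3, e_5]] give [- e_1] and [- e_2] modulo the derived
    distribution. *)
Let m31 p : U p -> m 3 1 p = 0.
Proof.
by move=> Up; eqn 4%N 5%N 1%N Up; move: H; have [[-> -> ->] _] := c0 Up; lra.
Qed.
Let m32 p : U p -> m 3 2 p = 0.
Proof.
by move=> Up; eqn 4%N 5%N 2%N Up; move: H; have [[-> -> ->] _] := c0 Up; lra.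
Qed.
Let m33 p : U p -> m 3 3 p = fdet p.
Proof.
by move=> Up; eqn 4%N 5%N 3%N Up; move: H; have [[-> -> ->] _] := c0 Up; rewrite /fdet; lra.
Qed.

Ltac zer3 Up := rewrite ?(m31 Up) ?(m32 Up) ?(m33 Up) ?(D0 _ Up m31) ?(D0 _ Up m32).
Ltac eqn3 i j l Up := let H := fresh "H" in have H := Heq i j l Up;
  rewrite cb_row5 row5E in H; move: H; zer Up; zer3 Up; move=> H.

Let m11 p : U p -> m 1 1 p = fdet p * a11 p.
Proof.
by move=> Up; eqn3 3%N 4%N 1%N Up; move: H; have [_ [-> -> _ _]] := c0 Up; lra.
Qed.
Let m12 p : U p -> m 1 2 p = fdet p * a12 p.
Proof.
by move=> Up; eqn3 3%N 4%N 2%N Up; move: H; have [_ [-> -> _ _]] := c0 Up; lra.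
Qed.
Let m21 p : U p -> m 2 1 p = fdet p * a21 p.
Proof.
by move=> Up; eqn3 3%N 5%N 1%N Up; move: H; have [_ [_ _ -> ->]] := c0 Up; lra.
Qed.
Let m22 p : U p -> m 2 2 p = fdet p * a22 p.
Proof.
by move=> Up; eqn3 3%N 5%N 2%N Up; move: H; have [_ [_ _ -> ->]] := c0 Up; lra.
Qed.

Let Sdet : S fdet. Proof. by apply: SB; apply: SM. Qed.

Definition Ddet k p : R := D k a11 p * a22 p + a11 p * D k a22 p
  - (D k a12 p * a21 p + a12 p * D k a21 p).

Let Dfdet k p : U p -> D k fdet p = Ddet k p.
Proof. by move=> Up; rewrite (DB k Up (SM (Sm 4 4) (Sm 5 5)) (SM (Sm 4 5) (Sm 5 4))) !DM. Qed.

Let D33 k p : U p -> D k (m 3 3) p = Ddet k p.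
Proof. by move=> Up; rewrite (DE k Up (Sm 3 3) m33) Dfdet. Qed.

Let Dfa k i j p : U p -> D k (fun q => fdet q * m i j q) p =
  Ddet k p * m i j p + fdet p * D k (m i j) p.
Proof. by move=> Up; rewrite DM // Dfdet. Qed.

Let D11 k p : U p -> D k (m 1 1) p = Ddet k p * a11 p + fdet p * D k a11 p.
Proof. by move=> Up; rewrite (DE k Up (Sm 1 1) m11) Dfa. Qed.
Let D12 k p : U p -> D k (m 1 2) p = Ddet k p * a12 p + fdet p * D k a12 p.
Proof. by move=> Up; rewrite (DE k Up (Sm 1 2) m12) Dfa. Qed.
Let D21 k p : U p -> D k (m 2 1) p = Ddet k p * a21 p + fdet p * D k a21 p.
Proof. by move=> Up; rewrite (DE k Up (Sm 2 1) m21) Dfa. Qed.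
Let D22 k p : U p -> D k (m 2 2) p = Ddet k p * a22 p + fdet p * D k a22 p.
Proof. by move=> Up; rewrite (DE k Up (Sm 2 2) m22) Dfa. Qed.

Ltac eqn4 i j l Up H := have H := Heq i j l Up; rewrite cb_row5 row5E in H; move: H;
  zer Up; zer3 Up; rewrite ?(m11 Up) ?(m12 Up) ?(m21 Up) ?(m22 Up) ?(D33 _ Up)
   ?(D11 _ Up) ?(D12 _ Up) ?(D21 _ Up) ?(D22 _ Up) /Ddet; move=> H.

(** Orthogonality of [e_1] and [e_3] for [gf]; [m23] is that of [e_2] and [e_3]. The trace relation
    [c1] is combined with the components of the brackets with [e_4] so that all derivatives of [m]
    cancel. *)
Let m13 p : U p -> m 1 3 p = 3 / 4 * (m 3 4 p * a12 p - m 3 5 p * a11 p).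
Proof.
move=> Up; have [w _] := c1 Up; have f0 := delta0 Up.
eqn4 1%N 4%N 1%N Up E1; eqn4 1%N 4%N 2%N Up E2; eqn4 2%N 4%N 1%N Up E3.
eqn4 2%N 4%N 2%N Up E4; eqn4 3%N 4%N 3%N Up EI.
have [_ [h1 h2 _ _]] := c0 Up; rewrite h1 h2 in EI.
(* The multipliers below are polynomial only after the goal is multiplied by [fdet p]. *)
apply/eqP; rewrite -subr_eq0 -(mulrI_eq0 _ (mulfI f0)); apply/eqP.
apply: (lincomb (3 / 4 * fdet p) EI); apply: (lincomb (- (1 / 4) * a22 p) E1).
apply: (lincomb (1 / 4 * a21 p) E2); apply: (lincomb (1 / 4 * a12 p) E3).
apply: (lincomb (- (1 / 4) * a11 p) E4); apply: (lincomb (- (1 / 4) * fdet p ^+ 2) w).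
by rewrite /fdet; field.
Qed.

Let m23 p : U p -> m 2 3 p = 3 / 4 * (m 3 4 p * a22 p - m 3 5 p * a21 p).
Proof.
move=> Up; have [_ w] := c1 Up; have f0 := delta0 Up.
eqn4 1%N 5%N 1%N Up E1; eqn4 1%N 5%N 2%N Up E2; eqn4 2%N 5%N 1%N Up E3.
eqn4 2%N 5%N 2%N Up E4; eqn4 3%N 5%N 3%N Up EI.
have [_ [_ _ h1 h2]] := c0 Up; rewrite h1 h2 in EI.
apply/eqP; rewrite -subr_eq0 -(mulrI_eq0 _ (mulfI f0)); apply/eqP.
apply: (lincomb (3 / 4 * fdet p) EI); apply: (lincomb (- (1 / 4) * a22 p) E1).
apply: (lincomb (1 / 4 * a21 p) E2); apply: (lincomb (1 / 4 * a12 p) E3).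
apply: (lincomb (- (1 / 4) * a11 p) E4); apply: (lincomb (- (1 / 4) * fdet p ^+ 2) w).
by rewrite /fdet; field.
Qed.

Let D13 k p : U p -> D k (m 1 3) p = 3 / 4 * (D k (m 3 4) p * a12 p + m 3 4 p * D k a12 p
  - (D k (m 3 5) p * a11 p + m 3 5 p * D k a11 p)).
Proof.
move=> Up; rewrite (DE k Up (Sm 1 3) m13).
have s1 := SM (Sm 3 4) (Sm 4 5); have s2 := SM (Sm 3 5) (Sm 4 4).
by rewrite (DZ k _ Up (SB s1 s2)) (DB k Up s1 s2) !DM.
Qed.

Let D23 k p : U p -> D k (m 2 3) p = 3 / 4 * (D k (m 3 4) p * a22 p + m 3 4 p * D k a22 p
  - (D k (m 3 5) p * a21 p + m 3 5 p * D k a21 p)).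
Proof.
move=> Up; rewrite (DE k Up (Sm 2 3) m23).
have s1 := SM (Sm 3 4) (Sm 5 5); have s2 := SM (Sm 3 5) (Sm 5 4).
by rewrite (DZ k _ Up (SB s1 s2)) (DB k Up s1 s2) !DM.
Qed.

Ltac eqn5 i j l Up H := have H := Heq i j l Up; rewrite cb_row5 row5E in H; move: H;
  zer Up; zer3 Up; rewrite ?(m11 Up) ?(m12 Up) ?(m21 Up) ?(m22 Up) ?(m13 Up) ?(m23 Up)
   ?(D33 _ Up) ?(D11 _ Up) ?(D12 _ Up) ?(D21 _ Up) ?(D22 _ Up) ?(D13 _ Up) ?(D23 _ Up)
   /Ddet; move=> H.

(** [gf (e_1, e_1) = 0]; [h22] and [h12] are [gf (e_2, e_2) = 0] and [gf (e_1, e_2) = 0]. With [m13]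
    and [m23] they complete the Gram matrix, whose other entries follow from the shape of [m]. *)
Let h11 p : U p ->
  2 * fdet p * (a11 p * m 1 5 p - a12 p * m 1 4 p) + 4 / 3 * m 1 3 p ^+ 2 = 0.
Proof.
move=> Up; have [_ _ w] := c2 Up; have f0 := delta0 Up; have [_ [k1 k2 _ _]] := c0 Up.
eqn5 3%N 4%N 4%N Up F4; eqn5 3%N 4%N 5%N Up F5; eqn5 3%N 4%N 3%N Up EI.
eqn5 1%N 3%N 1%N Up G1; eqn5 1%N 3%N 2%N Up G2; eqn5 1%N 4%N 3%N Up K.
eqn5 1%N 4%N 1%N Up E1; eqn5 1%N 4%N 2%N Up E2; rewrite k1 k2 in F4 F5 EI.
apply: (mulfI f0); rewrite mulr0.
(* The multipliers solve a linear system: every derivative of [m] and every value of [d] cancels. *)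
apply: (lincomb (3 / 5 * fdet p ^+ 2 * a11 p) F5).
apply: (lincomb (- (3 / 5 * fdet p ^+ 2 * a12 p)) F4).
apply: (lincomb (3 / 5 * fdet p * a11 p) G2); apply: (lincomb (- (3 / 5 * fdet p * a12 p)) G1).
apply: (lincomb (4 / 5 * fdet p ^+ 2) K).
apply: (lincomb (3 / 5 * fdet p * (m 3 4 p * a12 p - m 3 5 p * a11 p)) EI).
apply: (lincomb (- (3 / 5) * ((m 3 4 p * a12 p - m 3 5 p * a11 p) * a22 p
   - (m 3 4 p * a22 p - m 3 5 p * a21 p) * a12 p)) E1).
apply: (lincomb (- (3 / 5) * (- (m 3 4 p * a12 p - m 3 5 p * a11 p) * a21 p
   + (m 3 4 p * a22 p - m 3 5 p * a21 p) * a11 p)) E2).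
apply: (lincomb (- (3 / 5) * fdet p ^+ 3) w).
by rewrite /fdet; field.
Qed.

Let h22 p : U p ->
  2 * fdet p * (a21 p * m 2 5 p - a22 p * m 2 4 p) + 4 / 3 * m 2 3 p ^+ 2 = 0.
Proof.
move=> Up; have [_ w _] := c2 Up; have f0 := delta0 Up; have [_ [_ _ k1 k2]] := c0 Up.
eqn5 3%N 5%N 4%N Up F4; eqn5 3%N 5%N 5%N Up F5; eqn5 3%N 5%N 3%N Up EI.
eqn5 2%N 3%N 1%N Up G1; eqn5 2%N 3%N 2%N Up G2; eqn5 2%N 5%N 3%N Up K.
eqn5 2%N 5%N 1%N Up E1; eqn5 2%N 5%N 2%N Up E2; rewrite k1 k2 in F4 F5 EI.
apply: (mulfI f0); rewrite mulr0.
apply: (lincomb (- (3 / 5) * fdet p ^+ 2 * a22 p) F4).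
apply: (lincomb (3 / 5 * fdet p ^+ 2 * a21 p) F5).
apply: (lincomb (- (3 / 5) * fdet p * a22 p) G1); apply: (lincomb (3 / 5 * fdet p * a21 p) G2).
apply: (lincomb (4 / 5 * fdet p ^+ 2) K).
apply: (lincomb (3 / 5 * fdet p * (m 3 4 p * a22 p - m 3 5 p * a21 p)) EI).
apply: (lincomb (- (3 / 5) * ((m 3 4 p * a12 p - m 3 5 p * a11 p) * a22 p
   - (m 3 4 p * a22 p - m 3 5 p * a21 p) * a12 p)) E1).
apply: (lincomb (- (3 / 5) * (- (m 3 4 p * a12 p - m 3 5 p * a11 p) * a21 p
   + (m 3 4 p * a22 p - m 3 5 p * a21 p) * a11 p)) E2).
apply: (lincomb (3 / 5 * fdet p ^+ 3) w).
by rewrite /fdet; field.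
Qed.

Let h12 p : U p ->
  fdet p * (a11 p * m 2 5 p + a21 p * m 1 5 p - a12 p * m 2 4 p - a22 p * m 1 4 p)
  + 4 / 3 * (m 1 3 p * m 2 3 p) = 0.
Proof.
move=> Up; have [w _ _] := c2 Up; have f0 := delta0 Up; have [_ [_ _ k1 k2]] := c0 Up.
eqn5 3%N 5%N 4%N Up F4; eqn5 3%N 5%N 5%N Up F5; eqn5 3%N 5%N 3%N Up EI.
eqn5 1%N 3%N 1%N Up G1; eqn5 1%N 3%N 2%N Up G2.
eqn5 2%N 3%N 1%N Up G3; eqn5 2%N 3%N 2%N Up G4; eqn5 1%N 5%N 3%N Up K.
eqn5 1%N 5%N 1%N Up E1; eqn5 1%N 5%N 2%N Up E2; rewrite k1 k2 in F4 F5 EI.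
apply: (mulfI f0); rewrite mulr0.
apply: (lincomb (3 / 5 * fdet p ^+ 2 * a11 p) F5).
apply: (lincomb (- (3 / 5) * fdet p ^+ 2 * a12 p) F4).
apply: (lincomb (- (1 / 5) * fdet p * a22 p) G1); apply: (lincomb (1 / 5 * fdet p * a21 p) G2).
apply: (lincomb (2 / 5 * fdet p * a11 p) G4); apply: (lincomb (- (2 / 5) * fdet p * a12 p) G3).
apply: (lincomb (4 / 5 * fdet p ^+ 2) K).
apply: (lincomb (3 / 5 * fdet p * (m 3 4 p * a12 p - m 3 5 p * a11 p)) EI).
apply: (lincomb (- (3 / 5) * ((m 3 4 p * a12 p - m 3 5 p * a11 p) * a22 p
   - (m 3 4 p * a22 p - m 3 5 p * a21 p) * a12 p)) E1).
apply: (lincomb (- (3 / 5) * (- (m 3 4 p * a12 p - m 3 5 p * a11 p) * a21 p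
   + (m 3 4 p * a22 p - m 3 5 p * a21 p) * a11 p)) E2).
apply: (lincomb (- (3 / 5) * fdet p ^+ 3) w).
by rewrite /fdet; field.
Qed.

Lemma adapted_shape p : U p ->
  [/\ m 1 1 p = fdet p * a11 p, m 1 2 p = fdet p * a12 p,
      m 2 1 p = fdet p * a21 p & m 2 2 p = fdet p * a22 p].
Proof. by move=> Up; split; [exact: m11|exact: m12|exact: m21|exact: m22]. Qed.

Definition combine p (s : 'rV[R]_5) : 'rV[R]_5 :=
  let c l := cf s 1 * m 1 l p + cf s 2 * m 2 l p + cf s 3 * m 3 l p + cf s 4 * m 4 l p
             + cf s 5 * m 5 l p in
  row5 (c 1) (c 2) (c 3) (c 4) (c 5).

Lemma adapted_gram p s t : U p -> gf (combine p s) (combine p t) = fdet p ^+ 2 * gf s t.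
Proof.
move=> Up; have e11 := h11 Up; have e12 := h12 Up; have e22 := h22 Up.
rewrite {1}/gf /combine !row5E; apply/eqP; rewrite -subr_eq0; apply/eqP.
move: e11 e12 e22; zer Up; zer3 Up.
rewrite ?(m11 Up) ?(m12 Up) ?(m21 Up) ?(m22 Up) ?(m13 Up) ?(m23 Up) => e11 e12 e22.
apply: (lincomb (cf s 1 * cf t 1) e11); apply: (lincomb (cf s 2 * cf t 2) e22).
apply: (lincomb (cf s 1 * cf t 2 + cf s 2 * cf t 1) e12).
by rewrite /gf /fdet; field.
Qed.

End AdaptedFrames.

(** Elimination of [Omega]. In the trace relations, [(2 Omega_1 + Omega_4) + (Omega_1 + 2 Omega_4)]
    is three times the form [Omega_1 + Omega_4] of the third equation; the last three relations
    compare the fourth and fifth equations with the first three. *)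
Lemma structure_conditions {R : realType} (F : nat -> nat -> nat -> R) (t o : nat -> nat -> R) :
  (forall k l, (0 < k < 6)%N -> (0 < l < 6)%N -> t k l = (k == l)%:R) ->
  (forall i j,
    let w (a b : nat -> R) := a i * b j - a j * b i in
    let o2 a k b l : nat -> R := fun i => a * o k i + b * o l i in
    [/\ F 1%N i j = w (t 1%N) (o2 2 1%N 1 4%N) + w (t 2%N) (o 2%N) + w (t 3%N) (t 4%N),
        F 2%N i j = w (t 1%N) (o 3%N) + w (t 2%N) (o2 1 1%N 2 4%N) + w (t 3%N) (t 5%N),
        F 3%N i j = w (t 1%N) (o 5%N) + w (t 2%N) (o 6%N) + w (t 3%N) (o2 1 1%N 1 4%N)
                    + w (t 4%N) (t 5%N),
        F 4%N i j = w (t 1%N) (o 7%N) + 4 / 3 * w (t 3%N) (o 6%N) + w (t 4%N) (o 1%N)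
                    + w (t 5%N) (o 2%N) &
        F 5%N i j = w (t 2%N) (o 7%N) - 4 / 3 * w (t 3%N) (o 5%N) + w (t 4%N) (o 3%N)
                    + w (t 5%N) (o 4%N)]) ->
  ([/\ F 1%N 4%N 5%N = 0, F 2%N 4%N 5%N = 0 & F 3%N 4%N 5%N = 1] /\
   [/\ F 1%N 3%N 4%N = 1, F 2%N 3%N 4%N = 0, F 1%N 3%N 5%N = 0 & F 2%N 3%N 5%N = 1]) /\
  ((3 * F 3%N 3%N 4%N = F 1%N 1%N 4%N + F 2%N 2%N 4%N /\
    3 * F 3%N 3%N 5%N = F 1%N 1%N 5%N + F 2%N 2%N 5%N) /\
  [/\ F 5%N 3%N 5%N = 1 / 3 * F 1%N 1%N 3%N - 2 / 3 * F 2%N 2%N 3%N - 4 / 3 * F 3%N 1%N 5%N,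
      F 4%N 3%N 5%N = - F 1%N 2%N 3%N + 4 / 3 * F 3%N 2%N 5%N &
      F 5%N 3%N 4%N = - F 2%N 1%N 3%N - 4 / 3 * F 3%N 1%N 4%N]).
Proof.
move=> tE S.
move: (S 4%N 5%N) (S 3%N 4%N) (S 3%N 5%N) (S 1%N 4%N) (S 2%N 4%N) (S 1%N 5%N) (S 2%N 5%N)
  (S 1%N 3%N) (S 2%N 3%N) => /=; rewrite !tE //=.
move=> [p1 p2 p3 _ _] [q1 q2 q3 q4 q5] [r1 r2 r3 r4 r5] [s1 s2 s3 _ _] [t1 t2 t3 _ _]
  [u1 u2 u3 _ _] [v1 v2 v3 _ _] [w1 w2 w3 _ _] [x1 x2 x3 _ _].
split; [split; split|split; [split|split]].
- by rewrite p1; ring.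
- by rewrite p2; ring.
- by rewrite p3; ring.
- by rewrite q1; ring.
- by rewrite q2; ring.
- by rewrite r1; ring.
- by rewrite r2; ring.
- by rewrite q3 s1 t2; ring.
- by rewrite r3 u1 v2; ring.
- by rewrite r5 w1 x2 u3; field.
- by rewrite r4 x1 v3; field.
- by rewrite q5 w2 s3; field.
Qed.

(** * Frame components of an arbitrary adapted coframe *)

Section GivenCoframe.
Context {R : realType}.
Local Notation V := 'M[R]_(3, 2).
Local Notation fV := (@fin_dim_mx R 3 2).
Local Notation f5 := (@fin_dim_mx R 1 5).
Variables (A : R) (A0 : A != 0) (U : set V) (hU : open_in (ants_manifold A) U).
Local Notation D := (@ants_distribution R).
Variables (theta : 'I_5 -> V -> V -> R) (e : 'I_5 -> V -> V).
Hypothesis ad : adapted_coframe U D theta e.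

Let cof : coframe U theta e. Proof. by case: ad. Qed.
Let form_th i : form1 U (theta i). Proof. by case: cof. Qed.

Lemma coframe_vfield i : vfield U (e i). Proof. by case: cof. Qed.
Let ve := coframe_vfield.

Lemma theta_e i j p : U p -> theta i p (e j p) = (i == j)%:R.
Proof. by case: cof => _ _ _; exact. Qed.

Lemma theta_ix k l p : U p -> (0 < k < 6)%N -> (0 < l < 6)%N ->
  theta (ix k) p (e (ix l) p) = (k == l)%:R.
Proof.
move=> Up k5 l5; rewrite theta_e // -val_eqE /= /ix !inordK.
- by move: k5 l5; case: k => // k; case: l.
- by move: l5; case: l.
- by move: k5; case: k.
Qed.

Lemma tangent_comb p (c : R) u v : U p -> tangent U p u -> tangent U p v ->
  tangent U p (c *: u + v).
Proof.
move=> Up tu tv; rewrite -(fld_co A0 hU Up tu) -(fld_co A0 hU Up tv) scalemxAl -mulmxDl.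
by rewrite -linearZ -frD; exact: (fr_tan A0 hU).
Qed.

Lemma tangent0 p : U p -> tangent U p 0.
Proof. by move=> Up; have := fr_tan A0 hU 0 Up; rewrite linear0 mul0mx. Qed.

Lemma form0 w p : form1 U w -> U p -> w p 0 = 0.
Proof.
move=> [wl _] Up; have := wl p 1 0 0 Up (tangent0 Up) (tangent0 Up).
by rewrite scaler0 addr0 mul1r => /eqP; rewrite -subr_eq0 opprD addNKr oppr_eq0 => /eqP.
Qed.

Lemma theta_comb k (s z : R) i j p : U p ->
  theta k p (s *: e i p + z *: e j p) = s * theta k p (e i p) + z * theta k p (e j p).
Proof.
move=> Up; have [wl _] := form_th k; have w0 := form0 (form_th k) Up.
have ti := (ve i).2 p Up; have tj := (ve j).2 p Up; have t0 := tangent0 Up.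
have tj' : tangent U p (z *: e j p) by have := tangent_comb z Up tj t0; rewrite addr0.
rewrite wl //; congr (_ + _).
by have := wl p z _ _ Up tj t0; rewrite !addr0 w0 addr0.
Qed.

Lemma form_sum w p (c : 'I_5 -> R) : form1 U w -> U p ->
  w p (\sum_i c i *: e i p) = \sum_i c i * w p (e i p).
Proof.
move=> fw Up; have w0 := form0 fw Up; have [wl _] := fw.
have H (r : seq 'I_5) : tangent U p (\sum_(i <- r) c i *: e i p) /\
    w p (\sum_(i <- r) c i *: e i p) = \sum_(i <- r) c i * w p (e i p).
  elim: r => [|i r [tr IH]]; first by rewrite !big_nil; split=> //; exact: tangent0.
  rewrite !big_cons; split; first by apply: tangent_comb => //; exact: (ve i).2.
  by rewrite wl // ?IH //; exact: (ve i).2.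
exact: (H _).2.
Qed.

Lemma coframe_expand p v : U p -> tangent U p v -> v = \sum_i theta i p v *: e i p.
Proof.
move=> Up tv; have [_ _ /(_ p Up) span _] := cof.
have := tv; rewrite span => -[c E]; rewrite {1}E; apply: eq_bigr => i _; congr (_ *: _).
rewrite E form_sum // (bigD1 i) //= theta_e // eqxx mulr1 big1 ?addr0 // => j ji.
by rewrite theta_e // eq_sym (negbTE ji) mulr0.
Qed.

Definition fm (k : nat) : V -> 'rV[R]_5 := fun q => co q (e (ix k) q).

Lemma fm_smooth k : smooth_on U (fm k).
Proof. exact: (co_smooth A0 hU (ve _).1). Qed.

Lemma fm_fld k q : U q -> e (ix k) q = fld (fm k) q.
Proof. exact: (fld_of A0 hU (ve _)).2. Qed.

Lemma ext_d_coframe k i j p : U p ->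
  ext_d U (theta k) (e i) (e j) p = - theta k p (lie U (e i) (e j) p).
Proof.
move=> Up; rewrite /ext_d.
have c0 a b : U p -> dif U (fun q => theta k q (e a q)) p (e b p) = 0.
  move=> _; have E q : U q -> theta k q (e a q) = (k == a)%:R by exact: theta_e.
  have s := (form_th k).2 _ (ve a); have t := (ve b).2 p Up.
  exact: (etrans (dif_eq fV Up t fin_dim_R s E) (dif_cst fV Up t _ fin_dim_R)).
by rewrite !c0 // subrr sub0r.
Qed.

Definition fd (k i j : nat) (p : V) : R :=
  ext_d U (theta (ix k)) (e (ix i)) (e (ix j)) p.

Lemma br_fm i j p : U p -> br U (fm i) (fm j) p =
  - (fd 1 i j p *: fm 1 p + fd 2 i j p *: fm 2 p + fd 3 i j p *: fm 3 p
     + fd 4 i j p *: fm 4 p + fd 5 i j p *: fm 5 p).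
Proof.
move=> Up; have p0 := openin_dt A0 hU Up.
have vi := ve (ix i); have vj := ve (ix j).
have L : lie U (e (ix i)) (e (ix j)) p = fr (br U (fm i) (fm j) p) *m p.
  rewrite (lie_eq vi vj (@fm_fld i) (@fm_fld j) Up).
  exact: (lie_fld A0 hU (fm_smooth i) (fm_smooth j) Up).
have tl := (lie_vfield A0 hU vi vj).2 p Up.
have X := coframe_expand Up tl.
rewrite -(co_fr (br U (fm i) (fm j) p) p0) -L X.
have dE k : theta (ix k) p (lie U (e (ix i)) (e (ix j)) p) = - fd k i j p.
  by rewrite /fd ext_d_coframe // opprK.
rewrite sum5 !dE !(fm_fld _ Up) /fld !scalemxAl -!mulmxDl.
rewrite -!linearZ -!frD co_fr // !scaleNr -!opprD.
by [].
Qed.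

Definition fD (k : nat) (f : V -> R) : V -> R := fun p => dif U f p (fld (fm k) p).
Definition fmc (i l : nat) : V -> R := fun p => cf (fm i p) l.

Lemma fmc_smooth i l : smooth_on U (fmc i l).
Proof. by have /smooth_on_mxP := fm_smooth i; apply. Qed.

Lemma fm_tan k p : U p -> tangent U p (fld (fm k) p).
Proof. exact: (fr_tangent A0 hU). Qed.

Lemma fm_row i p : row5 (fmc i 1 p) (fmc i 2 p) (fmc i 3 p) (fmc i 4 p) (fmc i 5 p) = fm i p.
Proof. by apply: row5P; rewrite row5E. Qed.

Lemma fm_eq i j l p : U p -> fD i (fmc j l) p - fD j (fmc i l) p
  + cf (cb (row5 (fmc i 1 p) (fmc i 2 p) (fmc i 3 p) (fmc i 4 p) (fmc i 5 p))
           (row5 (fmc j 1 p) (fmc j 2 p) (fmc j 3 p) (fmc j 4 p) (fmc j 5 p))) l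
  = - (fd 1 i j p * fmc 1 l p + fd 2 i j p * fmc 2 l p + fd 3 i j p * fmc 3 l p
       + fd 4 i j p * fmc 4 l p + fd 5 i j p * fmc 5 l p).
Proof.
move=> Up; rewrite !fm_row.
have dE a b : fD a (fmc b l) p = cf (dif U (fm b) p (fld (fm a) p)) l.
  exact: (dif_mx fV Up (fm_tan a Up) 0 (ix l) (fm_smooth b)).
rewrite !dE; have := congr1 (fun y : 'rV[R]_5 => cf y l) (br_fm i j Up).
rewrite /br /fmc; move: (dif _ _ _ _) (dif _ _ _ _) (cb _ _) => u v w.
move: (fm 1 p) (fm 2 p) (fm 3 p) (fm 4 p) (fm 5 p) => y1 y2 y3 y4 y5.
by rewrite !mxE.
Qed.

Lemma fm_D k : (3 < k < 6)%N -> forall p, U p ->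
  [/\ fmc k 1 p = 0, fmc k 2 p = 0 & fmc k 3 p = 0].
Proof.
move=> k45 p Up; have [_ /(_ p Up) DE _] := ad.
have : D p (e (ix k) p).
  have n k' : (0 < k' < 4)%N -> theta (ix k') p (e (ix k) p) = 0.
    move=> k4; rewrite theta_e //; case: eqP => // /(congr1 val); rewrite /= /ix !inordK;
      by move: k45 k4; case: k' => [|[|[|[|k']]]] //; case: k => [|[|[|[|[|[|k]]]]]].
  by rewrite DE /=; split; [exact: (ve _).2|exact: n..].
move=> /distributionP[s [t E]].
by rewrite /fmc /fm E co_fr ?row5E //; exact: (openin_dt A0 hU).
Qed.

Let m4 := @fm_D 4 isT.
Let m5 := @fm_D 5 isT.

(** A relation between the rows of the block is a relation between [e_4] and [e_5], which duality
    with [theta] excludes. If the determinant vanished, its minors would provide such relations,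
    forcing the block to be zero, and then [e_4 = 0]. *)
Lemma fm_det p : U p -> fdet fmc p != 0.
Proof.
move=> Up; apply/eqP => f0.
have comb (s t : R) : s * fmc 4 4 p + t * fmc 5 4 p = 0 -> s * fmc 4 5 p + t * fmc 5 5 p = 0 ->
    s = 0 /\ t = 0.
  move=> h4 h5; have [a1 a2 a3] := m4 Up; have [b1 b2 b3] := m5 Up.
  have E : s *: e (ix 4) p + t *: e (ix 5) p = 0.
    rewrite !(fm_fld _ Up) /fld !scalemxAl -mulmxDl -!linearZ -frD.
    rewrite (_ : s *: fm 4 p + t *: fm 5 p = 0) ?linear0 ?mul0mx //.
    rewrite -(fm_row 4 p) -(fm_row 5 p) a1 a2 a3 b1 b2 b3.
    apply: row5P; rewrite [RHS]mxE mxE [X in X + _]mxE [X in _ + X]mxE !row5E //;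
      by rewrite !mulr0 addr0.
  have ln i : s * theta i p (e (ix 4) p) + t * theta i p (e (ix 5) p) = 0.
    by rewrite -theta_comb // E form0.
  have ne : (@ix 4 4 == ix 5) = false.
    by apply/eqP => /(congr1 val); rewrite /= /ix !inordK.
  have := ln (ix 4); have := ln (ix 5); rewrite !theta_e // !eqxx eq_sym ne.
  by rewrite !mulr0 !mulr1 add0r addr0.
have [z1 z2] : fmc 5 5 p = 0 /\ - fmc 4 5 p = 0.
  by apply: comb; [rewrite -f0 /fdet; ring|ring].
have [z3 z4] : fmc 5 4 p = 0 /\ - fmc 4 4 p = 0.
  by apply: comb; [ring|apply: oppr_inj; rewrite oppr0 -[RHS]f0 /fdet; ring].
have [] : (1 : R) = 0 /\ (0 : R) = 0.
  apply: comb; first by move/eqP: z4; rewrite oppr_eq0 => /eqP ->; ring.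
  by move/eqP: z2; rewrite oppr_eq0 => /eqP ->; ring.
by move=> /eqP; rewrite oner_eq0.
Qed.

Lemma fd_conditions p : U p ->
  ([/\ fd 1 4 5 p = 0, fd 2 4 5 p = 0 & fd 3 4 5 p = 1] /\
   [/\ fd 1 3 4 p = 1, fd 2 3 4 p = 0, fd 1 3 5 p = 0 & fd 2 3 5 p = 1]) /\
  ((3 * fd 3 3 4 p = fd 1 1 4 p + fd 2 2 4 p /\
    3 * fd 3 3 5 p = fd 1 1 5 p + fd 2 2 5 p) /\
  [/\ fd 5 3 5 p = 1 / 3 * fd 1 1 3 p - 2 / 3 * fd 2 2 3 p - 4 / 3 * fd 3 1 5 p,
      fd 4 3 5 p = - fd 1 2 3 p + 4 / 3 * fd 3 2 5 p &
      fd 5 3 4 p = - fd 2 1 3 p - 4 / 3 * fd 3 1 4 p]).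
Proof.
move=> Up; have [_ _ [Om [_ SE]]] := ad.
rewrite /structure_equations in SE; cbv beta zeta in SE.
have th k l := @theta_ix k l p Up.
apply: (@structure_conditions _ (fun k i j => fd k i j p)
  (fun k l => theta (ix k) p (e (ix l) p)) (fun k l => Om (ix k) p (e (ix l) p)) th) => i j.
exact: (SE (e (ix i)) (e (ix j)) p (ve _) (ve _) Up).
Qed.

Lemma fmc_hyps :
  [/\ (forall k (f g : V -> R) p, U p -> smooth_on U f -> smooth_on U g ->
         fD k (fun q => f q * g q) p = fD k f p * g p + f p * fD k g p),
      (forall k (f g : V -> R) p, U p -> smooth_on U f -> smooth_on U g ->
         fD k (fun q => f q - g q) p = fD k f p - fD k g p),
      (forall k (c : R) (f : V -> R) p, U p -> smooth_on U f -> fD k (fun q => c * f q) p = c * fD k f p),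
      (forall k (f g : V -> R) p, U p -> smooth_on U f -> (forall q, U q -> f q = g q) ->
         fD k f p = fD k g p) &
      forall k (f : V -> R) p, U p -> (forall q, U q -> f q = 0) -> fD k f p = 0].
Proof.
split.
- by move=> k f g p Up sf sg; exact: (difM fV Up (fm_tan k Up) sf sg).
- by move=> k f g p Up sf sg; exact: (difB fV Up (fm_tan k Up) fin_dim_R sf sg).
- by move=> k c f p Up sf; exact: (difZ fV Up (fm_tan k Up) c sf).
- by move=> k f g p Up sf E; exact: (dif_eq fV Up (fm_tan k Up) fin_dim_R sf E).
- move=> k f p Up E; have sf : smooth_on U f.
    by apply: (@smooth_on_eq _ _ _ _ (fun=> 0)) => [q Uq|]; [rewrite E|exact: smooth_on_cst].
  exact: (etrans (dif_eq fV Up (fm_tan k Up) fin_dim_R sf E) (dif_cst fV Up (fm_tan k Up) _ fin_dim_R)).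
Qed.

Lemma fm_shape p : U p ->
  [/\ fmc 1 1 p = fdet fmc p * fmc 4 4 p, fmc 1 2 p = fdet fmc p * fmc 4 5 p,
      fmc 2 1 p = fdet fmc p * fmc 5 4 p & fmc 2 2 p = fdet fmc p * fmc 5 5 p].
Proof.
have [DM DB DZ DE D0] := fmc_hyps.
by apply: (@adapted_shape _ _ U fD fmc fd D0 fm_eq) => // q Uq; have [h _] := fd_conditions Uq.
Qed.

Lemma fm_gram p s t : U p ->
  gf (combine fmc p s) (combine fmc p t) = fdet fmc p ^+ 2 * gf s t.
Proof.
have [DM DB DZ DE D0] := fmc_hyps.
by apply: (@adapted_gram _ _ U (@smooth_on _ _ _ U) fD fmc fd (@smooth_onM _ _ U) (@smooth_onB _ _ _ U)
  DM DB DZ DE D0 fmc_smooth fm_eq _ _ _ m4 m5 fm_det) => q Uq; have [h [h1 h2]] := fd_conditions Uq.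
Qed.

Definition fth p v : 'rV[R]_5 := row5 (theta (ix 1) p v) (theta (ix 2) p v) (theta (ix 3) p v)
  (theta (ix 4) p v) (theta (ix 5) p v).

Lemma co_combine p v : U p -> tangent U p v -> co p v = combine fmc p (fth p v).
Proof.
move=> Up tv; have p0 := openin_dt A0 hU Up.
rewrite {1}(coframe_expand Up tv) sum5 !(fm_fld _ Up) /fld !scalemxAl -!mulmxDl.
rewrite -!linearZ -!frD co_fr // /combine /fth !row5E /fmc.
move: (theta _ _ _) (theta _ _ _) (theta _ _ _) (theta _ _ _) (theta _ _ _) => c1 c2 c3 c4 c5.
move: (fm 1 p) (fm 2 p) (fm 3 p) (fm 4 p) (fm 5 p) => y1 y2 y3 y4 y5.
by apply: row5P; rewrite row5E !mxE.
Qed.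

Lemma metric_gf p u v : U p -> tangent U p u -> tangent U p v ->
  gf (co p u) (co p v) = fdet fmc p ^+ 2 * cartan_metric theta p u v.
Proof.
move=> Up tu tv; rewrite !co_combine // fm_gram //; congr (_ * _).
by rewrite /gf /fth !row5E.
Qed.

End GivenCoframe.

(** * The Levi-Civita connection *)

Section Christoffel.
Context {R : realType}.
Implicit Types x y z : 'rV[R]_5.

(* The Christoffel symbols of the metric [gf] in the frame [fr], from the Koszul formula. *)
Definition gam x y : 'rV[R]_5 := row5
   (9 / 10 * (cf x 1 * cf y 1) + 9 / 10 * (cf x 1 * cf y 2) + 9 / 10 * (cf x 2 * cf y 1) - 9 / 5
    * (cf x 2 * cf y 2) - 1 / 10 * (cf x 3 * cf y 1) + 1 / 5 * (cf x 3 * cf y 2) - 1 / 3 * (cf x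
    3 * cf y 4) - (cf x 4 * cf y 1) + (cf x 4 * cf y 2) + 2 / 3 * (cf x 4 * cf y 3) + (cf x 5 *
    cf y 1))
   (9 / 5 * (cf x 1 * cf y 1) - 9 / 10 * (cf x 1 * cf y 2) - 9 / 10 * (cf x 2 * cf y 1) - 9 / 10
    * (cf x 2 * cf y 2) - 1 / 5 * (cf x 3 * cf y 1) + 1 / 10 * (cf x 3 * cf y 2) - 1 / 3 * (cf x
    3 * cf y 5) + (cf x 4 * cf y 2) + (cf x 5 * cf y 1) - (cf x 5 * cf y 2) + 2 / 3 * (cf x 5 *
    cf y 3))
   (- (243 / 200 * (cf x 1 * cf y 2)) + 243 / 200 * (cf x 2 * cf y 1) + 9 / 5 * (cf x 4 * cf y
    1) - 9 / 10 * (cf x 4 * cf y 2) - 1 / 2 * (cf x 4 * cf y 5) - 9 / 10 * (cf x 5 * cf y 1) + 9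
    / 5 * (cf x 5 * cf y 2) + 1 / 2 * (cf x 5 * cf y 4))
   (- (81 / 50 * (cf x 1 * cf y 3)) + 9 / 10 * (cf x 1 * cf y 4) + 9 / 10 * (cf x 1 * cf y 5) +
    9 / 10 * (cf x 2 * cf y 4) - 9 / 5 * (cf x 2 * cf y 5) + 81 / 20 * (cf x 3 * cf y 1) - 1 /
    10 * (cf x 3 * cf y 4) + 1 / 5 * (cf x 3 * cf y 5) - 6 / 5 * (cf x 4 * cf y 3) - (cf x 4 *
    cf y 4) + (cf x 4 * cf y 5) + 12 / 5 * (cf x 5 * cf y 3) + (cf x 5 * cf y 4))
   (9 / 5 * (cf x 1 * cf y 4) - 9 / 10 * (cf x 1 * cf y 5) - 81 / 50 * (cf x 2 * cf y 3) - 9 /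
    10 * (cf x 2 * cf y 4) - 9 / 10 * (cf x 2 * cf y 5) + 81 / 20 * (cf x 3 * cf y 2) - 1 / 5 *
    (cf x 3 * cf y 4) + 1 / 10 * (cf x 3 * cf y 5) - 12 / 5 * (cf x 4 * cf y 3) + (cf x 4 * cf y
    5) + 6 / 5 * (cf x 5 * cf y 3) + (cf x 5 * cf y 4) - (cf x 5 * cf y 5)).

Lemma gam_row5 (x1 x2 x3 x4 x5 y1 y2 y3 y4 y5 : R) :
  gam (row5 x1 x2 x3 x4 x5) (row5 y1 y2 y3 y4 y5) = row5
   (9 / 10 * (x1 * y1) + 9 / 10 * (x1 * y2) + 9 / 10 * (x2 * y1) - 9 / 5 * (x2 * y2) - 1 / 10 *
    (x3 * y1) + 1 / 5 * (x3 * y2) - 1 / 3 * (x3 * y4) - (x4 * y1) + (x4 * y2) + 2 / 3 * (x4 *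
    y3) + (x5 * y1))
   (9 / 5 * (x1 * y1) - 9 / 10 * (x1 * y2) - 9 / 10 * (x2 * y1) - 9 / 10 * (x2 * y2) - 1 / 5 *
    (x3 * y1) + 1 / 10 * (x3 * y2) - 1 / 3 * (x3 * y5) + (x4 * y2) + (x5 * y1) - (x5 * y2) + 2 /
    3 * (x5 * y3))
   (- (243 / 200 * (x1 * y2)) + 243 / 200 * (x2 * y1) + 9 / 5 * (x4 * y1) - 9 / 10 * (x4 * y2) -
    1 / 2 * (x4 * y5) - 9 / 10 * (x5 * y1) + 9 / 5 * (x5 * y2) + 1 / 2 * (x5 * y4))
   (- (81 / 50 * (x1 * y3)) + 9 / 10 * (x1 * y4) + 9 / 10 * (x1 * y5) + 9 / 10 * (x2 * y4) - 9 /
    5 * (x2 * y5) + 81 / 20 * (x3 * y1) - 1 / 10 * (x3 * y4) + 1 / 5 * (x3 * y5) - 6 / 5 * (x4 *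
    y3) - (x4 * y4) + (x4 * y5) + 12 / 5 * (x5 * y3) + (x5 * y4))
   (9 / 5 * (x1 * y4) - 9 / 10 * (x1 * y5) - 81 / 50 * (x2 * y3) - 9 / 10 * (x2 * y4) - 9 / 10 *
    (x2 * y5) + 81 / 20 * (x3 * y2) - 1 / 5 * (x3 * y4) + 1 / 10 * (x3 * y5) - 12 / 5 * (x4 *
    y3) + (x4 * y5) + 6 / 5 * (x5 * y3) + (x5 * y4) - (x5 * y5)).
Proof.
rewrite /gam; set a := row5 x1 _ _ _ _; set b := row5 y1 _ _ _ _.
have [a1 a2 a3 a4 a5] : [/\ cf a 1 = x1, cf a 2 = x2, cf a 3 = x3, cf a 4 = x4 & cf a 5 = x5].
  by rewrite !row5E.
have [b1 b2 b3 b4 b5] : [/\ cf b 1 = y1, cf b 2 = y2, cf b 3 = y3, cf b 4 = y4 & cf b 5 = y5].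
  by rewrite !row5E.
by rewrite a1 a2 a3 a4 a5 b1 b2 b3 b4 b5.
Qed.

Lemma gf_row5 (x1 x2 x3 x4 x5 y1 y2 y3 y4 y5 : R) :
  gf (row5 x1 x2 x3 x4 x5) (row5 y1 y2 y3 y4 y5) =
  x1 * y5 + x5 * y1 - (x2 * y4 + x4 * y2) + 4 / 3 * (x3 * y3).
Proof. by rewrite /gf !row5E. Qed.

Lemma gam_linearl y : linear (gam^~ y).
Proof.
move=> a; elim/(@row5_ind R) => x1 x2 x3 x4 x5; elim/(@row5_ind R) => z1 z2 z3 z4 z5.
elim/(@row5_ind R): y => y1 y2 y3 y4 y5.
by rewrite row5_lin !gam_row5 row5_lin; congr row5; ring.
Qed.

Lemma gam_linearr x : linear (gam x).
Proof.
move=> a; elim/(@row5_ind R) => y1 y2 y3 y4 y5; elim/(@row5_ind R) => z1 z2 z3 z4 z5.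
elim/(@row5_ind R): x => x1 x2 x3 x4 x5.
by rewrite row5_lin !gam_row5 row5_lin; congr row5; ring.
Qed.

Lemma gf_linearl y : linear (gf^~ y : _ -> R).
Proof. by move=> a x z; rewrite -[RHS]/(a * gf x y + gf z y) /gf !cf_lin; ring. Qed.

Lemma gfC x y : gf x y = gf y x.
Proof. by rewrite /gf; ring. Qed.

Lemma gf_linearr x : linear (gf x : _ -> R).
Proof. by move=> a y z; rewrite !(gfC x); exact: gf_linearl. Qed.

Lemma gfB x y z : gf (x - y) z = gf x z - gf y z.
Proof. by rewrite addrC -scaleN1r gf_linearl /= -[_ *: _]/(_ * _) mulN1r addrC. Qed.

Lemma gfD x y z : gf (x + y) z = gf x z + gf y z.
Proof. by rewrite -[x]scale1r gf_linearl -[_ *: _]/(_ * _) mul1r scale1r. Qed.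

Lemma gfZ (a : R) x z : gf (a *: x) z = a * gf x z.
Proof. by rewrite /gf !mxE; ring. Qed.

Lemma gfN x y : gf (- x) y = - gf x y.
Proof. by rewrite -scaleN1r gfZ mulN1r. Qed.

Lemma gfDr x y z : gf x (y + z) = gf x y + gf x z.
Proof. by rewrite !(gfC x) gfD. Qed.

Lemma gfZr (a : R) x z : gf x (a *: z) = a * gf x z.
Proof. by rewrite !(gfC x) gfZ. Qed.

(** With [gam_metric], this characterizes the Levi-Civita connection of the constant metric. *)
Lemma gam_torsion x y : gam x y - gam y x = cb x y.
Proof.
elim/(@row5_ind R): x => x1 x2 x3 x4 x5; elim/(@row5_ind R): y => y1 y2 y3 y4 y5.
by rewrite addrC -scaleN1r !gam_row5 cb_row5 row5_lin; congr row5; field.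
Qed.

Lemma gam_metric x y z : gf (gam x y) z + gf y (gam x z) = 0.
Proof.
elim/(@row5_ind R): x => x1 x2 x3 x4 x5; elim/(@row5_ind R): y => y1 y2 y3 y4 y5.
elim/(@row5_ind R): z => z1 z2 z3 z4 z5.
by rewrite !gam_row5 !gf_row5; field.
Qed.

Definition crv x y z : 'rV[R]_5 := gam x (gam y z) - gam y (gam x z) - gam (cb x y) z.

Let gam_xy (s z y1 y2 y3 y4 y5 : R) : gam (row5 0 0 0 s z) (row5 y1 y2 y3 y4 y5) = row5
   (- (s * y1) + (s * y2) + 2 / 3 * (s * y3) + (z * y1))
   (s * y2 + (z * y1) - (z * y2) + 2 / 3 * (z * y3))
   (9 / 5 * (s * y1) - 9 / 10 * (s * y2) - 1 / 2 * (s * y5) - 9 / 10 * (z * y1) + 9 / 5 * (z *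
    y2) + 1 / 2 * (z * y4))
   (- (6 / 5 * (s * y3)) - (s * y4) + (s * y5) + 12 / 5 * (z * y3) + (z * y4))
   (- (12 / 5 * (s * y3)) + (s * y5) + 6 / 5 * (z * y3) + (z * y4) - (z * y5)).
Proof. by rewrite gam_row5; congr row5; field. Qed.

Let gam_yx (s z y1 y2 y3 y4 y5 : R) : gam (row5 y1 y2 y3 y4 y5) (row5 0 0 0 s z) = row5
   (- (1 / 3 * (y3 * s)))
   (- (1 / 3 * (y3 * z)))
   (- (1 / 2 * (y4 * z)) + 1 / 2 * (y5 * s))
   (9 / 10 * (y1 * s) + 9 / 10 * (y1 * z) + 9 / 10 * (y2 * s) - 9 / 5 * (y2 * z) - 1 / 10 *
    (y3 * s) + 1 / 5 * (y3 * z) - (y4 * s) + (y4 * z) + (y5 * s))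
   (9 / 5 * (y1 * s) - 9 / 10 * (y1 * z) - 9 / 10 * (y2 * s) - 9 / 10 * (y2 * z) - 1 / 5 * (y3
    * s) + 1 / 10 * (y3 * z) + (y4 * z) + (y5 * s) - (y5 * z)).
Proof. by rewrite gam_row5; congr row5; field. Qed.

(* [y] has the shape of a vector spanning with [x] a plane on which [gf] vanishes, except that
   [gf y y = 0] is not imposed. *)
Lemma crv_quartic (d s z y3 y4 y5 : R) :
  let x := row5 0 0 0 s z in let y := row5 (d * s) (d * z) y3 y4 y5 in
  gf (crv x y y) x = - (189 / 25) * d ^+ 2 * (s ^+ 2 - s * z + z ^+ 2) ^+ 2
    - 3 / 5 * (s ^+ 2 - s * z + z ^+ 2) * gf y y.
Proof.
move=> x y.
(* Metricity moves the outer [gam] to the other argument of [gf]: products of two connection terms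
   become pairings, and no nested [gam] is expanded. *)
have -> : gf (crv x y y) x = gf (gam x y) (gam y x) - gf (gam y y) (gam x x)
    + gf y (gam (cb x y) x).
  have h1 := gam_metric x (gam y y) x; have h2 := gam_metric y (gam x y) x.
  have h3 := gam_metric (cb x y) y x; rewrite /crv !gfB; lra.
have xx : gam x x = row5 0 0 0 (2 * s * z - s ^+ 2) (2 * s * z - z ^+ 2).
  by rewrite gam_row5; congr row5; field.
have xy : gam x y = _ := gam_xy _ _ _ _ _ _ _; have yx : gam y x = _ := gam_yx _ _ _ _ _ _ _.
have yy : gam y y = _ := gam_row5 _ _ _ _ _ _ _ _ _ _.
rewrite xx -gam_torsion [gam x y - _]addrC -[- gam y x]scaleN1r xy yx yy row5_lin gam_yx !gf_row5.
by field.
Qed.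

(** The algebra of [nc_koszul]: [Nxy] is the derivative of [Y] along [X] for [gf], and [G] is the
    gradient of half the logarithm of [h]. *)
Lemma koszul_cancel (h : R) (X Y Z G Nxy Nxz Nyz Nyx Nzx Nzy : 'rV[R]_5) :
  h * gf (Nxy + gf G X *: Y + gf G Y *: X - gf X Y *: G) Z = 2^-1 *
  (2 * h * gf G X * gf Y Z + h * (gf Nxy Z + gf Y Nxz)
   + (2 * h * gf G Y * gf Z X + h * (gf Nyz X + gf Z Nyx))
   - (2 * h * gf G Z * gf X Y + h * (gf Nzx Y + gf X Nzy))
   + h * gf (Nxy - Nyx) Z - h * gf (Nyz - Nzy) X + h * gf (Nzx - Nxz) Y).
Proof.
rewrite !(gfD, gfN, gfZ) (gfC Z X) (gfC Y Nxz) (gfC Z Nyx) (gfC X Nzy).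
by field.
Qed.

(** The algebra of [nc_null]: [P], [Q], [S] are the three terms of the curvature for [gf], and [d1],
    [d2], [d3] are derivatives of [a] and [b], which only multiply vectors of the null plane and
    pair to 0 with [X]. *)
Lemma conformal_cancel (X Y G P Q S Nyy Nxy Nyx B : 'rV[R]_5) (d1 d2 d3 : R) :
  gf X X = 0 -> gf X Y = 0 -> gf Y Y = 0 -> gf Nyx X = 0 -> gf Nxy Y = 0 ->
  gf Nyx Y = - gf Nyy X -> B = Nxy - Nyx ->
  let a := gf G X in let b := gf G Y in
  let W1 := Nyy + (b *: Y + b *: Y) in let W2 := Nxy + (a *: Y + b *: X) in
  gf (P + ((d1 *: Y + b *: Nxy) + (d1 *: Y + b *: Nxy)) + a *: W1 + gf G W1 *: X - gf X W1 *: G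
      - (Q + ((d2 *: Y + a *: Nyy) + (d3 *: X + b *: Nyx)) + b *: W2 + gf G W2 *: Y
         - gf Y W2 *: G)
      - (S + gf G B *: Y + b *: B - gf B Y *: G)) X = gf (P - Q - S) X.
Proof.
move=> xx xy yy nx ny n ->; cbv zeta.
rewrite !(gfD, gfN, gfZ, gfDr, gfZr) (gfC Y X) (gfC X Nyy) (gfC Y Nxy) xx xy yy nx ny n.
by rewrite (gfC G X) (gfC G Y); ring.
Qed.

End Christoffel.

Section LeviCivita.
Context {R : realType}.
Local Notation V := 'M[R]_(3, 2).
Local Notation fV := (@fin_dim_mx R 3 2).
Local Notation f5 := (@fin_dim_mx R 1 5).
Variables (A : R) (A0 : A != 0) (U : set V) (hU : open_in (ants_manifold A) U).
Implicit Types (x y z : V -> 'rV[R]_5) (p q : V) (f : V -> R).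

Definition dl (W : normedModType R) x (f : V -> W) : V -> W := fun p => dif U f p (fld x p).

Lemma dl_smooth (W : normedModType R) x (f : V -> W) : fin_dim W -> smooth_on U x ->
  smooth_on U f -> smooth_on U (dl x f).
Proof. by move=> fW sx sf; exact: (dif_smooth fV fW sf (fld_vfield A0 hU sx)). Qed.

Lemma dl_eq (W : normedModType R) x x' (f f' : V -> W) p : fin_dim W -> U p ->
  smooth_on U f -> x p = x' p -> (forall q, U q -> f q = f' q) -> dl x f p = dl x' f' p.
Proof.
move=> fW Up sf xE fE; have E : fld x p = fld x' p by rewrite /fld xE.
exact: (etrans (dif_eq fV Up (fr_tangent A0 hU x Up) fW sf fE) (congr1 (dif U f' p) E)).
Qed.

Lemma dlD (W : normedModType R) x (f f' : V -> W) p : fin_dim W -> U p ->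
  smooth_on U f -> smooth_on U f' -> dl x (fun q => f q + f' q) p = dl x f p + dl x f' p.
Proof. by move=> fW Up sf sf'; exact: (difD fV Up (fr_tangent A0 hU x Up) fW sf sf'). Qed.

Lemma dl_comm x y (W : normedModType R) (f : V -> W) p : fin_dim W -> U p ->
  smooth_on U x -> smooth_on U y -> smooth_on U f ->
  dl x (dl y f) p - dl y (dl x f) p = dl (br U x y) f p.
Proof. by move=> fW Up sx sy sf; exact: (dif_comm_fld A0 hU fW Up sf sx sy). Qed.

Lemma dl_gf x y z p : U p -> smooth_on U y -> smooth_on U z ->
  dl x (fun q => gf (y q) (z q)) p = gf (dl x y p) (z p) + gf (y p) (dl x z p).
Proof.
move=> Up sy sz; exact: (dif_bilin (@gf_linearl R) (@gf_linearr R) f5 f5 fin_dim_R fV sy sz Up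
  (fr_tangent A0 hU x Up)).
Qed.

Lemma dl_gam x y z p : U p -> smooth_on U y -> smooth_on U z ->
  dl x (fun q => gam (y q) (z q)) p = gam (dl x y p) (z p) + gam (y p) (dl x z p).
Proof.
move=> Up sy sz; exact: (dif_bilin (@gam_linearl R) (@gam_linearr R) f5 f5 f5 fV sy sz Up
  (fr_tangent A0 hU x Up)).
Qed.

Let scl (a : R) (v : 'rV[R]_5) := a *: v.
Let scl_linearl v : linear (scl^~ v).
Proof. by move=> a b c; rewrite /scl scalerDl -scalerA. Qed.
Let scl_linearr a : linear (scl a).
Proof. by move=> b u v; rewrite /scl scalerDr !scalerA mulrC. Qed.

Lemma dl_scale x f y p : U p -> smooth_on U f -> smooth_on U y ->
  dl x (fun q => f q *: y q) p = dl x f p *: y p + f p *: dl x y p.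
Proof.
move=> Up sf sy; exact: (dif_bilin scl_linearl scl_linearr fin_dim_R f5 f5 fV sf sy Up
  (fr_tangent A0 hU x Up)).
Qed.

Lemma smooth_scale f y : smooth_on U f -> smooth_on U y -> smooth_on U (fun q => f q *: y q).
Proof. exact: (smooth_on_bilin scl_linearl scl_linearr fin_dim_R f5). Qed.

Lemma smooth_gf x y : smooth_on U x -> smooth_on U y -> smooth_on U (fun q => gf (x q) (y q)).
Proof. exact: (smooth_on_bilin (@gf_linearl R) (@gf_linearr R) f5 f5). Qed.

Lemma smooth_gam x y : smooth_on U x -> smooth_on U y -> smooth_on U (fun q => gam (x q) (y q)).
Proof. exact: (smooth_on_bilin (@gam_linearl R) (@gam_linearr R) f5 f5). Qed.

(* The Levi-Civita connections: [nb] of the metric [gf], [nc] of [h * gf]. *)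
Definition nb x y : V -> 'rV[R]_5 := fun p => dl x y p + gam (x p) (y p).

Lemma nb_smooth x y : smooth_on U x -> smooth_on U y -> smooth_on U (nb x y).
Proof. by move=> sx sy; exact: (smooth_onD (dl_smooth f5 sx sy) (smooth_gam sx sy)). Qed.

Lemma brE x y p : br U x y p = dl x y p - dl y x p + cb (x p) (y p).
Proof. by []. Qed.

Lemma nb_torsion x y p : br U x y p = nb x y p - nb y x p.
Proof.
rewrite brE /nb -gam_torsion.
by move: (dl x y p) (dl y x p) (gam _ _) (gam _ _) => a b c d; rewrite opprD addrACA.
Qed.

Lemma nb_metric x y z p : U p -> smooth_on U y -> smooth_on U z ->
  dl x (fun q => gf (y q) (z q)) p = gf (nb x y p) (z p) + gf (y p) (nb x z p).
Proof.
move=> Up sy sz; rewrite dl_gf // /nb.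
move: (dl x y p) (dl x z p) => a b; have := gam_metric (x p) (y p) (z p).
rewrite !(gfC (y p)) !gfD; lra.
Qed.

Lemma nbD x y z p : U p -> smooth_on U x -> smooth_on U y -> smooth_on U z ->
  nb x (fun q => y q + z q) p = nb x y p + nb x z p.
Proof.
move=> Up sx sy sz; rewrite /nb dlD //; last exact: f5.
move: (dl x y p) (dl x z p) => a b; have := @gam_linearr R (x p) 1 (y p) (z p).
by rewrite !scale1r => ->; rewrite addrACA.
Qed.

Lemma nb_scale x f y p : U p -> smooth_on U x -> smooth_on U f -> smooth_on U y ->
  nb x (fun q => f q *: y q) p = dl x f p *: y p + f p *: nb x y p.
Proof.
move=> Up sx sf sy; rewrite /nb dl_scale //.
move: (dl x f p) (dl x y p) => a b; have := @gam_linearr R (x p) (f p) (y p) 0.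
have g0 : gam (x p) 0 = 0 by exact: linear_at0 (gam_linearr (x p)).
by rewrite !addr0 g0 addr0 => ->; rewrite scalerDr addrA.
Qed.

(** The second derivatives of [z] combine into its derivative along the bracket and the mixed terms
    cancel, so the curvature is the algebraic expression [crv] in the values at [p]. *)
Lemma nb_curvature x y z p : U p -> smooth_on U x -> smooth_on U y -> smooth_on U z ->
  nb x (nb y z) p - nb y (nb x z) p - nb (br U x y) z p = crv (x p) (y p) (z p).
Proof.
move=> Up sx sy sz.
have E x' y' : smooth_on U x' -> smooth_on U y' ->
   nb x' (nb y' z) p = dl x' (dl y' z) p + gam (dl x' y' p) (z p) + gam (y' p) (dl x' z p)
     + gam (x' p) (dl y' z p) + gam (x' p) (gam (y' p) (z p)).
  move=> sx' sy'; rewrite {1}/nb dlD //; [|exact: f5|exact: (dl_smooth f5 sy' sz)|exact: (smooth_gam sy' sz)].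
  rewrite dl_gam // /nb; have := @gam_linearr R (x' p) 1 (dl y' z p) (gam (y' p) (z p)).
  by rewrite !scale1r => ->; rewrite !addrA.
have [T1 [T2 [e1 e2 C]]] : exists T1 T2 : 'rV[R]_5,
    [/\ dl x (dl y z) p = T1, dl y (dl x z) p = T2 & dl (br U x y) z p = T1 - T2].
  exists (dl x (dl y z) p), (dl y (dl x z) p); split=> //.
  exact: esym (dl_comm f5 Up sx sy sz).
rewrite !E // e1 e2 /nb C brE /crv.
have -> : gam (dl x y p - dl y x p + cb (x p) (y p)) (z p) =
   gam (dl x y p) (z p) - gam (dl y x p) (z p) + gam (cb (x p) (y p)) (z p).
  rewrite -[dl x y p - _]scale1r gam_linearl scale1r; congr (_ + _).
  by rewrite addrC -scaleN1r gam_linearl scaleN1r addrC.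
have cancel (a b c d e f g i j : 'rV[R]_5) :
    (a + c + e + f + g) - (b + d + f + e + i) - (a - b + (c - d + j)) = g - i - j.
  by apply/rowP => k; rewrite !mxE; ring.
exact: cancel.
Qed.

Section Conformal.
Variables (h : V -> R) (sh : smooth_on U h) (h0 : forall p, U p -> h p != 0).

Let al k p : R := dl (fun=> ev k) h p / (2 * h p).

(* The gradient of [log h / 2] for the metric [gf]. *)
Definition gr p : 'rV[R]_5 := row5 (al 5 p) (- al 4 p) (3 / 4 * al 3 p) (- al 2 p) (al 1 p).

Lemma gr_smooth : smooth_on U gr.
Proof.
have sa k : smooth_on U (al k).
  apply: smooth_onM; first exact: (dl_smooth fin_dim_R (@smooth_on_cst _ _ _ U _) sh).
  apply: smooth_onV; first by move=> q Uq; rewrite mulf_neq0 ?h0 // pnatr_eq0.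
  exact: (smooth_onM (@smooth_on_cst _ _ _ U _) sh).
apply: smooth_row5; [exact: sa|exact: (smooth_onN (sa _))| |exact: (smooth_onN (sa _))|exact: sa].
exact: (smooth_onM (@smooth_on_cst _ _ _ U _) (sa _)).
Qed.

Lemma gf_gr x p : U p -> dl x h p = 2 * h p * gf (gr p) (x p).
Proof.
move=> Up; have E := ev_expand (x p) (dif_fr_linear Up sh).
have -> : dl x h p = cf (x p) 1 * dl (fun=> ev 1) h p + cf (x p) 2 * dl (fun=> ev 2) h p
   + cf (x p) 3 * dl (fun=> ev 3) h p + cf (x p) 4 * dl (fun=> ev 4) h p
   + cf (x p) 5 * dl (fun=> ev 5) h p by exact: E.
rewrite /gr /gf !row5E /al; have := h0 Up.
move: (dl _ _ _) (dl _ _ _) (dl _ _ _) (dl _ _ _) (dl _ _ _) => a b c d e hp.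
by field; rewrite hp.
Qed.

Definition nc x y : V -> 'rV[R]_5 := fun p =>
  nb x y p + gf (gr p) (x p) *: y p + gf (gr p) (y p) *: x p - gf (x p) (y p) *: gr p.

Lemma nc_smooth x y : smooth_on U x -> smooth_on U y -> smooth_on U (nc x y).
Proof.
move=> sx sy; have sg := gr_smooth; have s1 := nb_smooth sx sy.
have s2 := smooth_scale (smooth_gf sg sx) sy; have s3 := smooth_scale (smooth_gf sg sy) sx.
exact: (smooth_onB (smooth_onD (smooth_onD s1 s2) s3) (smooth_scale (smooth_gf sx sy) sg)).
Qed.

(** The Koszul formula for [h * gf]: it ties the explicit [nc] to the definition of [nabla]. *)
Lemma nc_koszul x y z p : U p -> smooth_on U x -> smooth_on U y -> smooth_on U z ->
  h p * gf (nc x y p) (z p) = 2^-1 *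
    (dl x (fun q => h q * gf (y q) (z q)) p + dl y (fun q => h q * gf (z q) (x q)) p
     - dl z (fun q => h q * gf (x q) (y q)) p + h p * gf (br U x y p) (z p)
     - h p * gf (br U y z p) (x p) + h p * gf (br U z x p) (y p)).
Proof.
move=> Up sx sy sz.
have E t u v : smooth_on U u -> smooth_on U v -> dl t (fun q => h q * gf (u q) (v q)) p =
    2 * h p * gf (gr p) (t p) * gf (u p) (v p)
    + h p * (gf (nb t u p) (v p) + gf (u p) (nb t v p)).
  move=> su sv; rewrite -(nb_metric t Up su sv) -(gf_gr t Up).
  exact: (difM fV Up (fr_tangent A0 hU t Up) sh (smooth_gf su sv)).
rewrite !E // !nb_torsion.
exact: koszul_cancel.
Qed.

Lemma nc_eq x x' y y' p : U p -> smooth_on U y -> x p = x' p ->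
  (forall q, U q -> y q = y' q) -> nc x y p = nc x' y' p.
Proof. by move=> Up sy xE yE; rewrite /nc /nb (dl_eq f5 Up sy xE yE) xE (yE p Up). Qed.

(** On a totally null plane the correction terms of the conformal change all pair to 0 with [x],
    whatever the derivatives of [h]. *)
Lemma nc_null x y p : U p -> smooth_on U x -> smooth_on U y ->
  (forall q, U q -> gf (x q) (x q) = 0) -> (forall q, U q -> gf (x q) (y q) = 0) ->
  (forall q, U q -> gf (y q) (y q) = 0) ->
  gf (nc x (nc y y) p - nc y (nc x y) p - nc (br U x y) y p) (x p)
  = gf (crv (x p) (y p) (y p)) (x p).
Proof.
move=> Up sx sy xx xy yy; have sg := gr_smooth.
have D0 t f : (forall q, U q -> f q = 0) -> dl t f p = 0.
  move=> fE; have sf : smooth_on U f.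
    by apply: (@smooth_on_eq _ _ _ _ (fun=> 0)) => [q Uq|]; [rewrite fE|exact: smooth_on_cst].
  exact: (etrans (dl_eq fin_dim_R Up sf erefl fE) (dif_cst fV Up (fr_tangent A0 hU t Up) _ fin_dim_R)).
(* The null conditions hold on all of [U], so they can be differentiated: this gives the
   orthogonality relations required by [conformal_cancel]. *)
have m1 t : gf (nb t x p) (x p) = 0.
  by have := nb_metric t Up sx sx; rewrite D0 // (gfC (x p)); lra.
have m2 t : gf (nb t y p) (y p) = 0.
  by have := nb_metric t Up sy sy; rewrite D0 // (gfC (y p)); lra.
have m3 t : gf (nb t x p) (y p) = - gf (nb t y p) (x p).
  by have := nb_metric t Up sx sy; rewrite D0 // (gfC (x p)); lra.
set a := fun q => gf (gr q) (x q); set b := fun q => gf (gr q) (y q).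
have sa : smooth_on U a by exact: smooth_gf.
have sb : smooth_on U b by exact: smooth_gf.
have nyy q : U q -> nc y y q = nb y y q + (b q *: y q + b q *: y q).
  by move=> Uq; rewrite /nc yy // scale0r subr0 addrA.
have nxy q : U q -> nc x y q = nb x y q + (a q *: y q + b q *: x q).
  by move=> Uq; rewrite /nc xy // scale0r subr0 addrA.
have s1 := smooth_scale sb sy; have s2 := smooth_scale sa sy; have s3 := smooth_scale sb sx.
have nyy' := nb_smooth sy sy; have nxy' := nb_smooth sx sy.
rewrite -(nb_curvature Up sx sy sy).
rewrite (nc_eq Up (nc_smooth sy sy) erefl nyy) (nc_eq Up (nc_smooth sx sy) erefl nxy).
have nx : nb x (fun q => nb y y q + (b q *: y q + b q *: y q)) p = nb x (nb y y) p
    + ((dl x b p *: y p + b p *: nb x y p) + (dl x b p *: y p + b p *: nb x y p)).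
  by rewrite (nbD Up sx nyy' (smooth_onD s1 s1)) (nbD Up sx s1 s1) (nb_scale Up sx sb sy).
have ny : nb y (fun q => nb x y q + (a q *: y q + b q *: x q)) p = nb y (nb x y) p
    + ((dl y a p *: y p + a p *: nb y y p) + (dl y b p *: x p + b p *: nb y x p)).
  rewrite (nbD Up sy nxy' (smooth_onD s2 s3)) (nbD Up sy s2 s3) (nb_scale Up sy sa sy).
  by rewrite (nb_scale Up sy sb sx).
rewrite /nc nx ny.
exact: (conformal_cancel (gr p) _ _ _ _ _ _ (xx p Up) (xy p Up) (yy p Up) (m1 y) (m2 x) (m3 y)
  (nb_torsion x y p)).
Qed.

End Conformal.

End LeviCivita.

Section Gram.
Context {R : realType}.

Lemma delta5 i j : (0 < i < 6)%N -> (0 < j < 6)%N ->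
  (1%:M : 'M[R]_5) (ix i) (ix j) = (i == j)%:R.
Proof.
move=> i5 j5; rewrite mxE -val_eqE /= /ix !inordK.
- by move: i5 j5; case: i => // i; case: j.
- by move: j5; case: j.
- by move: i5; case: i.
Qed.

(** The Gram matrix of Cartan's metric in its own frame; indices count from 0, so [i + j == 4] is
    the antidiagonal. *)
Definition gram_cst : 'M[R]_5 :=
  \matrix_(i, j) ((i + j == 4)%N%:R * nth 0 [:: 1; -1; 4 / 3; -1; 1] i).

Lemma gram_cst_unit : gram_cst \in unitmx.
Proof.
pose K : 'M[R]_5 := \matrix_(i, j) ((i + j == 4)%N%:R * nth 0 [:: 1; -1; 3 / 4; -1; 1] i).
have /mulmx1_unit[] // : gram_cst *m K = 1%:M.
apply/matrixP; apply: ord5P; apply: ord5P; rewrite delta5 // mxE sum5 !mxE /ix !inordK //=;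
  by field.
Qed.

End Gram.

(** * Curvature of the metric of an adapted coframe *)

Section CartanMetric.
Context {R : realType}.
Local Notation V := 'M[R]_(3, 2).
Local Notation fV := (@fin_dim_mx R 3 2).
Local Notation f5 := (@fin_dim_mx R 1 5).
Variables (A : R) (A0 : A != 0) (U : set V) (hU : open_in (ants_manifold A) U).
Local Notation D := (@ants_distribution R).
Variables (theta : 'I_5 -> V -> V -> R) (e : 'I_5 -> V -> V).
Hypothesis ad : adapted_coframe U D theta e.
Local Notation g := (cartan_metric theta).
Local Notation det := (fdet (fmc e)).
Implicit Types X Y Z : V -> V.

Let ve i : vfield U (e i) := coframe_vfield ad i.

Lemma gramE p : U p -> \matrix_(i, j) ip g (e i) (e j) p = gram_cst.
Proof.
move=> Up; have th k l := @theta_ix _ _ _ _ ad k l p Up.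
by apply/matrixP; apply: ord5P; apply: ord5P; rewrite [LHS]mxE [RHS]mxE /ip /cartan_metric !th //=
  /ix !inordK //=; field.
Qed.

Lemma metric_frame p v k : U p -> g p v (e k p) = \sum_j theta j p v * gram_cst j k.
Proof.
move=> Up; have th i l := @theta_ix _ _ _ _ ad i l p Up.
rewrite sum5; move: k; apply: ord5P; rewrite [RHS]/= !mxE /cartan_metric !th // /ix !inordK //=;
  by field.
Qed.

(** Raising an index with the inverse Gram matrix recovers a vector from its scalar products; this
    is how [nabla] is built from [koszul]. *)
Lemma metric_dual p v : U p -> tangent U p v ->
  \sum_k \sum_l (gram_inv e g p k l * g p v (e k p)) *: e l p = v.
Proof.
move=> Up tv; rewrite exchange_big [RHS](coframe_expand A0 hU ad Up tv) /=.
apply: eq_bigr => l _; rewrite -scaler_suml; congr (_ *: _).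
pose r : 'rV[R]_5 := \row_j theta j p v.
transitivity ((r *m gram_cst *m invmx gram_cst) 0 l).
  rewrite mxE; apply: eq_bigr => k _; rewrite mulrC /gram_inv gramE //; congr (_ * _).
  by rewrite metric_frame // [RHS]mxE; apply: eq_bigr => j _; congr (_ * _); rewrite mxE.
by rewrite mulmxK ?gram_cst_unit // mxE.
Qed.

Definition cx X : V -> 'rV[R]_5 := fun q => co q (X q).

Lemma cx_smooth X : vfield U X -> smooth_on U (cx X).
Proof. by move=> vX; exact: (fld_of A0 hU vX).1. Qed.

Lemma cx_fld X p : vfield U X -> U p -> X p = fld (cx X) p.
Proof. by move=> vX; exact: (fld_of A0 hU vX).2. Qed.

Definition cfac p : R := (det p ^+ 2)^-1.

Lemma det_smooth : smooth_on U det.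
Proof.
by apply: smooth_onB; apply: smooth_onM; exact: (fmc_smooth A0 hU ad).
Qed.

Lemma det_neq0 p : U p -> det p != 0.
Proof. exact: (fm_det A0 hU ad). Qed.

Lemma cfac_smooth : smooth_on U cfac.
Proof.
apply: smooth_onV; first by move=> p Up; rewrite expf_neq0 // det_neq0.
exact: (smooth_onM det_smooth det_smooth).
Qed.

Lemma cfac_neq0 p : U p -> cfac p != 0.
Proof. by move=> Up; rewrite invr_neq0 // expf_neq0 // det_neq0. Qed.

Lemma metricE p u v : U p -> tangent U p u -> tangent U p v ->
  g p u v = cfac p * gf (co p u) (co p v).
Proof.
move=> Up tu tv; rewrite (metric_gf A0 hU ad Up tu tv) mulKf //.
by rewrite expf_neq0 // det_neq0.
Qed.

Local Notation nc := (nc U cfac).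

Lemma lie_cx X Y p : vfield U X -> vfield U Y -> U p ->
  lie U X Y p = fr (br U (cx X) (cx Y) p) *m p.
Proof.
move=> vX vY Up; have E := lie_eq vX vY (fun q => cx_fld vX) (fun q => cx_fld vY) Up.
exact: (etrans E (lie_fld A0 hU (cx_smooth vX) (cx_smooth vY) Up)).
Qed.

Lemma cx_lie X Y p : vfield U X -> vfield U Y -> U p ->
  co p (lie U X Y p) = br U (cx X) (cx Y) p.
Proof.
move=> vX vY Up.
exact: (etrans (congr1 (co p) (lie_cx vX vY Up)) (co_fr _ (openin_dt A0 hU Up))).
Qed.

Lemma koszulE X Y Z p : vfield U X -> vfield U Y -> vfield U Z -> U p ->
  koszul U g X Y Z p = cfac p * gf (nc (cx X) (cx Y) p) (cx Z p).
Proof.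
move=> vX vY vZ Up; have [sX sY sZ] := And3 (cx_smooth vX) (cx_smooth vY) (cx_smooth vZ).
have dE T T' X' : vfield U T -> vfield U T' -> vfield U X' ->
    dif U (ip g T T') p (X' p) = dl U (cx X') (fun q => cfac q * gf (cx T q) (cx T' q)) p.
  move=> vT vT' vX'.
  have E q : U q -> cfac q * gf (cx T q) (cx T' q) = ip g T T' q.
    by move=> Uq; rewrite /ip metricE //; [exact: vT.2|exact: vT'.2].
  have s := smooth_onM cfac_smooth (smooth_gf (cx_smooth vT) (cx_smooth vT')).
  have E1 := dif_eq fV Up (vX'.2 p Up) fin_dim_R s E.
  exact: (etrans (esym E1) (congr1 (dif U _ p) (cx_fld vX' Up))).
have lE T T' X' : vfield U T -> vfield U T' -> vfield U X' ->
    ip g (lie U T T') X' p = cfac p * gf (br U (cx T) (cx T') p) (cx X' p).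
  move=> vT vT' vX'.
  have E := metricE Up ((lie_vfield A0 hU vT vT').2 p Up) (vX'.2 p Up).
  exact: (etrans E (congr1 (fun u => cfac p * gf u (cx X' p)) (cx_lie vT vT' Up))).
rewrite (nc_koszul A0 hU cfac_smooth cfac_neq0 Up sX sY sZ) /koszul.
have aux (a b c d i j a' b' c' d' i' j' : R) : a = a' -> b = b' -> c = c' -> d = d' -> i = i' ->
    j = j' -> 2^-1 * (a + b - c + d - i + j) = 2^-1 * (a' + b' - c' + d' - i' + j').
  by do 6 ![move=> ->].
exact: (aux _ _ _ _ _ _ _ _ _ _ _ _ (dE _ _ _ vY vZ vX) (dE _ _ _ vZ vX vY) (dE _ _ _ vX vY vZ)
  (lE _ _ _ vX vY vZ) (lE _ _ _ vY vZ vX) (lE _ _ _ vZ vX vY)).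
Qed.

Lemma nc_smooth_cx X Y : vfield U X -> vfield U Y -> smooth_on U (nc (cx X) (cx Y)).
Proof.
by move=> vX vY; exact: (nc_smooth A0 hU cfac_smooth cfac_neq0 (cx_smooth vX) (cx_smooth vY)).
Qed.

Lemma nablaE X Y p : vfield U X -> vfield U Y -> U p ->
  nabla U e g X Y p = fld (nc (cx X) (cx Y)) p.
Proof.
move=> vX vY Up; have tn := fr_tangent A0 hU (nc (cx X) (cx Y)) Up.
rewrite -[RHS](metric_dual Up tn) /nabla; apply: eq_bigr => k _; apply: eq_bigr => l _.
rewrite (koszulE vX vY (ve k) Up); congr ((_ * _) *: _).
rewrite (metricE Up tn ((ve k).2 p Up)).
by rewrite (co_fld A0 hU _ Up).
Qed.

Lemma nabla_vfield X Y : vfield U X -> vfield U Y -> vfield U (nabla U e g X Y).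
Proof.
move=> vX vY; have [s t] := fld_vfield A0 hU (nc_smooth_cx vX vY).
split=> [|p Up]; first by apply: smooth_on_eq s => p Up; rewrite nablaE.
by rewrite nablaE //; exact: t.
Qed.

Lemma nabla_nabla X Y Z p : vfield U X -> vfield U Y -> vfield U Z -> U p ->
  nabla U e g X (nabla U e g Y Z) p = fr (nc (cx X) (nc (cx Y) (cx Z)) p) *m p.
Proof.
move=> vX vY vZ Up; have vN := nabla_vfield vY vZ.
have E q : U q -> cx (nabla U e g Y Z) q = nc (cx Y) (cx Z) q.
  move=> Uq; exact: (etrans (congr1 (co q) (nablaE vY vZ Uq)) (co_fld A0 hU _ Uq)).
have E' := nc_eq A0 hU cfac Up (cx_smooth vN) (erefl (cx X p)) E.
exact: (etrans (nablaE vX vN Up) (congr1 (fun u => fr u *m p) E')).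
Qed.

Lemma riemE X Y Z p : vfield U X -> vfield U Y -> vfield U Z -> U p ->
  co p (riem U e g X Y Z p) = nc (cx X) (nc (cx Y) (cx Z)) p - nc (cx Y) (nc (cx X) (cx Z)) p
    - nc (br U (cx X) (cx Y)) (cx Z) p
  /\ tangent U p (riem U e g X Y Z p).
Proof.
move=> vX vY vZ Up; have vL := lie_vfield A0 hU vX vY.
have E1 := nabla_nabla vX vY vZ Up; have E2 := nabla_nabla vY vX vZ Up.
have E3 : nabla U e g (lie U X Y) Z p = fr (nc (br U (cx X) (cx Y)) (cx Z) p) *m p.
  have E := @nc_eq _ _ A0 _ hU cfac (cx (lie U X Y)) (br U (cx X) (cx Y)) (cx Z) _ p Up
    (cx_smooth vZ) (cx_lie vX vY Up) (fun q _ => erefl).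
  exact: (etrans (nablaE vL vZ Up) (congr1 (fun u => fr u *m p) E)).
rewrite /riem E1 E2 E3; move: (nc _ _ p) (nc _ _ p) (nc _ _ p) => u v w.
rewrite -!mulmxBl -!frB; split; last exact: (fr_tan A0 hU).
by rewrite co_fr //; exact: (openin_dt A0 hU).
Qed.

Definition ecomb (s z : R) i j : V -> V := fun q => s *: e (ix i) q + z *: e (ix j) q.

Lemma cx_ecomb s z i j p : U p -> cx (ecomb s z i j) p = s *: fm e i p + z *: fm e j p.
Proof.
move=> Up; rewrite /cx /ecomb !(fm_fld A0 hU ad _ Up) /fld !scalemxAl -mulmxDl -!linearZ -frD.
by rewrite co_fr //; exact: (openin_dt A0 hU).
Qed.

Lemma ecomb_fld s z i j p : U p ->
  fld (fun q => s *: fm e i q + z *: fm e j q) p = ecomb s z i j p.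
Proof.
move=> Up; rewrite /ecomb !(fm_fld A0 hU ad _ Up) /fld !scalemxAl -mulmxDl -!linearZ -frD.
by [].
Qed.

Lemma ecomb_vfield s z i j : vfield U (ecomb s z i j).
Proof.
have sm k c := smooth_scale (@smooth_on_cst _ _ _ U c) (fm_smooth A0 hU ad k).
have [t1 t2] := fld_vfield A0 hU (smooth_onD (sm i s) (sm j z)).
split=> [|p Up]; last by rewrite -(ecomb_fld _ _ _ _ Up); exact: t2.
exact: (smooth_on_eq (fun q Uq => ecomb_fld s z i j Uq) t1).
Qed.

Lemma null_plane s z p : U p -> let x := ecomb s z 4 5 p in let y := ecomb s z 1 2 p in
  [/\ g p x x = 0, g p x y = 0, g p y x = 0 & g p y y = 0].
Proof.
move=> Up /=; have th k l := @theta_ix _ _ _ _ ad k l p Up.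
by split; rewrite /cartan_metric /ecomb !(theta_comb A0 hU ad) // !th //=; ring.
Qed.

Lemma null_gf s z p : U p ->
  [/\ gf (cx (ecomb s z 4 5) p) (cx (ecomb s z 4 5) p) = 0,
      gf (cx (ecomb s z 4 5) p) (cx (ecomb s z 1 2) p) = 0 &
      gf (cx (ecomb s z 1 2) p) (cx (ecomb s z 1 2) p) = 0].
Proof.
move=> Up; have [xx xy _ yy] := null_plane s z Up.
have tx := (ecomb_vfield s z 4 5).2 p Up; have ty := (ecomb_vfield s z 1 2).2 p Up.
by split; rewrite (metric_gf A0 hU ad Up) ?xx ?xy ?yy ?mulr0.
Qed.

Lemma quartic_value s z p : U p ->
  let S := s * fmc e 4 4 p + z * fmc e 5 4 p in
  let Z := s * fmc e 4 5 p + z * fmc e 5 5 p in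
  quartic_in U theta e p s z = - (189 / 25) * (S ^+ 2 - S * Z + Z ^+ 2) ^+ 2.
Proof.
move=> Up S Z; have [xx xy yx yy] := null_plane s z Up.
have vX := ecomb_vfield s z 4 5; have vY := ecomb_vfield s z 1 2.
have [xE yE] : cx (ecomb s z 4 5) p = row5 0 0 0 S Z /\
    exists y3 y4 y5, cx (ecomb s z 1 2) p = row5 (det p * S) (det p * Z) y3 y4 y5.
  have [m41 m42 m43] := fm_D A0 hU ad (isT : (3 < 4 < 6)%N) Up.
  have [m51 m52 m53] := fm_D A0 hU ad (isT : (3 < 5 < 6)%N) Up.
  have [m11 m12 m21 m22] := fm_shape A0 hU ad Up.
  rewrite !cx_ecomb // -!(fm_row e _ p) m41 m42 m43 m51 m52 m53 m11 m12 m21 m22.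
  have lin (a b x1 x2 x3 x4 x5 y1 y2 y3 y4 y5 : R) :
      a *: row5 x1 x2 x3 x4 x5 + b *: row5 y1 y2 y3 y4 y5 = row5 (a * x1 + b * y1)
        (a * x2 + b * y2) (a * x3 + b * y3) (a * x4 + b * y4) (a * x5 + b * y5).
    by apply: row5P; rewrite !mxE /ix !inordK.
  split; first by rewrite lin; congr row5; rewrite /S /Z; ring.
  (* The last three coordinates are left unspecified: [crv_quartic] allows arbitrary ones. *)
  do 3 eexists; rewrite lin; congr row5; rewrite /S /Z; ring.
have nXX q : U q -> gf (cx (ecomb s z 4 5) q) (cx (ecomb s z 4 5) q) = 0.
  by move=> Uq; have [] := null_gf s z Uq.
have nXY q : U q -> gf (cx (ecomb s z 4 5) q) (cx (ecomb s z 1 2) q) = 0.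
  by move=> Uq; have [] := null_gf s z Uq.
have nYY q : U q -> gf (cx (ecomb s z 1 2) q) (cx (ecomb s z 1 2) q) = 0.
  by move=> Uq; have [] := null_gf s z Uq.
have [R1 tR] := riemE vX vY vY Up.
have R2 := nc_null A0 hU cfac_smooth cfac_neq0 Up (cx_smooth vX) (cx_smooth vY) nXX nXY nYY.
have R3 : ip g (riem U e g (ecomb s z 4 5) (ecomb s z 1 2) (ecomb s z 1 2)) (ecomb s z 4 5) p =
    - (189 / 25) * (S ^+ 2 - S * Z + Z ^+ 2) ^+ 2.
  have E1 := metricE Up tR (vX.2 p Up).
  have E2 := congr1 (fun u => cfac p * gf u (cx (ecomb s z 4 5) p)) R1.
  have E3 := congr1 (fun u => cfac p * u) R2.
  apply: (etrans E1 (etrans E2 (etrans E3 _))).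
  (* Nullity of the second vector removes the last term of [crv_quartic], and the conformal factor
     cancels [det p ^+ 2]. *)
  have yn := nYY p Up; have [y3 [y4 [y5 yE']]] := yE; rewrite yE' in yn *.
  rewrite xE crv_quartic yn /cfac; have d0 := det_neq0 Up.
  by move: (det p) d0 => d d0; field.
(* Every Ricci or scalar term of [weyl] carries a scalar product of two vectors of the null plane,
   so no Ricci curvature is computed. *)
have aux (a b c c' d f k l x y u v : R) : x = 0 -> y = 0 -> u = 0 -> v = 0 ->
    a - c * (b * x - d * u + f * y - k * v) + c' * l * (y * x - v * u) = a.
  by move=> -> -> -> ->; ring.
exact: (etrans (aux _ _ _ _ _ _ _ _ _ _ _ _ xx yy yx xy) R3).
Qed.

End CartanMetric.

(** * The root type of the quartic *)

Section TypeD.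
Context {R : realType}.
Variables (k al be ga : R) (k0 : k != 0) (disc : be ^+ 2 < 4 * al * ga).

Let ga0 : ga != 0.
Proof.
apply/eqP => g0; move: disc; rewrite g0 mulr0 => /(le_lt_trans (sqr_ge0 be)).
by rewrite ltxx.
Qed.

Lemma definite_form_eq0 s z : al * s ^+ 2 + be * s * z + ga * z ^+ 2 = 0 -> s = 0 /\ z = 0.
Proof.
(* Completing the square in [4 * ga] times the form. *)
move=> E; have F : (2 * ga * z + be * s) ^+ 2 + (4 * al * ga - be ^+ 2) * s ^+ 2 = 0.
  by transitivity (4 * ga * (al * s ^+ 2 + be * s * z + ga * z ^+ 2)); [ring|rewrite E mulr0].
have d0 : 0 < 4 * al * ga - be ^+ 2 by rewrite subr_gt0.
have s0 : s = 0.
  have sq1 := sqr_ge0 (2 * ga * z + be * s); have sq2 := mulr_ge0 (ltW d0) (sqr_ge0 s).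
  have /eqP : (4 * al * ga - be ^+ 2) * s ^+ 2 = 0 by lra.
  by rewrite mulf_eq0 gt_eqF //= sqrf_eq0 => /eqP.
split=> //; move/eqP: E; rewrite s0 expr0n /= !mulr0 mul0r !add0r mulf_eq0 (negbTE ga0) /=.
by rewrite sqrf_eq0 => /eqP.
Qed.

Let D : R := Num.sqrt (4 * al * ga - be ^+ 2).
Let D0 : 0 < D. Proof. by rewrite sqrtr_gt0 subr_gt0. Qed.
Let DD : D ^+ 2 = 4 * al * ga - be ^+ 2. Proof. by rewrite sqr_sqrtr // subr_ge0 ltW. Qed.
Let w : R[i] := Complex (- be / (2 * ga)) (D / (2 * ga)).
Local Notation c := (real_complex R).

(** Vieta's formulas: [w] and its conjugate are the roots of [ga X^2 + be X + al], the form at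
    [s = 1]. *)
Let w_sum : c ga * (w + conjc w) = - c be.
Proof. by apply/eqP; rewrite eq_complex /=; apply/andP; split; apply/eqP; field. Qed.

Let w_prod : c ga * (w * conjc w) = c al.
Proof.
have E : al = (D ^+ 2 + be ^+ 2) / (4 * ga) by rewrite DD; field.
apply/eqP; rewrite eq_complex /=; apply/andP; split; apply/eqP; last by field.
by rewrite [RHS]E; field.
Qed.

Let P : {poly R} := Poly [:: k * al ^+ 2; 2 * k * al * be; k * (be ^+ 2 + 2 * al * ga);
  2 * k * be * ga; k * ga ^+ 2].

Let P_fact : map_poly c P =
  (c k * c ga ^+ 2)%:P * (('X - w%:P) ^+ 2 * ('X - (conjc w)%:P) ^+ 2).
Proof.
have E : P = k%:P * (ga%:P * 'X ^+ 2 + be%:P * 'X + al%:P) ^+ 2.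
  by rewrite /P /= !cons_poly_def; ring.
have F : map_poly c P = (c k)%:P * ((c ga)%:P * 'X ^+ 2 + (c be)%:P * 'X + (c al)%:P) ^+ 2.
  by rewrite E !(rmorphM, rmorphD, rmorphXn) /= !map_polyC !map_polyX.
rewrite F -w_prod -[c be]opprK -w_sum; ring.
Qed.

Lemma square_type_D (Q : R -> R -> R) :
  (forall s z, Q s z = k * (al * s ^+ 2 + be * s * z + ga * z ^+ 2) ^+ 2) ->
  type_D_nonreal Q /\ no_real_root Q.
Proof.
move=> QE; have g2 : k * ga ^+ 2 != 0 by rewrite mulf_neq0 // expf_neq0.
split; last first.
  move=> s z /eqP; rewrite QE mulf_eq0 (negbTE k0) sqrf_eq0 /= => /eqP.
  exact: definite_form_eq0.
have PE : P = [:: k * al ^+ 2; 2 * k * al * be; k * (be ^+ 2 + 2 * al * ga); 2 * k * be * ga;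
    k * ga ^+ 2] :> seq R by rewrite /P (@PolyK _ 0) //=.
exists P; split.
- move=> s z; rewrite QE !big_ord_recr big_ord0 /= PE /=; ring.
- by rewrite PE.
exists w; split; first by rewrite /= mulf_neq0 ?invr_eq0 ?mulf_neq0 ?pnatr_eq0 // gt_eqF.
move=> u; rewrite P_fact.
have c0 : c k * c ga ^+ 2 != 0 by rewrite -rmorphXn -rmorphM fmorph_eq0.
have X0 v n : ('X - v%:P : {poly R[i]}) ^+ n != 0 by rewrite expf_neq0 // polyXsubC_eq0.
rewrite mupMr ?rootC // mupM // !mup_XsubCX.
have ww : w != conjc w.
  rewrite eq_complex /= eqxx /= -addr_eq0 -mulr2n mulrn_eq0 /=.
  by rewrite mulf_neq0 ?invr_eq0 ?mulf_neq0 ?pnatr_eq0 // gt_eqF.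
rewrite (eq_sym w) (eq_sym (conjc w)); case: (eqVneq u w) => [->|uw] /=.
  by rewrite (negbTE ww).
by case: eqP.
Qed.

End TypeD.

Lemma cartan_quartic_type (R : realType) (A : R) p Q : A != 0 ->
  cartan_quartic (ants_manifold A) (@ants_distribution R) p Q ->
  type_D_nonreal Q /\ no_real_root Q.
Proof.
move=> A0 [U [theta [e [hU Up ad ->]]]].
pose a := fmc e 4 4 p; pose b := fmc e 5 4 p; pose c := fmc e 4 5 p; pose d := fmc e 5 5 p.
apply: (@square_type_D _ (- (189 / 25)) (a ^+ 2 - a * c + c ^+ 2)
  (2 * a * b - a * d - b * c + 2 * c * d) (b ^+ 2 - b * d + d ^+ 2)).
- by rewrite oppr_eq0 mulf_neq0 // ?invr_eq0 pnatr_eq0.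
(* [4 al ga - be^2] equals [3 det^2]: the discriminant -3 of [S^2 - S Z + Z^2] is multiplied by the
   square of the determinant of the substitution. *)
- rewrite -subr_gt0; have : 0 < 3 * fdet (fmc e) p ^+ 2.
    by rewrite mulr_gt0 // exprn_even_gt0 //= (fm_det A0 hU ad Up).
  by congr (_ < _); rewrite /fdet -/a -/b -/c -/d; ring.
- move=> s z; rewrite (quartic_value A0 hU ad s z Up) -/a -/b -/c -/d.
  by congr (_ * _ ^+ 2); ring.
Qed.

Theorem theorem3p3 (R : realType) (A : R) (hA : A != 0) :
  let M := ants_manifold A in
  let D := @ants_distribution R in
  [/\ (forall U : set 'M[R]_(3, 2),
         open_in M U -> U !=set0 -> connected U ->
         lie_isomorphic sl2R2 sl2R2_bracket U [set X | symmetry_field U D X]),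
      [/\ homogeneous M D, is_235 M D &
          exists E : 'M[R]_2 * 'cV[R]_2 -> set ('M[R]_2 * 'cV[R]_2),
            [/\ is_distribution SL2R2 2 E, left_invariant E &
                locally_equivalent M D SL2R2 E]] &
      forall p, M p ->
        (exists Q, cartan_quartic M D p Q) /\
        (forall Q, cartan_quartic M D p Q -> type_D_nonreal Q /\ no_real_root Q)].
Proof.
move=> M D; split.
- by move=> U hU U0 cU; exact: (symmetry_algebra hA hU U0 cU).
- split; [exact: (ants_homogeneous hA)|exact: (ants_is_235 hA)|exists (group_distribution A); split].
  + exact: (group_is_distribution hA).
  + exact: (group_left_invariant hA).
  + exact: (group_equivalent hA).
- move=> p Mp; split; first exact: (cartan_quartic_exists hA Mp).
  by move=> Q; exact: (cartan_quartic_type hA).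
Qed.
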